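(* For every strict $\omega$-category $C$, the cubical nerve $N(C)$ is a complete stratified precubical set.
   Context: **Precubical sets.** A precubical set $X$ is a sequence of sets $X_0,X_1,\dots$ with face operations $\partial_i^\alpha\colon X_n\to X_{n-1}$ ($n\ge 1$, $1\le i\le n$, $\alpha\in\{-,+\}$) such that $\partial_i^\alpha\partial_j^\beta=\partial_j^\beta\partial_{i+1}^\alpha$ for $i\ge j$. Elements of $X_n$ are called $n$-cubes. A precubical operation on $n$-cubes is a formal composite of face operations starting at $n$-cubes, modulo these relations; each has a unique standard decomposition $\partial_{i(1)}^{\alpha(1)}\cdots\partial_{i(p)}^{\alpha(p)}$ with $1\le i(1)<\dots<i(p)\le n$ (the identity when $p=0$). Signs are multiplied as $\pm1$, and $(-)^m$ is the sign of $(-1)^m$. **Shells and boxes.** For $n\ge1$, an $n$-shell $s$ in $X$ is a family of $(n-1)$-cubes $s_i^\alpha$, indexed by the $2n$ face operations on $n$-cubes, with $\partial_i^\alpha s_j^\beta=\partial_j^\beta s_{i+1}^\alpha$ for $i\ge j$. An $n$-box $b$ opposite $\partial_k^\gamma$ is a family of $(n-1)$-cubes $b_i^\alpha$, indexed by the $2n-1$ face operations $\partial_i^\alpha\ne\partial_k^\gamma$ on $n$-cubes, with the same relations whenever both sides make sense. A filler of a shell (box) is an $n$-cube $x$ with $\partial_i^\alpha x=s_i^\alpha$ (resp. $b_i^\alpha$) for all indices that occur. A non-identity precubical operation $\theta=\partial_{i(1)}^{\alpha(1)}\cdots\partial_{i(p)}^{\alpha(p)}$ acts on a shell by $\theta s=\partial_{i(1)}^{\alpha(1)}\cdots\partial_{i(p-1)}^{\alpha(p-1)}s_{i(p)}^{\alpha(p)}$,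 and similarly on a box $b$ opposite $\partial_k^\gamma$ when $\theta\neq\partial_k^\gamma$. **Complementary operations.** A precubical operation $\theta$ on $n$-cubes is complementary to $\partial_k^\gamma$ if its standard decomposition has no factor $\partial_k^-$ or $\partial_k^+$ and inserting $\partial_k^{-\gamma}$ (in the place making indices increasing) gives a standard decomposition $\partial_{i(1)}^{\alpha(1)}\cdots\partial_{i(p)}^{\alpha(p)}$ for which the sign $(-)^{i(r)-r}\alpha(r)$ is independent of $r$. (For face operations: $\partial_l^\delta$ is complementary to $\partial_k^\gamma$ iff $k\ne l$ and $(-)^k\gamma=(-)^l\delta$.) **Stratifications.** A stratified precubical set is a precubical set $X$ with subsets $t_nX\subseteq X_n$ for $n\ge1$, whose members are called thin ($0$-cubes are never thin). A box $b$ opposite $\partial_k^\gamma$ is admissible if $\theta b$ is thin for every non-identity $\theta$ complementary to $\partial_k^\gamma$. A shell $s$ is admissible if there are distinct non-complementary face operations $\partial_k^\gamma,\partial_l^\delta$ with $s_k^\gamma=s_l^\delta$ such that the two boxes got by removing $s_k^\gamma$, respectively $s_l^\delta$, from $s$ are both admissible. A stratified precubical set is complete if (i) every admissible box and every admissible shell has a unique thin filler; and (ii) if $x$ is the thin filler of an admissible box $b$ opposite $\partial_k^\gamma$ and all $b_i^\alpha$ are thin, then $\partial_k^\gamma x$ is thin. **$\omega$-categories.** A (strict) $\omega$-category is a set $C$ with, for each $p\ge0$, unary operations $d_p^-,d_p^+$ and a partial binary operation $\#_p$ such that: $x\#_p y$ is defined iff $d_p^+x=d_p^-y$; for each $p$,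 $C$ is the set of morphisms of a category under $\#_p$, with $d_p^-x$, $d_p^+x$ the left and right identities of $x$; $d_p^\alpha d_q^\beta=d_q^\beta d_p^\alpha=d_p^\alpha$ for $p<q$; $d_p^\alpha(x\#_q y)=d_p^\alpha x\#_q d_p^\alpha y$ for $p\ne q$; $(x\#_p y)\#_q(z\#_p w)=(x\#_q z)\#_p(y\#_q w)$ for $p\ne q$ whenever both sides are defined; every element is an identity for some $\#_p$ (i.e. $d_p^-x=d_p^+x=x$). Morphisms preserve all the operations. **Cubes.** Let $I$ be the free augmented chain complex with basis $u_1$ in degree $1$ and $\partial^-u_1,\partial^+u_1$ in degree $0$, with $\partial u_1=\partial^+u_1-\partial^-u_1$ and $\epsilon\partial^\pm u_1=1$. Let $I^n=I\otimes\cdots\otimes I$ ($n$ factors, $\partial(x\otimes y)=\partial x\otimes y+(-1)^{\deg x}x\otimes\partial y$), with its tensor product basis (standard basis) and $u_n=u_1\otimes\cdots\otimes u_1$. Let $\check\partial_i^\alpha\colon I^{n-1}\to I^n$, $x\otimes y\mapsto x\otimes\partial^\alpha u_1\otimes y$ for $x\in I^{i-1}$, $y\in I^{n-i}$. For chains, $x\ge0$ means $x$ is a sum of standard basis elements. The $\omega$-category $\nu I^n$ is the set of double sequences $x=(x_0^-,x_0^+\mid x_1^-,x_1^+\mid\dots)$ with $x_i^\pm$ $i$-chains in $I^n$, $x_i^\pm\ge0$, $\epsilon x_0^\pm=1$, $x_i^+-x_i^-=\partial x_{i+1}^-=\partial x_{i+1}^+$; here $d_p^\alpha x=(x_0^-,x_0^+\mid\dots\mid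 x_{p-1}^-,x_{p-1}^+\mid x_p^\alpha,x_p^\alpha\mid0,0\mid\dots)$, and if $d_p^+x=d_p^-y=w$ then $x\#_p y=x-w+y$ termwise. The maps $\check\partial_i^\alpha$ induce morphisms $\nu I^{n-1}\to\nu I^n$. For a chain $c$ of positive degree write $\partial c=\partial^+c-\partial^-c$ with $\partial^\pm c$ the positive and negative parts in the standard basis. The atom $\langle u_n\rangle\in\nu I^n$ has $\langle u_n\rangle_q^\alpha=(\partial^\alpha)^{n-q}u_n$ for $q\le n$ and $0$ for $q>n$. **Cubical nerve.** The cubical nerve $N(C)$ of an $\omega$-category $C$ is the stratified precubical set with $N(C)_n=\hom(\nu I^n,C)$, $\partial_i^\alpha x=x\circ\check\partial_i^\alpha$, where an $n$-cube $x\colon\nu I^n\to C$ ($n\ge1$) is thin iff $x\langle u_n\rangle$ is an identity for $\#_{n-1}$. *)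

(* Defs.v *)
From mathcomp Require Import all_boot all_order all_algebra.
From mathcomp Require Import boolp.
Set Implicit Arguments.
Unset Strict Implicit.
Unset Printing Implicit Defensive.
Import Order.TTheory GRing.Theory Num.Theory.
Local Open Scope nat_scope.

(* Conventions: signs are booleans ([true] is +, [false] is -), and the sign   *)
(* (-)^m a is [odd m (+) a].  The directions 1 .. n of an n-cube are numbered  *)
(* from 0, as elements of 'I_n; this changes neither the order of the indices  *)
(* nor the differences i(r) - r, with r also numbered from 0.                  *)

Definition ord_same n (j : 'I_n.-1) : 'I_n := widen_ord (leq_pred n) j.

Fact ord_next_subproof n (i : 'I_n.-1) : i.+1 < n.
Proof. by rewrite -ltn_predRL. Qed.

Definition ord_next n (i : 'I_n.-1) : 'I_n := Ordinal (ord_next_subproof i).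

(* Since 'I_0 is empty, the faces of 0-cubes carry no data. *)
Record precubical := Precubical {
  cubes :> nat -> Type;
  face : forall n, 'I_n -> bool -> cubes n -> cubes n.-1;
  face_face : forall n (i j : 'I_n.-1) (a b : bool) (x : cubes n), j <= i ->
    face i a (face (ord_same j) b x) = face j b (face (ord_next i) a x)
}.

(* Words of face operations from n-cubes to m-cubes: [op_snoc w i a] is the    *)
(* composite of w with the face operation (i, a), the latter applied first.    *)
Inductive face_word (m : nat) : nat -> Type :=
| op_id : face_word m m
| op_snoc n (w : face_word m n.-1) (i : 'I_n) (a : bool) : face_word m n.

Arguments op_id {m}.

Fixpoint factors m n (w : face_word m n) : seq (nat * bool) :=
  match w with
  | op_id => [::]
  | op_snoc _ w' i a => rcons (factors w') (nat_of_ord i, a)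
  end.

Definition standard (fs : seq (nat * bool)) : Prop :=
  sorted ltn [seq f.1 | f <- fs].

Fixpoint op_apply (X : precubical) m n (w : face_word m n) : X n -> X m :=
  match w in face_word _ n return X n -> X m with
  | op_id => id
  | op_snoc _ w' i a => fun x => op_apply w' (face i a x)
  end.

Definition face_op n (i : 'I_n) (a : bool) : face_word n.-1 n :=
  op_snoc op_id i a.

Definition insert_face (k : nat) (g : bool) (fs : seq (nat * bool)) :=
  [seq f <- fs | f.1 < k] ++ (k, g) :: [seq f <- fs | k < f.1].

Definition constant_sign (fs : seq (nat * bool)) : Prop :=
  exists e : bool, forall r, r < size fs ->
    let f := nth (0, false) fs r in odd (f.1 - r) (+) f.2 = e.

(* A precubical operation is represented by its standard decomposition w.      *)
Definition complementary m n (w : face_word m n) (k : 'I_n) (g : bool) : Prop :=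
  [/\ standard (factors w),
      nat_of_ord k \notin [seq f.1 | f <- factors w] &
      constant_sign (insert_face k (~~ g) (factors w))].

Record shell (X : precubical) (n : nat) := Shell {
  shell_face :> 'I_n -> bool -> X n.-1;
  shell_dim : 0 < n;
  shell_rel : forall (i j : 'I_n.-1) (a b : bool), j <= i ->
    face i a (shell_face (ord_same j) b) = face j b (shell_face (ord_next i) a)
}.

Record box (X : precubical) (n : nat) (k : 'I_n) (g : bool) := Box {
  box_face :> forall (i : 'I_n) (a : bool), (i, a) != (k, g) -> X n.-1;
  box_rel : forall (i j : 'I_n.-1) (a b : bool)
      (hj : (ord_same j, b) != (k, g)) (hi : (ord_next i, a) != (k, g)),
    j <= i -> face i a (box_face hj) = face j b (box_face hi)
}.

Definition shell_filler X n (s : shell X n) (x : X n) : Prop :=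
  forall i a, face i a x = s i a.

Definition box_filler X n (k : 'I_n) g (b : box X k g) (x : X n) : Prop :=
  forall i a (h : (i, a) != (k, g)), face i a x = b i a h.

Definition remove_face X n (s : shell X n) (k : 'I_n) (g : bool) : box X k g :=
  @Box X n k g (fun i a _ => s i a)
    (fun i j a b _ _ hij => @shell_rel X n s i j a b hij).

Record stratified := Stratified {
  strat_cubes :> precubical;
  thin : forall n, strat_cubes n -> Prop;
  thin_dim : forall x : strat_cubes 0, ~ thin x
}.

(* The non-identity operations are those of the form [op_snoc w i a], and such *)
(* an operation sends b to the image under w of the member b_i^a.  The member  *)
(* exists, i.e. a proof h exists, as soon as the operation is complementary to *)
(* (k, g): the index k does not then occur among its factors.                  *)
Definition admissible_box (X : stratified) n (k : 'I_n) g (b : box X k g) :=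
  forall m (w : face_word m n.-1) (i : 'I_n) (a : bool)
    (h : (i, a) != (k, g)),
  complementary (op_snoc w i a) k g -> thin (op_apply w (b i a h)).

Definition admissible_shell (X : stratified) n (s : shell X n) :=
  exists (k l : 'I_n) (g d : bool),
    [/\ (k, g) <> (l, d),
        ~ complementary (face_op l d) k g,
        s k g = s l d,
        admissible_box (remove_face s k g) &
        admissible_box (remove_face s l d)].

Definition complete (X : stratified) : Prop :=
  [/\ forall n (k : 'I_n) g (b : box X k g), admissible_box b ->
        exists! x : X n, thin x /\ box_filler b x,
      forall n (s : shell X n), admissible_shell s ->
        exists! x : X n, thin x /\ shell_filler s x &
      forall n (k : 'I_n) g (b : box X k g) (x : X n),
        admissible_box b -> thin x -> box_filler b x ->
        (forall i a (h : (i, a) != (k, g)), thin (b i a h)) ->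
        thin (face k g x)].

(* The composite of x and y under #_p takes a proof of d_p^+ x = d_p^- y as an *)
(* argument.  An equation between composites is required for all proofs that   *)
(* its two sides are defined.                                                  *)
Record omega_cat := OmegaCat {
  ocar :> Type;
  od : nat -> bool -> ocar -> ocar;
  ocomp : forall p (x y : ocar), od p true x = od p false y -> ocar;
  od_od : forall p a b x, od p b (od p a x) = od p a x;
  od_comp_src : forall p x y (h : od p true x = od p false y),
    od p false (ocomp h) = od p false x;
  od_comp_tgt : forall p x y (h : od p true x = od p false y),
    od p true (ocomp h) = od p true y;
  ocomp_idl : forall p x (h : od p true (od p false x) = od p false x),
    ocomp h = x;
  ocomp_idr : forall p x (h : od p true x = od p false (od p true x)),
    ocomp h = x;
  ocompA : forall p x y z
      (hxy : od p true x = od p false y) (hyz : od p true y = od p false z)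
      (hl : od p true (ocomp hxy) = od p false z)
      (hr : od p true x = od p false (ocomp hyz)),
    ocomp hl = ocomp hr;
  od_lt : forall p q a b x, p < q ->
    od p a (od q b x) = od p a x /\ od q b (od p a x) = od p a x;
  od_comp : forall p q a x y (h : od q true x = od q false y)
      (h' : od q true (od p a x) = od q false (od p a y)), p <> q ->
    od p a (ocomp h) = ocomp h';
  ocomp_interchange : forall p q x y z w
      (hxy : od p true x = od p false y) (hzw : od p true z = od p false w)
      (hxz : od q true x = od q false z) (hyw : od q true y = od q false w)
      (hl : od q true (ocomp hxy) = od q false (ocomp hzw))
      (hr : od p true (ocomp hxz) = od p false (ocomp hyw)), p <> q ->
    ocomp hl = ocomp hr;
  od_dim : forall x, exists p, od p false x = x /\ od p true x = x
}.

Definition is_identity (C : omega_cat) (p : nat) (x : C) : Prop :=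
  od p false x = x /\ od p true x = x.

Record omega_hom (C D : omega_cat) := OmegaHom {
  ohom :> C -> D;
  ohom_d : forall p a x, ohom (od p a x) = od p a (ohom x);
  ohom_comp : forall p x y (h : od p true x = od p false y)
      (h' : od p true (ohom x) = od p false (ohom y)),
    ohom (ocomp h) = ocomp h'
}.

Lemma omega_hom_ext (C D : omega_cat) (f g : omega_hom C D) :
  (forall x, f x = g x) -> f = g.
Proof.
case: f => f fd fc; case: g => g gd gc /= /funext fg.
by move: fd fc; rewrite fg => fd fc; congr OmegaHom; exact: Prop_irrelevance.
Qed.

Lemma omega_comp_d (B C D : omega_cat) (g : omega_hom C D) (f : omega_hom B C)
    p a (x : B) :
  g (f (od p a x)) = od p a (g (f x)).
Proof. by rewrite !ohom_d. Qed.

Lemma omega_comp_comp (B C D : omega_cat) (g : omega_hom C D)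
    (f : omega_hom B C) p (x y : B) (h : od p true x = od p false y)
    (h' : od p true (g (f x)) = od p false (g (f y))) :
  g (f (ocomp h)) = ocomp h'.
Proof.
have hf : od p true (f x) = od p false (f y) by rewrite -!ohom_d h.
by rewrite (ohom_comp h hf) (ohom_comp hf h').
Qed.

Definition omega_comp (B C D : omega_cat) (g : omega_hom C D)
    (f : omega_hom B C) : omega_hom B D :=
  @OmegaHom B D (fun x => g (f x)) (@omega_comp_d B C D g f)
    (@omega_comp_comp B C D g f).

Local Open Scope ring_scope.

(* The tensor product basis of I^n: the cell t is the tensor product over      *)
(* i < n of u_1 if [t i = None], and of (d^a u_1) if [t i = Some a].           *)
Definition cell (n : nat) := {ffun 'I_n -> option bool}.

Definition chain (n : nat) := {ffun cell n -> int}.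

Definition deg n (t : cell n) : nat := #|[set j | t j == None]|.

Definition deg_before n (t : cell n) (m : nat) : nat :=
  #|[set j : 'I_n | (j < m)%N && (t j == None)]|.

Definition basis_chain n (t : cell n) : chain n := [ffun e => (e == t)%:R].

Definition top_cell n : cell n := [ffun=> None].

Definition top_chain n : chain n := basis_chain (top_cell n).

Definition close_cell n (t : cell n) (i : 'I_n) (a : bool) : cell n :=
  [ffun j => if j == i then Some a else t j].

Definition boundary_cell n (t : cell n) : chain n :=
  [ffun e => \sum_(i < n | t i == None) (-1) ^+ deg_before t i *
     (basis_chain (close_cell t i true) e -
      basis_chain (close_cell t i false) e)].

(* The tensor product formula for this boundary is [boundary_tensor] below.    *)
Definition boundary n (c : chain n) : chain n :=
  [ffun e => \sum_t c t * boundary_cell t e].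

Definition boundary_part n (a : bool) (c : chain n) : chain n :=
  [ffun t => Num.max (if a then boundary c t else - boundary c t) 0].

Definition augmentation n (c : chain n) : int := \sum_(t | deg t == 0%N) c t.

Definition homogeneous n (q : nat) (c : chain n) : Prop :=
  forall t, c t != 0 -> deg t = q.

Definition chain_nonneg n (c : chain n) : Prop := forall t, 0 <= c t.

Definition tensor p q (x : chain p) (y : chain q) : chain (p + q) :=
  [ffun t : cell (p + q) =>
     x [ffun i => t (lshift q i)] * y [ffun i => t (rshift p i)]].

(* The map from I^(n-1) to I^n that sends x (x) y, with x in I^i, to           *)
(* x (x) d^a u_1 (x) y.                                                        *)
Definition coface n (i : 'I_n) (a : bool) (c : chain n.-1) : chain n :=
  [ffun t : cell n => if t i == Some a then c [ffun j => t (lift i j)] else 0].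

Definition open_cell n (t : cell n) (i : 'I_n) : cell n :=
  [ffun j => if j == i then None else t j].

Definition sgn_int (a : bool) : int := if a then 1 else -1.

Lemma close_open n (t e : cell n) (i : 'I_n) (a : bool) :
  ((t i == None) && (e == close_cell t i a)) =
  ((e i == Some a) && (t == open_cell e i)).
Proof.
apply/andP/andP => -[/eqP h /eqP ->]; rewrite !ffunE !eqxx; split=> //;
  by apply/eqP/ffunP => j; rewrite !ffunE; case: (j =P i) => // ->.
Qed.

Lemma deg_before_open n (t : cell n) (i : 'I_n) :
  deg_before (open_cell t i) i = deg_before t i.
Proof.
rewrite /deg_before; apply: eq_card => j; rewrite !inE ffunE.
by case: (j =P i) => [->|//]; rewrite ltnn.
Qed.

Lemma boundaryE n (c : chain n) (e : cell n) :
  boundary c e = \sum_(i < n)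
    if e i is Some a then
      (-1) ^+ deg_before e i * sgn_int a * c (open_cell e i)
    else 0.
Proof.
rewrite ffunE.
under eq_bigr => t _ do rewrite ffunE mulr_sumr.
rewrite (exchange_big_dep predT) //=; apply: eq_bigr => i _.
under eq_bigr => t _ do rewrite !ffunE.
rewrite (eq_bigr (fun t : cell n => c t * ((-1) ^+ deg_before t i *
  ((((e i == Some true) && (t == open_cell e i))%:R : int) -
   ((e i == Some false) && (t == open_cell e i))%:R)))); last first.
  by move=> t ti; rewrite -!close_open ti.
case ei: (e i) => [a|]; last by rewrite big1 // => t _; rewrite subrr !mulr0.
rewrite (bigD1 (open_cell e i)) /=; last by rewrite ffunE eqxx.
rewrite big1 ?addr0; last first.
  by move=> t /andP[_ /negPf ->]; rewrite !andbF subrr !mulr0.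
rewrite eqxx !andbT deg_before_open.
by case: a {ei}; rewrite /sgn_int /= ?subr0 ?sub0r mulrC.
Qed.

Lemma boundary_u1 : boundary (top_chain 1) =
  basis_chain [ffun=> Some true] - basis_chain [ffun=> Some false].
Proof.
apply/ffunP => e; rewrite boundaryE big_ord1.
have [E F] : (forall b, (e == [ffun=> Some b]) = (e ord0 == Some b)) /\
     open_cell e ord0 = top_cell 1.
  split=> [b|]; last by apply/ffunP => j; rewrite !ffunE ord1.
  apply/eqP/eqP => [->|h]; first by rewrite ffunE.
  by apply/ffunP => j; rewrite !ffunE ord1.
rewrite F !ffunE !E eqxx.
have -> : deg_before e (ord0 : 'I_1) = 0%N.
  by apply: eq_card0 => j; rewrite inE.
by case: (e ord0) => [[]|].
Qed.

Lemma sum_deg_before n (t : cell n) m :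
  deg_before t m = (\sum_(j < n) ((j < m) && (t j == None)))%N.
Proof. by rewrite /deg_before cardsE -sum1_card big_mkcond. Qed.

Lemma sum_deg n (t : cell n) : deg t = (\sum_(j < n) (t j == None))%N.
Proof. by rewrite /deg cardsE -sum1_card big_mkcond. Qed.

Lemma boundary_tensor p q d (x : chain p) (y : chain q) (t : cell (p + q)) :
  homogeneous d x ->
  boundary (tensor x y) t =
    tensor (boundary x) y t + (-1) ^+ d * tensor x (boundary y) t.
Proof.
move=> hx; rewrite boundaryE big_split_ord /=.
set tl := [ffun i => t (lshift q i)] : cell p.
set tr := [ffun i => t (rshift p i)] : cell q.
rewrite [tensor (boundary x) y t]ffunE [tensor x (boundary y) t]ffunE -/tl -/tr.
rewrite !boundaryE mulr_suml !mulr_sumr; congr (_ + _); apply: eq_bigr => i _.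
  rewrite [tl i]ffunE; case: (t (lshift q i)) => [a|]; last by rewrite mul0r.
  have -> : deg_before t (lshift q i) = deg_before tl i.
    rewrite !sum_deg_before big_split_ord /= [X in (_ + X)%N]big1 ?addn0.
      by apply: eq_bigr => j _; rewrite ffunE.
    move=> j _; suff -> : (p + j < i)%N = false by [].
    by apply/negbTE; rewrite -leqNgt (leq_trans (ltnW (ltn_ord i))) ?leq_addr.
  rewrite -mulrA [tensor _ _ _]ffunE !mulrA; congr (_ * x _ * y _);
    apply/ffunP => j; rewrite !ffunE ?(inj_eq (@lshift_inj _ _)) //.
  by rewrite eq_rlshift.
rewrite [tr i]ffunE; case: (t (rshift p i)) => [a|]; last by rewrite !mulr0.
rewrite [tensor _ _ _]ffunE.
have -> : [ffun i0 => open_cell t (rshift p i) (lshift q i0)] = tl.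
  by apply/ffunP => j; rewrite !ffunE eq_lrshift.
have -> : [ffun i0 => open_cell t (rshift p i) (rshift p i0)] = open_cell tr i.
  by apply/ffunP => j; rewrite !ffunE (inj_eq (@rshift_inj _ _)).
have -> : deg_before t (rshift p i) = (deg tl + deg_before tr i)%N.
  rewrite !sum_deg_before sum_deg big_split_ord /=; congr addn;
    apply: eq_bigr => j _; rewrite ffunE ?ltn_add2l //.
  by rewrite (leq_trans (ltn_ord j)) ?leq_addr.
have [->|/hx ->] := eqVneq (x tl) 0; first by rewrite !(mul0r, mulr0).
by rewrite exprD -!mulrA; congr (_ * _); rewrite [RHS]mulrCA; congr (_ * _);
  rewrite [RHS]mulrCA.
Qed.

Lemma boundaryB n (c d : chain n) : boundary (c - d) = boundary c - boundary d.
Proof.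
apply/ffunP => e; rewrite !ffunE -sumrB; apply: eq_bigr => t _.
by rewrite !ffunE mulrBl.
Qed.

Lemma boundaryD n (c d : chain n) : boundary (c + d) = boundary c + boundary d.
Proof.
apply/ffunP => e; rewrite !ffunE -big_split; apply: eq_bigr => t _.
by rewrite !ffunE mulrDl.
Qed.

Lemma boundary0 n : boundary (0 : chain n) = 0.
Proof. by apply: (addIr (boundary 0)); rewrite -boundaryD addr0 add0r. Qed.

Definition delete n (i : 'I_n) (t : cell n) : cell n.-1 :=
  [ffun j => t (lift i j)].

Lemma cofaceE n (i : 'I_n) a (c : chain n.-1) t :
  coface i a c t = if t i == Some a then c (delete i t) else 0.
Proof. by rewrite ffunE. Qed.

Lemma cofaceB n (i : 'I_n) a c d : coface i a (c - d) = coface i a c - coface i a d.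
Proof.
by apply/ffunP => t; rewrite !ffunE; case: ifP; rewrite ?ffunE ?subrr.
Qed.

Lemma cofaceD n (i : 'I_n) a c d : coface i a (c + d) = coface i a c + coface i a d.
Proof.
by apply/ffunP => t; rewrite !ffunE; case: ifP; rewrite ?ffunE ?addr0.
Qed.

Lemma coface0 n (i : 'I_n) a : coface i a 0 = 0.
Proof. by apply/ffunP => t; rewrite !ffunE; case: ifP; rewrite ?ffunE. Qed.

Lemma deg_delete n (i : 'I_n) a (t : cell n) : t i = Some a ->
  deg (delete i t) = deg t.
Proof.
case: n i t => [[]//|n] i t ti; rewrite !sum_deg [RHS](bigD1_ord i) //= ti.
by apply: eq_bigr => j _; rewrite ffunE.
Qed.

Lemma deg_before_delete n (i : 'I_n) a (t : cell n) (j : 'I_n.-1) :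
  t i = Some a -> deg_before t (lift i j) = deg_before (delete i t) j.
Proof.
case: n i t j => [[]//|n] i t j ti.
rewrite !sum_deg_before (bigD1_ord i) //= ti andbF add0n.
apply: eq_bigr => m _; rewrite ffunE; congr (nat_of_bool (_ && _)).
by rewrite /= !ltnNge leq_bump2.
Qed.

Lemma boundary_coface n (i : 'I_n) a (c : chain n.-1) :
  boundary (coface i a c) = coface i a (boundary c).
Proof.
case: n i c => [[]//|n] i c; apply/ffunP => e.
rewrite cofaceE !boundaryE (bigD1_ord i) //=.
have -> : (if e i is Some b then (-1) ^+ deg_before e i * sgn_int b *
    coface i a c (open_cell e i) else 0) = 0.
  by case: (e i) => // b; rewrite cofaceE ffunE eqxx mulr0.
rewrite add0r; case: eqP => [ei|/eqP/negPf ei].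
  apply: eq_bigr => j _. rewrite [delete i e j]ffunE.
  case: (e (lift i j)) => // b; rewrite (deg_before_delete _ ei) cofaceE.
  rewrite ifT; last by rewrite ffunE (negPf (neq_lift _ _)) ei; apply/eqP.
  congr (_ * c _).
  by apply/ffunP => m; rewrite !ffunE (inj_eq lift_inj).
rewrite big1 // => j _; case: (e (lift i j)) => // b.
by rewrite cofaceE ffunE (negPf (neq_lift _ _)) ei mulr0.
Qed.

Lemma homogeneous_coface n (i : 'I_n) a q (c : chain n.-1) :
  homogeneous q c -> homogeneous q (coface i a c).
Proof.
move=> hc t; rewrite cofaceE; case: ifP => [/eqP ti|_]; last by rewrite eqxx.
by move/hc; rewrite (deg_delete ti).
Qed.

Lemma nonneg_coface n (i : 'I_n) a (c : chain n.-1) :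
  chain_nonneg c -> chain_nonneg (coface i a c).
Proof. by move=> hc t; rewrite cofaceE; case: ifP. Qed.

Lemma augmentation_coface n (i : 'I_n) a (c : chain n.-1) :
  augmentation (coface i a c) = augmentation c.
Proof.
rewrite /augmentation; under eq_bigr do rewrite cofaceE.
rewrite -big_mkcondr /=.
pose ins (e : cell n.-1) : cell n :=
  [ffun j => if unlift i j is Some j' then e j' else Some a].
have insK e : delete i (ins e) = e by apply/ffunP => j; rewrite !ffunE liftK.
rewrite (reindex_onto ins (delete i)) /=; last first.
  move=> t /andP[_ /eqP ti]; apply/ffunP => j.
  by rewrite ffunE; case: unliftP => [j' ->|->]; rewrite ?ffunE.
have insi e : ins e i = Some a by rewrite ffunE unlift_none.
by apply: eq_big => [e|e _]; rewrite insK // eqxx insi eqxx !andbT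
  -(deg_delete (insi e)) insK.
Qed.

Lemma coface_coface n (i j : 'I_n.-1) a b (c : chain n.-1.-1) : (j <= i)%N ->
  coface (ord_same j) b (coface i a c) = coface (ord_next i) a (coface j b c).
Proof.
move=> hij; apply/ffunP => t; rewrite !cofaceE [delete _ _ i]ffunE.
have -> : lift (ord_same j) i = ord_next i.
  by apply: val_inj; rewrite /= /bump hij.
rewrite [delete _ _ j]ffunE.
have -> : lift (ord_next i) j = ord_same j.
  by apply: val_inj; rewrite /= /bump ltnNge hij.
do 2!case: ifP => // _; congr (c _); apply/ffunP => m; rewrite !ffunE.
congr (t _); apply: val_inj => /=.
by rewrite (bumpC j) /unbump /bump hij ltnNge hij subn0.
Qed.

Definition sign_test n (t : cell n) (f : nat -> bool) : bool :=
  [forall i : 'I_n, if t i is Some b then b (+) odd (deg_before t i) == f i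
                    else true].

Definition atom_support n (a : bool) (q : nat) : chain n :=
  [ffun t => ((deg t == q) && sign_test t (fun=> a))%:R].

Lemma deg_open n (t : cell n) (i : 'I_n) b : t i = Some b ->
  deg (open_cell t i) = (deg t).+1.
Proof.
move=> ti; rewrite !sum_deg (bigD1 i) //= [in RHS](bigD1 i) //= ti ffunE eqxx.
by rewrite add0n add1n; congr _.+1; apply: eq_bigr => j /negPf ji; rewrite ffunE ji.
Qed.

Lemma deg_before_open_lt n (t : cell n) (i j : 'I_n) b : t i = Some b ->
  j != i -> deg_before (open_cell t i) j = (deg_before t j + (i < j))%N.
Proof.
move=> ti ji; rewrite !sum_deg_before (bigD1 i) //= [in RHS](bigD1 i) //= ti.
rewrite ffunE eqxx andbT andbF add0n addnC; congr addn.
by apply: eq_bigr => m /negPf mi; rewrite ffunE mi.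
Qed.

Lemma boundary_atom_support n a q :
  boundary (atom_support n a q.+1) =
    atom_support n true q - atom_support n false q.
Proof.
apply/ffunP => t; rewrite boundaryE.
pose F (m : nat) : int := (deg t == q)%:R * sgn_int a *
  (sign_test t (fun j => if (j < m)%N then a else ~~ a))%:R.
transitivity (\sum_(i < n) (F i.+1 - F i)); last first.
  rewrite -(big_mkord predT (fun i => F i.+1 - F i)) telescope_sumr //.
  rewrite /F.
  have -> : sign_test t (fun j => if (j < n)%N then a else ~~ a) =
            sign_test t (fun=> a).
    by apply: eq_forallb => i; rewrite ltn_ord.
  rewrite !ffunE; case: (deg t == q) => /=; last by rewrite !mul0r.
  case: a {F} => /=; rewrite /sgn_int /=; last rewrite !mulN1r opprK addrC //.
  by rewrite !mul1r.
apply: eq_bigr => i _.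
pose H := [forall j : 'I_n, if t j is Some b then
   (j != i) ==> (b (+) odd (deg_before t j) == if (j < i)%N then a else ~~ a)
   else true].
case ti: (t i) => [b|]; last first.
  rewrite /F; apply/eqP; rewrite eq_sym subr_eq0; apply/eqP.
  congr (_ * (nat_of_bool _)%:R); apply: eq_forallb => j.
  case tj: (t j) => [b|//]; rewrite ltnS leq_eqVlt.
  case: (nat_of_ord j =P i) => // /val_inj ji; by rewrite ji ti in tj.
have ltSE (j : 'I_n) : (j < i.+1)%N = (j == i) || (j < i)%N.
  by rewrite ltnS leq_eqVlt.
have GS : sign_test t (fun j => if (j < i.+1)%N then a else ~~ a) =
          H && (b (+) odd (deg_before t i) == a).
  apply/forallP/andP => [h|[/forallP h1 h2] j].
    split; last by have := h i; rewrite ti ltnSn.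
    apply/forallP => j; have := h j; case: (t j) => // b'.
    by rewrite ltSE; case: (eqVneq j i).
  have := h1 j; case tj: (t j) => [b'|//]; rewrite ltSE.
  by case: (j =P i) tj => [->|//]; rewrite ti => -[<-].
have G0 : sign_test t (fun j => if (j < i)%N then a else ~~ a) =
          H && (b (+) odd (deg_before t i) == ~~ a).
  apply/forallP/andP => [h|[/forallP h1 h2] j].
    split; last by have := h i; rewrite ti ltnn.
    by apply/forallP => j; have := h j; case: (t j) => // b'; case: (j == i).
  have := h1 j; case tj: (t j) => [b'|//].
  by case: (j =P i) tj => [->|//]; rewrite ti ltnn => -[<-].
rewrite /F GS G0 ffunE (deg_open ti) eqSS.
have -> : sign_test (open_cell t i) (fun=> a) = H.
  apply: eq_forallb => j; rewrite ffunE.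
  case: (eqVneq j i) => [->|ji]; first by rewrite ti.
  case: (t j) => // b'; rewrite (deg_before_open_lt ti ji) oddD.
  case: (ltngtP j i) => [_|_|/val_inj ij]; last by rewrite ij eqxx in ji.
    by rewrite addbF.
  by case: b' (odd _) (a) => [] [] [].
rewrite -signr_odd; case: (deg t == q) (H) => [] [];
  case: (odd _) (b) (a) => [] [] [] /=; rewrite /sgn_int /=;
  by rewrite ?(mulr0, mul0r, mulr1, mul1r, mulN1r, subr0, sub0r, expr0, expr1, opprK).
Qed.

Lemma boundary_part_atom_support n a q : (q < n)%N ->
  boundary_part a (atom_support n a q.+1) = atom_support n a q.
Proof.
move=> qn; apply/ffunP => t.
rewrite ffunE boundary_atom_support !ffunE.
case: eqP => [dt|_]; last by case: a; rewrite /= subrr ?oppr0.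
have [i ti] : exists i, t i != None.
  apply/existsP; rewrite -[X in is_true X]negbK negb_exists.
  apply/negP => /forallP h; suff : deg t = n by move=> e; rewrite -dt e ltnn in qn.
  rewrite /deg -[RHS]card_ord; apply: eq_card => i; rewrite !inE.
  by have := h i; rewrite negbK.
have : ~~ (sign_test t (fun=> true) && sign_test t (fun=> false)).
  apply/negP => /andP[/forallP/(_ i) + /forallP/(_ i)].
  by case: (t i) ti => // b _ /eqP ->.
by case: a; case: (sign_test t (fun=> true)); case: (sign_test t (fun=> false)).
Qed.

Lemma top_chain_support n a : top_chain n = atom_support n a n.
Proof.
apply/ffunP => t; rewrite !ffunE; congr (nat_of_bool _)%:R.
apply/eqP/andP => [->|[/eqP dt _]].
  split; last by apply/forallP => i; rewrite ffunE.
  by rewrite sum_deg (eq_bigr (fun=> 1%N)) ?sum1_card ?card_ord // => i _; rewrite ffunE.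
have /subset_cardP h : #|[set j | t j == None]| = #|'I_n| by rewrite card_ord.
apply/ffunP => i; rewrite ffunE; apply/eqP.
by have := h (subset_predT _) i; rewrite !inE.
Qed.

Definition dchain (n : nat) := nat -> bool -> chain n.

Definition nu_cond n (x : dchain n) : Prop :=
  [/\ forall q a, homogeneous q (x q a),
      forall q a, chain_nonneg (x q a),
      forall a, augmentation (x 0%N a) = 1 &
      forall q a, x q true - x q false = boundary (x q.+1 a)].

Record nu (n : nat) := Nu { nu_seq :> nat -> bool -> chain n; nuP : nu_cond nu_seq }.

Lemma nu_ext n (x y : nu n) : (forall q a, x q a = y q a) -> x = y.
Proof.
case: x y => x hx [y hy] /= h.
have e : x = y by apply/funext => q; apply/funext => a.
by move: hx hy; rewrite e => hx hy; congr Nu; exact: Prop_irrelevance.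
Qed.

Definition dchain_d n (p : nat) (a : bool) (x : dchain n) : dchain n :=
  fun q b => if (q < p)%N then x q b else if q == p then x p a else 0.

Definition dchain_comp n (p : nat) (x y : dchain n) : dchain n :=
  fun q b => x q b - dchain_d p true x q b + y q b.

Lemma nu_cond_d n p a (x : nu n) : nu_cond (dchain_d p a x).
Proof.
have [h1 h2 h3 h4] := nuP x; rewrite /dchain_d; split.
- move=> q b; case: ifP => // _; case: (q =P p) => [->|_] //.
  by move=> t; rewrite ffunE eqxx.
- move=> q b; case: ifP => [_|_]; first exact: h2.
  case: (q =P p) => [_|_]; first exact: h2.
  by move=> t; rewrite ffunE.
- by move=> b; case: ifP => // /negbT; rewrite -leqNgt leqn0 => /eqP ->; rewrite eqxx.
move=> q b; case: (ltngtP q p) => [qp|qp|->].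
- case: (ltngtP q.+1 p) => [_|pq|<-]; [exact: h4| |exact: h4].
  by rewrite ltnNge qp in pq.
- by rewrite subrr ltnNge ltnW ?gtn_eqF ?boundary0 // ltnS ltnW.
by rewrite subrr ltnNge leqnSn /= gtn_eqF ?boundary0.
Qed.

Definition nu_d n p a (x : nu n) : nu n := Nu (nu_cond_d p a x).

Lemma nu_composable n p (x y : nu n) : nu_d p true x = nu_d p false y ->
  (forall q b, (q < p)%N -> x q b = y q b) /\ x p true = y p false.
Proof.
move=> /(congr1 (@nu_seq n)) /= h; split=> [q b qp|].
  by have := congr1 (fun z => z q b) h; rewrite /dchain_d qp.
by have := congr1 (fun z => z p true) h; rewrite /dchain_d ltnn eqxx.
Qed.

Lemma dchain_compE n p (x y : nu n) (h : nu_d p true x = nu_d p false y) q b :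
  dchain_comp p x y q b =
    if (q < p)%N then x q b else
    if q == p then (if b then y p true else x p false) else x q b + y q b.
Proof.
have [h1 h2] := nu_composable h; rewrite /dchain_comp /dchain_d.
case: ifP => [qp|_]; first by rewrite subrr add0r -h1.
case: (q =P p) => [->|_]; last by rewrite subr0.
by case: b; rewrite ?subrr ?add0r // h2 subrK.
Qed.

Lemma nu_cond_comp n p (x y : nu n) (h : nu_d p true x = nu_d p false y) :
  nu_cond (dchain_comp p x y).
Proof.
have [h1 h2] := nu_composable h.
have [x1 x2 x3 x4] := nuP x; have [y1 y2 y3 y4] := nuP y; split.
- move=> q b; rewrite (dchain_compE h).
  case: ifP => // _; case: (q =P p) => [->|_]; first by case: b.
  move=> t; rewrite ffunE; have [->|/x1 //] := eqVneq (x q b t) 0.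
  by rewrite add0r => /y1.
- move=> q b; rewrite (dchain_compE h).
  case: ifP => [_|_]; first exact: x2.
  case: (q =P p) => [_|_]; first by case: b.
  by move=> t; rewrite ffunE addr_ge0 ?x2 ?y2.
- move=> b; rewrite (dchain_compE h); case: ifP => [_|/negbT]; first exact: x3.
  by rewrite -leqNgt leqn0 => /eqP ->; rewrite eqxx; case: b.
move=> q b; rewrite !(dchain_compE h); case: (ltngtP q p) => [qp|qp|->].
- case: (ltngtP q.+1 p) => [_|pq|e]; [exact: x4| |].
    by rewrite ltnNge qp in pq.
  by rewrite -e; case: b; rewrite -?x4 // -y4 !h1.
- rewrite ltnNge ltnW ?gtn_eqF /= ?boundaryD ?ltnS 1?ltnW // -(x4 q b) -(y4 q b).
  by rewrite opprD addrACA.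
rewrite ltnNge leqnSn /= gtn_eqF // boundaryD -(x4 p b) -(y4 p b) h2.
by rewrite [RHS]addrC addrA subrK.
Qed.

Definition nu_comp n p (x y : nu n) (h : nu_d p true x = nu_d p false y) : nu n :=
  Nu (nu_cond_comp h).

Lemma dchain_dB n p a (x y : dchain n) q b :
  dchain_d p a (fun q b => x q b - y q b) q b =
    dchain_d p a x q b - dchain_d p a y q b.
Proof. by rewrite /dchain_d; case: ifP => // _; case: ifP => // _; rewrite subrr. Qed.

Lemma dchain_dD n p a (x y : dchain n) q b :
  dchain_d p a (fun q b => x q b + y q b) q b =
    dchain_d p a x q b + dchain_d p a y q b.
Proof. by rewrite /dchain_d; case: ifP => // _; case: ifP => // _; rewrite addr0. Qed.

Lemma dchain_d_comp n p a q (x y : dchain n) r b :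
  dchain_d p a (dchain_comp q x y) r b =
    dchain_d p a x r b - dchain_d p a (dchain_d q true x) r b
    + dchain_d p a y r b.
Proof. by rewrite /dchain_comp dchain_dD dchain_dB. Qed.

Lemma dchain_d_lt n p q a b (x : dchain n) r e : (p < q)%N ->
  dchain_d p a (dchain_d q b x) r e = dchain_d p a x r e /\
  dchain_d q b (dchain_d p a x) r e = dchain_d p a x r e.
Proof.
move=> pq; rewrite /dchain_d pq; split.
  by case: ifP => // rp; rewrite (ltn_trans rp pq).
rewrite [(q < p)%N]ltnNge (ltnW pq) /= (gtn_eqF pq).
case: (ltngtP r p) => [rp|rp|->]; last by rewrite pq.
  by rewrite (ltn_trans rp pq).
by rewrite !if_same.
Qed.

Lemma dchain_dC n p q a b (x : dchain n) r e : p <> q ->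
  dchain_d p a (dchain_d q b x) r e = dchain_d q b (dchain_d p a x) r e.
Proof.
move=> pq; case: (ltngtP p q) => [h|h|//].
  by case: (dchain_d_lt a b x r e h) => -> ->.
by case: (dchain_d_lt b a x r e h) => -> ->.
Qed.

Lemma interchange_sum (V : zmodType) (x px y qx c qy z pz w : V) :
  (x - px + y) - (qx - c + qy) + (z - pz + w) =
  (x - qx + z) - (px - c + pz) + (y - qy + w).
Proof.
by rewrite !opprD !opprK !addrA [LHS](ACl (1*4*7*2*5*8*3*6*9)).
Qed.

Lemma nu_d_d n p a b (x : nu n) :
  nu_d p b (nu_d p a x) = nu_d p a x.
Proof.
apply: nu_ext => q e /=; rewrite /dchain_d.
by rewrite ltnn eqxx; case: (q < p)%N; case: (q == p).
Qed.

Lemma nu_comp_src n p (x y : nu n) (h : nu_d p true x = nu_d p false y) :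
  nu_d p false (nu_comp h) = nu_d p false x.
Proof.
apply: nu_ext => q e /=; rewrite /dchain_d !(dchain_compE h).
by rewrite ltnn eqxx; case: (q < p)%N; case: (q == p).
Qed.

Lemma nu_comp_tgt n p (x y : nu n) (h : nu_d p true x = nu_d p false y) :
  nu_d p true (nu_comp h) = nu_d p true y.
Proof.
apply: nu_ext => q e /=; rewrite /dchain_d !(dchain_compE h).
by rewrite ltnn eqxx; case: (ltnP q p) => // qp; rewrite (nu_composable h).1.
Qed.

Lemma nu_comp_idl n p (x : nu n) (h : nu_d p true (nu_d p false x) = nu_d p false x) :
  nu_comp h = x.
Proof.
apply: nu_ext => q e /=; rewrite (dchain_compE h) /= /dchain_d.
rewrite ltnn eqxx; case: (ltnP q p) => // _.
by case: (q =P p) => [->|_]; [case: e|rewrite add0r].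
Qed.

Lemma nu_comp_idr n p (x : nu n) (h : nu_d p true x = nu_d p false (nu_d p true x)) :
  nu_comp h = x.
Proof.
apply: nu_ext => q e /=; rewrite (dchain_compE h) /= /dchain_d.
rewrite ltnn eqxx; case: (ltnP q p) => // _.
by case: (q =P p) => [->|_]; [case: e|rewrite addr0].
Qed.

Lemma nu_compA n p (x y z : nu n)
    (hxy : nu_d p true x = nu_d p false y) (hyz : nu_d p true y = nu_d p false z)
    (hl : nu_d p true (nu_comp hxy) = nu_d p false z)
    (hr : nu_d p true x = nu_d p false (nu_comp hyz)) :
  nu_comp hl = nu_comp hr.
Proof.
apply: nu_ext => q e /=.
rewrite (dchain_compE hl) (dchain_compE hr) /=.
rewrite !(dchain_compE hxy) !(dchain_compE hyz) ltnn eqxx.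
by case: (ltnP q p) => // _; case: (q =P p) => // _; rewrite addrA.
Qed.

Lemma nu_d_lt n p q a b (x : nu n) :
  (p < q)%N ->
  nu_d p a (nu_d q b x) = nu_d p a x /\ nu_d q b (nu_d p a x) = nu_d p a x.
Proof.
by move=> pq; split; apply: nu_ext => r e /=;
  case: (dchain_d_lt a b x r e pq).
Qed.

Lemma nu_d_comp n p q a (x y : nu n) (h : nu_d q true x = nu_d q false y)
    (h' : nu_d q true (nu_d p a x) = nu_d q false (nu_d p a y)) :
  p <> q ->
  nu_d p a (nu_comp h) = nu_comp h'.
Proof.
move=> pq; apply: nu_ext => r e.
by rewrite /= dchain_d_comp /dchain_comp (dchain_dC _ _ _ _ _ pq).
Qed.

Lemma nu_comp_interchange n p q (x y z w : nu n)
    (hxy : nu_d p true x = nu_d p false y) (hzw : nu_d p true z = nu_d p false w)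
    (hxz : nu_d q true x = nu_d q false z) (hyw : nu_d q true y = nu_d q false w)
    (hl : nu_d q true (nu_comp hxy) = nu_d q false (nu_comp hzw))
    (hr : nu_d p true (nu_comp hxz) = nu_d p false (nu_comp hyw)) :
  p <> q ->
  nu_comp hl = nu_comp hr.
Proof.
move=> pq; apply: nu_ext => r e.
have D k (X Y : dchain n) :
  dchain_comp k X Y r e = X r e - dchain_d k true X r e + Y r e by [].
rewrite /= [LHS]D [RHS]D !dchain_d_comp !D (dchain_dC _ _ _ _ _ pq).
exact: interchange_sum.
Qed.

Lemma nu_dim n (x : nu n) :
  exists p, nu_d p false x = x /\ nu_d p true x = x.
Proof.
exists n; have [h1 _ _ h4] := nuP x.
have x0 q a : (n < q)%N -> x q a = 0.
  move=> nq; apply/ffunP => t; rewrite ffunE; apply/eqP.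
  apply: contraLR nq => /h1 <-; rewrite -leqNgt.
  by rewrite -[leqRHS]card_ord max_card.
have e : x n true = x n false.
  by apply/eqP; rewrite -subr_eq0 (h4 n true) x0 // boundary0.
split; apply: nu_ext => q a /=; rewrite /dchain_d;
  by case: ltngtP => [//|/x0 -> //|->]; case: a.
Qed.

Definition nuI (n : nat) : omega_cat :=
  @OmegaCat (nu n) (@nu_d n) (@nu_comp n) (@nu_d_d n) (@nu_comp_src n)
    (@nu_comp_tgt n) (@nu_comp_idl n) (@nu_comp_idr n) (@nu_compA n)
    (@nu_d_lt n) (@nu_d_comp n) (@nu_comp_interchange n) (@nu_dim n).

Definition atom_dchain (n : nat) : dchain n := fun q a =>
  if (q <= n)%N then iter (n - q) (boundary_part a) (top_chain n) else 0.

Lemma nu_cond_atom n : nu_cond (atom_dchain n).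
Proof.
have E q a : atom_dchain n q a = atom_support n a q.
  rewrite /atom_dchain.
  case: leqP => [|nq]; last first.
    apply/ffunP => t; rewrite !ffunE; case: eqP => //= dt.
    by move: nq; rewrite -dt ltnNge -[X in (_ <= X)%N]card_ord max_card.
  move=> qn; rewrite -{2}(subKn qn).
  elim: (n - q)%N (leq_subr q n) => [_|k IH kn] /=.
    by rewrite subn0; exact: top_chain_support.
  rewrite IH ?(ltnW kn) // -(subnSK kn) boundary_part_atom_support //.
  by rewrite ltn_subrL (leq_ltn_trans _ kn).
split.
- move=> q a t; rewrite E ffunE; by case: (deg t =P q).
- by move=> q a t; rewrite E ffunE; case: (_ && _).
- move=> a; rewrite E /augmentation.
  rewrite (bigD1 ([ffun=> Some a] : cell n)) /=; last first.
    by rewrite /deg eq_card0 // => i; rewrite !inE ffunE.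
  have d0 (t : cell n) i : deg t = 0%N -> deg_before t i = 0%N.
    move/card0_eq => h; apply: eq_card0 => j; have := h j.
    by rewrite !inE => ->; rewrite andbF.
  have dc : deg ([ffun=> Some a] : cell n) = 0%N.
    by apply: eq_card0 => i; rewrite !inE ffunE.
  rewrite big1 => [|t /andP[/eqP dt ta]].
    rewrite addr0 ffunE dc eqxx /=.
    suff -> : sign_test ([ffun=> Some a] : cell n) (fun=> a) by [].
    by apply/forallP => i; rewrite ffunE d0 // addbF.
  rewrite ffunE dt eqxx /=; case: (boolP (sign_test _ _)) => // /forallP h; case/eqP: ta.
  apply/ffunP => i; rewrite ffunE; have := h i; rewrite d0 //.
  case ti: (t i) => [b|]; first by rewrite addbF => /eqP ->.
  by move/card0_eq: dt => /(_ i); rewrite !inE ti.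
by move=> q a; rewrite !E boundary_atom_support.
Qed.

Definition atom (n : nat) : nuI n := Nu (nu_cond_atom n).

Lemma dchain_d_coface n p a (i : 'I_n) b (x : dchain n.-1) q e :
  dchain_d p a (fun q e => coface i b (x q e)) q e =
    coface i b (dchain_d p a x q e).
Proof. by rewrite /dchain_d; do 2!case: ifP => // _; rewrite coface0. Qed.

Lemma nu_cond_coface n (i : 'I_n) b (x : nu n.-1) :
  nu_cond (fun q a => coface i b (x q a)).
Proof.
have [h1 h2 h3 h4] := nuP x; split=> [q a|q a|a|q a].
- exact/homogeneous_coface.
- exact/nonneg_coface.
- by rewrite augmentation_coface.
by rewrite -cofaceB (h4 q a) boundary_coface.
Qed.

Definition nu_coface_fun n (i : 'I_n) (b : bool) (x : nu n.-1) : nu n :=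
  Nu (nu_cond_coface i b x).

Lemma nu_coface_d n (i : 'I_n) b p a (x : nu n.-1) :
  nu_coface_fun i b (nu_d p a x) = nu_d p a (nu_coface_fun i b x).
Proof. by apply: nu_ext => q e /=; rewrite dchain_d_coface. Qed.

Lemma nu_coface_comp n (i : 'I_n) b p (x y : nu n.-1)
    (h : nu_d p true x = nu_d p false y)
    (h' : nu_d p true (nu_coface_fun i b x) = nu_d p false (nu_coface_fun i b y)) :
  nu_coface_fun i b (nu_comp h) = nu_comp h'.
Proof.
apply: nu_ext => q e /=.
by rewrite /dchain_comp dchain_d_coface cofaceD cofaceB.
Qed.

Definition nu_coface n (i : 'I_n) (b : bool) : omega_hom (nuI n.-1) (nuI n) :=
  @OmegaHom (nuI n.-1) (nuI n) (nu_coface_fun i b)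
    (@nu_coface_d n i b) (@nu_coface_comp n i b).

Definition nerve_face (C : omega_cat) n (i : 'I_n) (a : bool)
    (x : omega_hom (nuI n) C) : omega_hom (nuI n.-1) C :=
  omega_comp x (nu_coface i a).

Lemma nerve_face_face (C : omega_cat) n (i j : 'I_n.-1) a b
    (x : omega_hom (nuI n) C) : (j <= i)%N ->
  nerve_face i a (nerve_face (ord_same j) b x) =
    nerve_face j b (nerve_face (ord_next i) a x).
Proof.
move=> hij; apply: omega_hom_ext => c /=; congr (x _).
by apply: nu_ext => q e; apply: coface_coface.
Qed.

Definition nerve_precubical (C : omega_cat) : precubical :=
  @Precubical (fun n => omega_hom (nuI n) C) (@nerve_face C) (@nerve_face_face C).

Definition nerve_thin (C : omega_cat) n (x : omega_hom (nuI n) C) : Prop :=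
  (0 < n)%N /\ is_identity n.-1 (x (atom n)).

Lemma nerve_thin_dim (C : omega_cat) (x : omega_hom (nuI 0) C) : ~ nerve_thin x.
Proof. by case. Qed.

Definition nerve (C : omega_cat) : stratified :=
  @Stratified (nerve_precubical C) (@nerve_thin C) (@nerve_thin_dim C).

(* Main.v *)
From mathcomp Require Import all_boot all_order all_algebra.
From mathcomp Require Import boolp zify.
Require Import Defs.
Set Implicit Arguments.
Unset Strict Implicit.
Unset Printing Implicit Defensive.
Import Order.TTheory GRing.Theory Num.Theory.
Local Open Scope nat_scope.

(* The omega-category of an n-cube is freely generated by its atoms: write     *)
(* ev for the sub-omega-category of nu I^n x C generated by prescribed values  *)
(* on atoms; if the values have the right boundaries then ev is the graph of a *)
(* function.  For this, describe an element x above level p as the sum of the  *)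
(* atoms of a list of cells, its pieces.  The cells carry a linear order for   *)
(* which every cell lies after its source and before its target, and a cut of  *)
(* the sorted list of pieces is always a decomposition x = y #_p z.  At the    *)
(* highest level at which x has at least two pieces, every decomposition of x  *)
(* has the same value as the one that splits off the least piece: it can be    *)
(* moved to the front, and when it trades places with a single other piece     *)
(* then x decomposes at level p - 1 into parts containing one of them each, so *)
(* that the interchange law applies.                                           *)
(*   For a box opposite the face f of u_n, let E be the side d_{n-1} u_n that  *)
(* contains f.  Going down from level n - 1, the pieces of E other than f are  *)
(* complementary, hence have identity values and may be removed; at level 0    *)
(* only f is left, so E and f have the same value.  A thin filler thus takes a *)
(* single value on u_n, on f and on the two sides of u_n, namely the value of  *)
(* the side of u_n not containing f, which is a composite of cells of the box. *)

(** * Composition as a relation *)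

(** Morphisms out of [nuI n] are the same as compatible families of values on the atoms [catom t] of
    the cells t of the cube: values on atoms determine a morphism ([hom_ext]), and all values with
    the right boundaries occur ([hom_ex]). Filling a shell thus means choosing a value for u_n, and
    filling a box means choosing values for u_n and for the missing face.

    Freeness rests on [ev_good]. The relation [ev] contains every value that x receives by composing
    prescribed values of atoms along some decomposition; it is shown to be functional and total by
    induction on the number of terms [mu x]. If x is not an atom, [decomposition] gives a highest
    level p with at least two pieces, and [split_min] splits off there the piece b of least rank. By
    [canonical_val], every evaluation of x gives the value computed from this one splitting. The
    critical case is [front_swap], where two single pieces are composed in the wrong order: the
    order on cells shows that both of their sources already occur in the source of x, so the pieces
    lie side by side in a composite at level p - 1, and the interchange law in C identifies the two
    orders.

    Thinness rests on the chain identity [boundary_compl]. Let f be a face of u_n and E the side of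
    u_n at level n - 1 that contains f. At each level the pieces other than f are cells
    complementary to f, some before f and some after it. If their values are identities they can be
    stripped off level by level until only f remains ([reduced_ev]), so E has the same value as f
    ([ev_face]).

    In a thin cube, u_n has the same value as each of its two sides. For an admissible box opposite
    f, the side without f consists of cells of the box ([other_side_in_box]), so its value c is
    forced on u_n, and on f by [filler_face]. Conversely c has the boundaries required of f: those
    of f agree with those of its side ([ev_source]), hence by globularity with those of the other
    side. If all members of the box are thin, c is a composite of identities for #_{n-2}
    ([ev_thin]), so the missing face is thin. For an admissible shell, the two non-complementary
    faces lie on opposite sides of u_n ([noncomplementary_sign]), so both sides have the common
    value of these faces, which is then the value of u_n. *)

Section Cmp.
Variable C : omega_cat.
Implicit Types (x y z w : C) (p q : nat) (a b : bool).

(** A relation in place of the partial operation, so that the proofs of definedness need not be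
    carried through equations; proof irrelevance makes it functional. *)
Definition cmp p y z x := exists h : od p true y = od p false z, ocomp h = x.

Lemma cmp_comp p y z x : cmp p y z x -> od p true y = od p false z.
Proof. by case. Qed.

Lemma cmp_uniq p y z x x' : cmp p y z x -> cmp p y z x' -> x = x'.
Proof. by move=> [h <-] [h' <-]; rewrite (Prop_irrelevance h h'). Qed.

Lemma cmp_ex p y z : od p true y = od p false z -> exists x, cmp p y z x.
Proof. by move=> h; exists (ocomp h), h. Qed.

Lemma cmp_src p y z x : cmp p y z x -> od p false x = od p false y.
Proof. by case=> h <-; exact: od_comp_src. Qed.

Lemma cmp_tgt p y z x : cmp p y z x -> od p true x = od p true z.
Proof. by case=> h <-; exact: od_comp_tgt. Qed.

Lemma od_odE p q a b x :
  od p a (od q b x) = if p < q then od p a x else od q b x.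
Proof.
case: (ltngtP p q) => [h|h|->]; last exact: od_od.
  by case: (od_lt a b x h).
by case: (od_lt b a x h).
Qed.

Lemma odC p q a b x : p <> q -> od p a (od q b x) = od q b (od p a x).
Proof. by rewrite !od_odE; case: ltngtP. Qed.

Lemma cmp_d p q a y z x : p <> q -> cmp p y z x ->
  cmp p (od q a y) (od q a z) (od q a x).
Proof.
move=> pq [h <-].
have h' : od p true (od q a y) = od p false (od q a z).
  by rewrite !(@odC p q) // h.
by exists h'; rewrite -(od_comp h h') //; apply: nesym.
Qed.

Lemma cmp_d_lt p q a y z x : q < p -> cmp p y z x ->
  od q a x = od q a y /\ od q a x = od q a z.
Proof.
move=> qp h; have e : od q a y = od q a z.
  have := congr1 (od q a) (cmp_comp h); by rewrite !od_odE qp.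
suff e2 : od q a x = od q a y by rewrite -e.
have := congr1 (od q a) (cmp_src h); by rewrite !od_odE qp.
Qed.

Lemma cmp_idl p x : cmp p (od p false x) x x.
Proof.
have h : od p true (od p false x) = od p false x by rewrite od_od.
by exists h; apply: ocomp_idl.
Qed.

Lemma cmp_idr p x : cmp p x (od p true x) x.
Proof.
have h : od p true x = od p false (od p true x) by rewrite od_od.
by exists h; apply: ocomp_idr.
Qed.

Lemma cmp_assoc p x y z xy yz w :
  cmp p x y xy -> cmp p xy z w -> cmp p y z yz -> cmp p x yz w.
Proof.
move=> [h1 e1] [h2 e2] [h3 e3]; subst.
have hr : od p true x = od p false (ocomp h3) by rewrite od_comp_src.
by exists hr; apply: esym; apply: ocompA.
Qed.

Lemma cmp_assocr p x y z xy yz w :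
  cmp p y z yz -> cmp p x yz w -> cmp p x y xy -> cmp p xy z w.
Proof.
move=> [h1 e1] [h2 e2] [h3 e3]; subst.
have hr : od p true (ocomp h3) = od p false z by rewrite od_comp_tgt.
by exists hr; apply: ocompA.
Qed.

Lemma cmp_assoc_ex p x y z xy w : cmp p x y xy -> cmp p xy z w ->
  exists2 yz, cmp p y z yz & cmp p x yz w.
Proof.
move=> h1 h2; have [|yz h3] := @cmp_ex p y z.
  by rewrite -(cmp_tgt h1) (cmp_comp h2).
by exists yz => //; apply: (cmp_assoc h1 h2 h3).
Qed.

Lemma cmp_assocr_ex p x y z yz w : cmp p y z yz -> cmp p x yz w ->
  exists2 xy, cmp p x y xy & cmp p xy z w.
Proof.
move=> h1 h2; have [|xy h3] := @cmp_ex p x y.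
  by rewrite -(cmp_src h1) (cmp_comp h2).
by exists xy => //; apply: (cmp_assocr h1 h2 h3).
Qed.

(** Definedness of the last composite is not assumed: the p-target of xz and the p-source of yw are
    #_q composites of the same two elements. *)
Lemma cmp_interchange p q x y z w xy zw xz yw t : p <> q ->
  cmp p x y xy -> cmp p z w zw -> cmp q x z xz -> cmp q y w yw ->
  cmp q xy zw t -> cmp p xz yw t.
Proof.
move=> pq h1 h2 h3 h4 h5.
have hr : od p true xz = od p false yw.
  apply: (@cmp_uniq q (od p true x) (od p true z)); first exact: cmp_d (nesym pq) h3.
  by rewrite (cmp_comp h1) (cmp_comp h2); exact: cmp_d (nesym pq) h4.
move: h1 h2 h3 h4 h5 hr => [h1 e1] [h2 e2] [h3 e3] [h4 e4] [h5 e5] hr; subst.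
exists hr; apply: esym; apply: ocomp_interchange => //.
Qed.

(** For p < q a #_q composite has the same d_p sides as each of its factors, so the corresponding
    factors of y and z are automatically composable at level p. *)
Lemma cmp_grid p q y1 y2 y z1 z2 z x : p < q ->
  cmp q y1 y2 y -> cmp q z1 z2 z -> cmp p y z x ->
  exists u v, [/\ cmp p y1 z1 u, cmp p y2 z2 v & cmp q u v x].
Proof.
move=> pq h1 h2 h3.
have [u hu] : exists u, cmp p y1 z1 u.
  apply: cmp_ex; rewrite -(cmp_d_lt true pq h1).1 -(cmp_d_lt false pq h2).1.
  exact: cmp_comp h3.
have [v hv] : exists v, cmp p y2 z2 v.
  apply: cmp_ex; rewrite -(cmp_d_lt true pq h1).2 -(cmp_d_lt false pq h2).2.
  exact: cmp_comp h3.
exists u, v; split => //; apply: (cmp_interchange _ h1 h2 hu hv h3).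
by move=> e; rewrite e ltnn in pq.
Qed.

Lemma is_identityP p x : is_identity p x <-> forall a, od p a x = x.
Proof. by split=> [[h1 h2] [] | h] //; split. Qed.

Lemma is_identity_le p q x : p <= q -> is_identity p x -> is_identity q x.
Proof.
move=> pq [h _]; apply/is_identityP => a.
by rewrite -h od_odE ltnNge pq.
Qed.

(** If q < p, then d_p distributes over #_q. If p <= q, both factors are also identities for #_q,
    and the composite is degenerate. *)
Lemma is_identity_cmp p q y z x :
  cmp q y z x -> is_identity p y -> is_identity p z -> is_identity p x.
Proof.
move=> h hy hz; case: (ltnP q p) => [qp|pq].
  apply/is_identityP => a.
  have ne : q <> p by move=> e; rewrite e ltnn in qp.
  apply: cmp_uniq (cmp_d a ne h) _.
  by move/is_identityP: hy => ->; move/is_identityP: hz => ->.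
suff -> : x = y by [].
have [_ ty] := is_identity_le pq hy; have [sz tz] := is_identity_le pq hz.
have yz : y = z by rewrite -ty (cmp_comp h).
apply: (cmp_uniq h); rewrite -yz -{2}ty; exact: cmp_idr.
Qed.

Lemma cmp_identityl p y z x : cmp p y z x -> is_identity p y -> x = z.
Proof.
move=> h [_ e]; apply: (cmp_uniq h).
by rewrite -e (cmp_comp h); exact: cmp_idl.
Qed.

Lemma cmp_identityr p y z x : cmp p y z x -> is_identity p z -> x = y.
Proof.
move=> h [e _]; apply: (cmp_uniq h).
by rewrite -e -(cmp_comp h); exact: cmp_idr.
Qed.

End Cmp.

Lemma cmp_hom (C D : omega_cat) (f : omega_hom C D) p (y z x : C) :
  cmp p y z x -> cmp p (f y) (f z) (f x).
Proof.
move=> [h <-]; have h' : od p true (f y) = od p false (f z) by rewrite -!ohom_d h.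
by exists h'; rewrite -(ohom_comp h h').
Qed.

Local Open Scope ring_scope.

(** * Atoms and the order on cells *)

Section Cells.
Variable n : nat.
Implicit Types (t e : cell n) (a b : bool) (q : nat).

(** The condition for e to be a term of the atom of t with sign a: e is a face of t, and each
    coordinate closed on the way from t to e has sign a after correction by the free coordinates of
    e before it. *)
Definition matches t a e : bool := [forall i : 'I_n,
  if t i is Some b then e i == Some b
  else if e i is Some b then b (+) odd (deg_before e i) == a else true].

Definition cell_chain t a q : chain n :=
  [ffun e => ((deg e == q) && matches t a e)%:R].

Lemma cell_chain_ge0 t a q e : 0 <= cell_chain t a q e.
Proof. by rewrite ffunE; case: (_ && _). Qed.

Lemma matches_closed t a e i b : matches t a e -> t i = Some b -> e i = Some b.
Proof. by move=> /forallP/(_ i) + ti; rewrite ti => /eqP. Qed.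

Lemma matches_sub t a e : matches t a e ->
  [set j | e j == None] \subset [set j | t j == None].
Proof.
move=> m; apply/subsetP => j; rewrite !inE; case tj: (t j) => [b|//].
by rewrite (matches_closed m tj).
Qed.

Lemma matches_deg t a e : matches t a e -> (deg e <= deg t)%N.
Proof. by move/matches_sub/subset_leq_card. Qed.

Lemma matches_eq t a e : matches t a e -> deg e = deg t -> e = t.
Proof.
move=> m d; have /eqP/setP s : [set j | e j == None] == [set j | t j == None].
  by rewrite eqEcard (matches_sub m) [X in (X <= _)%N]/= -/(deg t) -/(deg e) d /=.
apply/ffunP => j; case tj: (t j) => [b|]; first exact: matches_closed m tj.
by have := s j; rewrite !inE tj eqxx => /eqP.
Qed.

Lemma matches_refl t a : matches t a t.
Proof. by apply/forallP => i; case: (t i). Qed.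

Lemma cell_chain_deg t a : cell_chain t a (deg t) = basis_chain t.
Proof.
apply/ffunP => e; rewrite !ffunE; congr (nat_of_bool _)%:R.
apply/andP/eqP => [[/eqP d m]|->]; first exact: matches_eq m d.
by rewrite eqxx matches_refl.
Qed.

Lemma cell_chain_gt t a q : (deg t < q)%N -> cell_chain t a q = 0.
Proof.
move=> h; apply/ffunP => e; rewrite !ffunE; case: eqP => //= d.
by case: (boolP (matches _ _ _)) => // /matches_deg; rewrite d leqNgt h.
Qed.

Lemma cell_chain_neq0 t a q e :
  cell_chain t a q e != 0 -> deg e = q /\ matches t a e.
Proof. by rewrite ffunE; case: (deg e =P q) => [->|]; case: matches. Qed.

Lemma matches_top a e : matches (top_cell n) a e = sign_test e (fun=> a).
Proof. by apply: eq_forallb => i; rewrite ffunE. Qed.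

Lemma cell_chain_top a q : cell_chain (top_cell n) a q = atom_support n a q.
Proof. by apply/ffunP => e; rewrite !ffunE matches_top. Qed.

Lemma atomE q a : atom n q a = atom_support n a q.
Proof.
rewrite /= /atom_dchain; case: leqP => [qn|nq]; last first.
  apply/ffunP => t; rewrite !ffunE; case: eqP => //= dt.
  by move: nq; rewrite -dt ltnNge -[X in (_ <= X)%N]card_ord max_card.
rewrite -{2}(subKn qn).
elim: (n - q)%N (leq_subr q n) => [_|k IH kn] /=.
  by rewrite subn0; exact: top_chain_support.
rewrite IH ?(ltnW kn) // -(subnSK kn) boundary_part_atom_support //.
by rewrite ltn_subrL (leq_ltn_trans _ kn).
Qed.

End Cells.

Lemma matches_delete n (t e : cell n) a (i : 'I_n) b :
  t i = Some b -> e i = Some b -> matches (delete i t) a (delete i e) = matches t a e.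
Proof.
case: n t e i => [|n] t e i; first by case: i.
move=> ti ei; apply/forallP/forallP => h j; last first.
  by have := h (lift i j); rewrite !ffunE (deg_before_delete _ ei).
case: (unliftP i j) => [j' ->|->]; last by rewrite ti ei.
by have := h j'; rewrite !ffunE (deg_before_delete _ ei).
Qed.

Lemma coface_cell_chain n (t : cell n) (i : 'I_n) b a q : t i = Some b ->
  coface i b (cell_chain (delete i t) a q) = cell_chain t a q.
Proof.
move=> ti; apply/ffunP => e; rewrite cofaceE !ffunE.
case: eqP => [ei|ne]; first by rewrite (deg_delete ei) (matches_delete _ ti ei).
case: (boolP (matches _ _ _)) => [m|]; last by rewrite andbF.
by case: ne; apply: matches_closed m ti.
Qed.

Lemma closed_ex n (t : cell n) : t != top_cell n -> exists i b, t i = Some b.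
Proof.
move=> h; suff /existsP[i] : [exists i, t i != None].
  by case ti: (t i) => [b|//] _; exists i, b.
apply: contraR h => /existsPn h; apply/eqP/ffunP => i.
by rewrite ffunE; have := h i; rewrite negbK => /eqP.
Qed.

(** The top cell gives the atom of u_n; any other cell has a closed coordinate, and its chains come
    from a smaller cube through a coface map. *)
Lemma nu_cond_cell n (t : cell n) : nu_cond (fun q a => cell_chain t a q).
Proof.
elim: n t => [|n IH] t; case: (eqVneq t (top_cell _)) => [->|/closed_ex[i [b ti]]].
- have := nuP (atom 0); congr nu_cond; apply/funext => q; apply/funext => a.
  by rewrite cell_chain_top atomE.
- by case: i ti.
- have := nuP (atom n.+1); congr nu_cond; apply/funext => q; apply/funext => a.
  by rewrite cell_chain_top atomE.
have := nu_cond_coface i b (Nu (IH (delete i t))).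
congr nu_cond; apply/funext => q; apply/funext => a /=.
exact: coface_cell_chain.
Qed.

Definition catom n (t : cell n) : nu n := Nu (nu_cond_cell t).

Lemma catom_top n : catom (top_cell n) = atom n.
Proof. by apply: nu_ext => q a; rewrite atomE /= cell_chain_top. Qed.

Lemma nu_coface_catom n (t : cell n) (i : 'I_n) b : t i = Some b ->
  nu_coface_fun i b (catom (delete i t)) = catom t.
Proof. by move=> ti; apply: nu_ext => q a; apply: coface_cell_chain. Qed.

Lemma catom_inj n : injective (@catom n).
Proof.
move=> t e h; have := congr1 (fun x : nu n => x (deg t) true t) h.
rewrite /= cell_chain_deg ffunE eqxx => /esym/eqP h1.
have [//|d m] := @cell_chain_neq0 _ e true (deg t) t; first by rewrite (eqP h1).
have := congr1 (fun x : nu n => x (deg e) true e) h.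
rewrite /= cell_chain_deg [RHS]ffunE eqxx => /eqP h2.
have [//|d' m'] := @cell_chain_neq0 _ t true (deg e) e; first by rewrite (eqP h2).
by apply: (matches_eq m); apply/eqP; rewrite eqn_leq (matches_deg m) (matches_deg m').
Qed.

(** * The order on cells *)

Definition sgn n (t : cell n) (i : 'I_n) : int :=
  if t i is Some b then if b (+) odd (deg_before t i) then 1 else -1 else 0.

Fixpoint base3 (m : nat) (s : nat -> int) : int :=
  if m is m'.+1 then 3 * base3 m' s + s m' else 0.

Lemma eq_base3 m s s' : (forall j, (j < m)%N -> s j = s' j) -> base3 m s = base3 m s'.
Proof.
elim: m => //= m IH h; rewrite h // IH // => j jm.
by apply: h; apply: ltnW.
Qed.

(** Digits between -1 and 1 differ by at most 2, so a difference at an earlier place, scaled by at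
    least 3, outweighs all later ones. *)
Lemma base3_lt m s s' i :
  (forall j, `|s j| <= 1) -> (forall j, `|s' j| <= 1) ->
  (i < m)%N -> (forall j, (j < i)%N -> s j = s' j) -> s i < s' i ->
  base3 m s < base3 m s'.
Proof.
move=> b b'; elim: m => // m IH; rewrite ltnS leq_eqVlt => /predU1P[->|im] h hi /=.
  by rewrite (eq_base3 h) ltrD2l.
have := IH im h hi; move: (b m) (b' m); lia.
Qed.

(* A base 3 encoding of the sign-adjusted coordinates: comparing ranks is the *)
(* alternating lexicographic order, for which every cell lies after the       *)
(* negative and before the positive part of its boundary.                     *)
Definition rank n (t : cell n) : int :=
  base3 n (fun j => if insub j is Some i then sgn t i else 0).

Lemma rank_lt n (t e : cell n) (i : 'I_n) :
  (forall j : 'I_n, (j < i)%N -> sgn t j = sgn e j) -> sgn t i < sgn e i ->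
  rank t < rank e.
Proof.
have B (u : cell n) j : `|if insub j is Some k then sgn u k else 0 : int| <= 1.
  by case: insub => // k; rewrite /sgn; case: (u k) => // b; case: ifP.
move=> h hi; apply: (@base3_lt _ _ _ i) => //; last by rewrite valK.
by move=> j ji; case: insubP => // k _ kj; apply: h; rewrite kj.
Qed.

Lemma deg_before_eq n (t e : cell n) m :
  (forall j : 'I_n, (j < m)%N -> (t j == None) = (e j == None)) ->
  deg_before t m = deg_before e m.
Proof.
move=> h; apply: eq_card => j; rewrite !inE.
by case: ltnP => //= jm; rewrite h.
Qed.

Lemma sgn_eq n (t e : cell n) (i : 'I_n) :
  (forall j : 'I_n, (j < i)%N -> (t j == None) = (e j == None)) ->
  t i = e i -> sgn t i = sgn e i.
Proof. by move=> h hi; rewrite /sgn hi (deg_before_eq h). Qed.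

(** At the first coordinate where t and e differ, t is free and e is closed with adjusted sign a;
    before it the adjusted signs agree. *)
Lemma cell_chain_rank n (t e : cell n) a q : (q < deg t)%N ->
  cell_chain t a q e != 0 -> if a then rank t < rank e else rank e < rank t.
Proof.
move=> qt /cell_chain_neq0[de m].
have /existsP[i0 hi0] : [exists i, t i != e i].
  apply/existsPn => h; suff te : t = e by rewrite -de te ltnn in qt.
  by apply/ffunP => i; apply/eqP; have := h i; rewrite negbK.
case: (@arg_minnP _ i0 (fun i => t i != e i) (@nat_of_ord n) hi0) => i hi imin.
have lt (j : 'I_n) : (j < i)%N -> t j = e j.
  by move=> ji; apply/eqP; apply: contraLR ji => /imin; rewrite -leqNgt.
have lts (j : 'I_n) : (j < i)%N -> sgn t j = sgn e j.
  move=> ji; apply: sgn_eq; last exact: lt.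
  by move=> k kj; rewrite lt // (ltn_trans kj ji).
have si : sgn t i = 0 /\ sgn e i = if a then 1 else -1.
  have := forallP m i; rewrite /sgn.
  case: (t i) (e i) hi => [b|] [c|] //= hi /eqP; last by move=> ->.
  by move=> [h]; rewrite h eqxx in hi.
case: a si {m} => -[s1 s2].
  by apply: (@rank_lt _ _ _ i) => //; rewrite s1 s2.
apply: (@rank_lt _ _ _ i) => [j ji|]; first by rewrite lts.
by rewrite s1 s2.
Qed.

(** * Composition in nu I^n *)

Local Notation ncmp p y z x := (@cmp (nuI _) p y z x).

Section Nu.
Variable n : nat.
Implicit Types (x y z : nu n) (c d : chain n) (t e b : cell n) (S T : seq (cell n)).

Definition total c : int := \sum_t c t.

Lemma totalD c d : total (c + d) = total c + total d.
Proof. by rewrite -big_split; apply: eq_bigr => t _; rewrite ffunE. Qed.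

Lemma totalB c d : total (c - d) = total c - total d.
Proof. by rewrite -sumrB; apply: eq_bigr => t _; rewrite !ffunE. Qed.

Lemma total_basis t : total (basis_chain t) = 1.
Proof.
rewrite /total (bigD1 t) //= ffunE eqxx big1 ?addr0 // => e /negPf h.
by rewrite ffunE h.
Qed.

(** Opposite faces of a cell enter its boundary with opposite coefficients. Hence source and target
    chains have the same number of terms in every degree. *)
Lemma total_boundary c : total (boundary c) = 0.
Proof.
rewrite /total; under eq_bigr do rewrite ffunE.
rewrite exchange_big big1 // => t _; rewrite -mulr_sumr.
under eq_bigr do rewrite ffunE.
rewrite exchange_big big1 ?mulr0 // => i _; rewrite -mulr_sumr.
rewrite (eq_bigr (fun e => (basis_chain (close_cell t i true)
  - basis_chain (close_cell t i false)) e)); last by move=> e _; rewrite !ffunE.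
by rewrite -/(total _) totalB !total_basis subrr mulr0.
Qed.

Lemma total_ge0 c : (forall t, 0 <= c t) -> 0 <= total c.
Proof. by move=> h; apply: sumr_ge0. Qed.

Lemma total_eq0 c : (forall t, 0 <= c t) -> total c = 0 -> c = 0.
Proof.
move=> h /eqP; rewrite psumr_eq0 // => /allP h0; apply/ffunP => t.
by rewrite ffunE; apply/eqP/h0; rewrite mem_index_enum.
Qed.

Lemma nu_ge0 x q a t : 0 <= x q a t.
Proof. by have [_ h _ _] := nuP x; apply: h. Qed.

Lemma nu_bd x q a : x q true - x q false = boundary (x q.+1 a).
Proof. by have [_ _ _ h] := nuP x; apply: h. Qed.

Lemma nu_tgt x q a : x q true = x q false + boundary (x q.+1 a).
Proof. by rewrite -nu_bd addrC subrK. Qed.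

Lemma nu_homog x q a t : x q a t != 0 -> deg t = q.
Proof. by have [h _ _ _] := nuP x; apply: h. Qed.

Lemma nu_gt x q a : (n < q)%N -> x q a = 0.
Proof.
move=> nq; apply/ffunP => t; rewrite ffunE; apply/eqP.
apply: contraLR nq => /nu_homog <-; rewrite -leqNgt.
by rewrite -[leqRHS]card_ord max_card.
Qed.

Lemma nu_total x q a : total (x q a) = total (x q false).
Proof.
case: a => //; apply/eqP; rewrite -subr_eq0 -totalB.
by rewrite (nu_bd _ _ true) total_boundary.
Qed.

Lemma nu_total0 x a : total (x 0%N a) = 1.
Proof.
have [_ _ h _] := nuP x; rewrite -(h a) /total /augmentation.
rewrite [LHS](bigID (fun t => deg t == 0%N)) /= [X in _ + X]big1 ?addr0 // => t.
by move=> h0; apply/eqP; apply: contraNT h0 => /nu_homog ->.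
Qed.

Lemma ncmpP p y z x : ncmp p y z x <->
  [/\ forall q a, (q < p)%N -> y q a = x q a /\ z q a = x q a,
      y p false = x p false, z p true = x p true, y p true = z p false &
      forall q a, (p < q)%N -> x q a = y q a + z q a].
Proof.
split=> [[h <-]|[h1 h2 h3 h4 h5]].
  have [e1 e2] := nu_composable h.
  split=> [q a qp||||q a pq] /=; rewrite ?(dchain_compE h) ?ltnn ?eqxx ?qp //.
    by rewrite e1.
  by rewrite ltnNge (ltnW pq) /= gtn_eqF.
have h : nu_d p true y = nu_d p false z.
  apply: nu_ext => q a /=; rewrite /dchain_d; case: ifP => [qp|_].
    by have [-> ->] := h1 q a qp.
  by rewrite h4.
exists h; apply: nu_ext => q a; rewrite /= (dchain_compE h).
case: (ltngtP q p) => [qp|pq|->]; first by have [-> _] := h1 q a qp.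
  by rewrite h5.
by case: a.
Qed.

Lemma ncmp_gt p y z x q a : ncmp p y z x -> (p < q)%N -> x q a = y q a + z q a.
Proof. by move/ncmpP=> [_ _ _ _ h]; apply: h. Qed.

(** Below p all parts agree with x; at p the left factor has the source of x, and its target follows
    from the boundary formula. The right factor is then what is left of x. *)
Lemma ncmp_left_uniq p w v w' v' x : ncmp p w v x -> ncmp p w' v' x ->
  (forall q a, (p < q)%N -> w q a = w' q a) -> w = w' /\ v = v'.
Proof.
move=> h h' e; have ww : w = w'.
  apply: nu_ext => q a.
  move/ncmpP: h h' => [h1 h2 h3 h4 h5] /ncmpP[k1 k2 k3 k4 k5].
  case: (ltngtP q p) => [qp|pq|->]; first by rewrite (h1 q a qp).1 (k1 q a qp).1.
    exact: e.
  case: a; last by rewrite h2 k2.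
  by rewrite (nu_tgt w p true) (nu_tgt w' p true) h2 k2 (e p.+1).
split => //; subst w'; apply: nu_ext => q a.
move/ncmpP: h h' => [h1 h2 h3 h4 h5] /ncmpP[k1 k2 k3 k4 k5].
case: (ltngtP q p) => [qp|pq|->]; first by rewrite (h1 q a qp).2 (k1 q a qp).2.
  by apply: (addrI (w q a)); rewrite -h5 // -k5.
by case: a; [rewrite h3 k3 | rewrite -h4 -k4].
Qed.

Definition triv p x := forall q a, (p < q)%N -> x q a = 0.

Lemma trivP p x : triv p x <-> @is_identity (nuI n) p x.
Proof.
split=> [h|[h _] q a pq].
  have e : x p true = x p false by rewrite (nu_tgt x p true) (h p.+1) // boundary0 addr0.
  split; apply: nu_ext => q a /=; rewrite /dchain_d;
  by case: (ltngtP q p) => // [/h->|->] //; case: a.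
rewrite -h /= /dchain_d ltnNge (ltnW pq) /=.
by rewrite gtn_eqF.
Qed.

Lemma add_eq0 c d : (forall t, 0 <= c t) -> (forall t, 0 <= d t) ->
  c + d = 0 -> c = 0 /\ d = 0.
Proof.
move=> hc hd /ffunP h; split; apply/ffunP => t; have := h t;
  by rewrite !ffunE; move: (hc t) (hd t); move: (c t) (d t) => u v; lia.
Qed.

(** Chains are nonnegative, so nothing cancels in a vanishing sum; the interface of the two factors
    at level p is the source of x plus the boundary of a vanishing chain. *)
Lemma triv_cmp p r y z x : ncmp p y z x -> triv r x -> triv r y /\ triv r z.
Proof.
move=> /ncmpP[h1 h2 h3 h4 h5] hx.
have gt q a : (p < q)%N -> (r < q)%N -> y q a = 0 /\ z q a = 0.
  move=> pq rq; apply: add_eq0; try by move=> t; apply: nu_ge0.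
  by rewrite -h5 // hx.
split=> q a rq; case: (ltngtP q p) => [qp|pq|e].
- by rewrite (h1 q a qp).1 hx.
- by have [] := gt q a pq rq.
- subst q; case: a; last by rewrite h2 hx.
  rewrite (nu_tgt y p true) h2 hx // add0r.
  by have [-> _] := gt p.+1 true (ltnSn _) (leqW rq); rewrite boundary0.
- by rewrite (h1 q a qp).2 hx.
- by have [] := gt q a pq rq.
subst q; case: a; first by rewrite h3 hx.
rewrite -h4 (nu_tgt y p true) h2 hx // add0r.
by have [-> _] := gt p.+1 true (ltnSn _) (leqW rq); rewrite boundary0.
Qed.

(** The measure for inductions over decompositions. By [nu_total] the target chains would give the
    same count, and a nontrivial factor strictly lowers the count of its partner. *)
Definition mu x : int := \sum_(q < n.+1) total (x q false).

Lemma mu_ge0 x : 0 <= mu x.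
Proof. by apply: sumr_ge0 => q _; apply: total_ge0 => t; apply: nu_ge0. Qed.

Lemma mu_d p a x : mu (nu_d p a x) <= mu x.
Proof.
apply: ler_sum => q _ /=; rewrite /dchain_d; case: ifP => // _.
case: (_ =P p) => [->|_]; first by rewrite nu_total.
rewrite {1}/total big1 => [|t _]; last by rewrite ffunE.
by apply: total_ge0 => t; apply: nu_ge0.
Qed.

Lemma mu_cmp_l p y z x : ncmp p y z x ->
  mu x = mu y + \sum_(q < n.+1 | (p < q)%N) total (z q false).
Proof.
move=> /ncmpP[h1 h2 h3 h4 h5]; rewrite [X in _ + X]big_mkcond /= /mu -big_split /=.
apply: eq_bigr => q _; case: (ltngtP q p) => [qp|pq|->].
- by rewrite (h1 q false qp).1 addr0.
- by rewrite h5 // totalD.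
by rewrite h2 addr0.
Qed.

Lemma mu_cmp_r p y z x : ncmp p y z x ->
  mu x = mu z + \sum_(q < n.+1 | (p < q)%N) total (y q false).
Proof.
move=> /ncmpP[h1 h2 h3 h4 h5]; rewrite [X in _ + X]big_mkcond /= /mu -big_split /=.
apply: eq_bigr => q _; case: (ltngtP q p) => [qp|pq|->].
- by rewrite (h1 q false qp).2 addr0.
- by rewrite h5 // totalD addrC.
by rewrite -(nu_total _ _ true) -(nu_total z _ true) h3 addr0.
Qed.

Lemma sum_total_ge0 p x : 0 <= \sum_(q < n.+1 | (p < q)%N) total (x q false).
Proof. by apply: sumr_ge0 => q _; apply: total_ge0 => t; apply: nu_ge0. Qed.

Lemma sum_total_gt0 p x : ~ triv p x ->
  0 < \sum_(q < n.+1 | (p < q)%N) total (x q false).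
Proof.
move=> h; rewrite lt_neqAle sum_total_ge0 andbT eq_sym; apply/negP => /eqP h0.
apply: h => q a pq; case: (ltnP n q) => [|qn]; first exact: nu_gt.
apply: total_eq0; first by move=> t; apply: nu_ge0.
rewrite nu_total; move/eqP: h0; rewrite psumr_eq0 => [/allP h0|i _]; last first.
  by apply: total_ge0 => t; apply: nu_ge0.
have := h0 (Ordinal (qn : (q < n.+1)%N)); rewrite mem_index_enum => /(_ isT) /=.
by rewrite pq => /eqP.
Qed.

Lemma mu_le_l p y z x : ncmp p y z x -> mu y <= mu x.
Proof. by move/mu_cmp_l ->; rewrite lerDl sum_total_ge0. Qed.

Lemma mu_le_r p y z x : ncmp p y z x -> mu z <= mu x.
Proof. by move/mu_cmp_r ->; rewrite lerDl sum_total_ge0. Qed.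

Lemma mu_lt_l p y z x : ncmp p y z x -> ~ triv p z -> mu y < mu x.
Proof. by move/mu_cmp_l -> => /sum_total_gt0; rewrite ltrDl. Qed.

Lemma mu_lt_r p y z x : ncmp p y z x -> ~ triv p y -> mu z < mu x.
Proof. by move/mu_cmp_r -> => /sum_total_gt0; rewrite ltrDl. Qed.

Lemma mu_ind (P : nu n -> Prop) :
  (forall x, (forall y, mu y < mu x -> P y) -> P x) -> forall x, P x.
Proof.
move=> step; suff h m x : mu x < m%:Z -> P x.
  by move=> x; apply: (h `|mu x|.+1 x); move: (mu_ge0 x); lia.
elim: m x => [|m IH] x hx; first by move: (mu_ge0 x); lia.
by apply: step => y yx; apply: IH; lia.
Qed.

(** * Sums of atoms *)

Definition psum S q a : chain n := \sum_(b <- S) cell_chain b a q.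

Lemma psumE S q a t : psum S q a t = \sum_(b <- S) cell_chain b a q t.
Proof. by rewrite /psum sum_ffunE. Qed.

Lemma psum_cat S T q a : psum (S ++ T) q a = psum S q a + psum T q a.
Proof. exact: big_cat. Qed.

Lemma psum_cons b S q a : psum (b :: S) q a = cell_chain b a q + psum S q a.
Proof. exact: big_cons. Qed.

Lemma psum1 b q a : psum [:: b] q a = cell_chain b a q.
Proof. exact: big_seq1. Qed.

Lemma psum_ge0 S q a t : 0 <= psum S q a t.
Proof. by rewrite psumE; apply: sumr_ge0 => b _; apply: cell_chain_ge0. Qed.

Lemma psum_neq0 S q a t : psum S q a t != 0 ->
  exists2 b, b \in S & cell_chain b a q t != 0.
Proof.
rewrite psumE => h; suff /hasP : has (fun b => cell_chain b a q t != 0) S by [].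
apply: contraR h => /hasPn h; rewrite big_seq big1 // => b /h.
by rewrite negbK => /eqP.
Qed.

Lemma psum_mem S q a t b : b \in S -> cell_chain b a q t <= psum S q a t.
Proof.
move=> h; rewrite psumE (big_rem b) //= lerDl.
by apply: sumr_ge0 => c _; apply: cell_chain_ge0.
Qed.

Lemma psum_bd S q a : boundary (psum S q.+1 a) = psum S q true - psum S q false.
Proof.
elim: S => [|b S IH]; first by rewrite /psum !big_nil boundary0 subrr.
rewrite !psum_cons boundaryD IH.
rewrite -(nu_bd (catom b) q a) /= addrACA opprD //.
Qed.

(** Nothing is required at levels up to p, where faces of different pieces may be glued together. *)
Definition rep x p S := forall q a, (p < q)%N -> x q a = psum S q a.

Lemma rep_perm x p S T : perm_eq S T -> rep x p S -> rep x p T.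
Proof. by move=> h r q a pq; rewrite r // /psum (perm_big T). Qed.

Lemma rep_bd x p S : rep x p S -> x p true = x p false + (psum S p true - psum S p false).
Proof. by move=> h; rewrite (nu_tgt x p true) (h p.+1) // psum_bd. Qed.

Lemma augmentationD c d : augmentation (c + d) = augmentation c + augmentation d.
Proof. by rewrite /augmentation -big_split; apply: eq_bigr => t _; rewrite ffunE. Qed.

Lemma augmentation_psum S a : augmentation (psum S 0%N a) = (size S)%:R.
Proof.
elim: S => [|b S IH].
  by rewrite /psum big_nil /augmentation big1 // => t _; rewrite ffunE.
rewrite psum_cons augmentationD IH.
by have [_ _ h _] := nuP (catom b); rewrite [X in X + _](h a) /= mulrS.
Qed.

Lemma psum_homog S q a t : psum S q a t != 0 -> deg t = q.
Proof. by case/psum_neq0 => b _ /cell_chain_neq0[]. Qed.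

(* The source of [x] at level [p], pushed across the pieces in [S]. *)
Definition push x p S : chain n := x p false + (psum S p true - psum S p false).

Lemma push_homog x p S : homogeneous p (push x p S).
Proof.
move=> t; rewrite !ffunE => h.
have : [|| x p false t != 0, psum S p true t != 0 | psum S p false t != 0].
  by apply: contraR h; rewrite !negb_or !negbK => /and3P[/eqP-> /eqP-> /eqP->].
by case/or3P => [/nu_homog|/psum_homog|/psum_homog].
Qed.

Lemma push_aug x S : augmentation (push x 0 S) = 1.
Proof.
have [_ _ h _] := nuP x; rewrite augmentationD h.
suff -> : augmentation (psum S 0 true - psum S 0 false) = 0 by rewrite addr0.
apply: (addIr (augmentation (psum S 0 false))).
by rewrite -augmentationD subrK !augmentation_psum add0r.
Qed.
End Nu.

(** * Decomposition into pieces *)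

(* Values of a chain at a cell occur with distinct but convertible finite type *)
(* structures, which [lia] does not identify: they are generalized first.      *)
Ltac chain_lia := repeat match goal with
  |- context [@fun_of_fin ?A ?B ?P ?f ?t] => move: (@fun_of_fin A B P f t)
  end; lia.

Section Pieces.
Variable n : nat.
Implicit Types (x y z : nu n) (t e b c : cell n) (S T : seq (cell n)).

Lemma chainD (c d : chain n) t : (c + d) t = c t + d t.
Proof. by rewrite ffunE. Qed.

Lemma chainN (c : chain n) t : (- c) t = - c t.
Proof. by rewrite ffunE. Qed.

Definition chainE := (chainD, chainN).

Definition above p S := all (fun b : cell n => p < deg b)%N S.

Lemma boundary_push x q S : boundary (push x q.+1 S) = boundary (x q.+1 false).
Proof. by rewrite boundaryD boundaryB !psum_bd subrr addr0. Qed.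

(** The pushed chain becomes the interface, as target of y and source of z at level p. Its
    nonnegativity is the only condition on y and z that is not automatic. *)
Lemma split_push x p S1 S2 : rep x p (S1 ++ S2) -> (forall t, 0 <= push x p S1 t) ->
  exists y z, [/\ ncmp p y z x, rep y p S1 & rep z p S2].
Proof.
move=> hx hp; have [x1 x2 x3 x4] := nuP x.
pose f : dchain n := fun q a => if (q < p)%N then x q a else
  if q == p then (if a then push x p S1 else x p false) else psum S1 q a.
pose g : dchain n := fun q a => if (q < p)%N then x q a else
  if q == p then (if a then x p true else push x p S1) else psum S2 q a.
have hf : nu_cond f.
  rewrite /f; split=> [q a|q a|a|q a].
  - case: ifP => // _; case: eqP => [->|_]; last by move=> t /psum_homog.
    by case: a => //; apply: push_homog.
  - case: ifP => // _; case: eqP => [_|_]; last by move=> t; apply: psum_ge0.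
    by case: a.
  - case: ifP => [_|/negbT]; first exact: x3.
    rewrite -leqNgt leqn0 => /eqP ->; rewrite eqxx.
    by case: a; [apply: push_aug|apply: x3].
  case: (ltngtP q p) => [qp|pq|e].
  - case: (ltngtP q.+1 p) => [_|h|e]; [exact: x4|by rewrite ltnNge qp in h|].
    by rewrite -e; case: a; rewrite ?boundary_push -(x4 q false).
  - by rewrite ltnNge ltnW ?gtn_eqF ?ltnS 1?ltnW //= psum_bd.
  by rewrite e ltnNge leqnSn /= gtn_eqF // psum_bd [LHS]addrC addKr.
have hg : nu_cond g.
  rewrite /g; split=> [q a|q a|a|q a].
  - case: ifP => // _; case: eqP => [->|_]; last by move=> t /psum_homog.
    by case: a => //; apply: push_homog.
  - case: ifP => // _; case: eqP => [_|_]; last by move=> t; apply: psum_ge0.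
    by case: a.
  - case: ifP => [_|/negbT]; first exact: x3.
    rewrite -leqNgt leqn0 => /eqP ->; rewrite eqxx.
    by case: a; [apply: x3|apply: push_aug].
  case: (ltngtP q p) => [qp|pq|e].
  - case: (ltngtP q.+1 p) => [_|h|e]; [exact: x4|by rewrite ltnNge qp in h|].
    by rewrite -e; case: a; rewrite ?boundary_push; [apply: x4|rewrite -(x4 q false)].
  - by rewrite ltnNge ltnW ?gtn_eqF ?ltnS 1?ltnW //= psum_bd.
  rewrite e ltnNge leqnSn /= gtn_eqF // psum_bd (rep_bd hx) /push !psum_cat.
  move: (x p false) (psum _ _ _) (psum _ _ _) (psum _ _ _) (psum _ _ _).
  move=> A B D E F; apply/ffunP => t; rewrite !ffunE.
  by move: (A t) (B t) (D t) (E t) (F t); lia.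
exists (Nu hf), (Nu hg); split.
- apply/ncmpP; split=> [q a qp||||q a pq] /=; rewrite /f /g ?ltnn ?eqxx ?qp //.
  by rewrite ltnNge (ltnW pq) /= (gtn_eqF pq) hx // psum_cat.
- by move=> q a pq; rewrite /= /f ltnNge (ltnW pq) /= (gtn_eqF pq).
by move=> q a pq; rewrite /= /g ltnNge (ltnW pq) /= (gtn_eqF pq).
Qed.

(* If a piece of [S1] consumes [t], then [t] precedes all of [S2], so no piece *)
(* of [S2] produces [t], and the coefficient of [t] is at least its final one. *)
Lemma split_rep x p S1 S2 : rep x p (S1 ++ S2) -> above p (S1 ++ S2) ->
  (forall b c, b \in S1 -> c \in S2 -> rank b <= rank c) ->
  exists y z, [/\ ncmp p y z x, rep y p S1 & rep z p S2].
Proof.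
move=> hx habove hr; apply: split_push => // t.
have [h0|/psum_neq0[b bS ht]] := eqVneq (psum S1 p false t) 0.
  by rewrite !ffunE h0 subr0 addr_ge0 ?nu_ge0 ?psum_ge0.
have /allP ab := habove.
have tb := cell_chain_rank (ab b _) ht.
have h2 : psum S2 p true t = 0.
  apply/eqP; apply/negP => /negP/psum_neq0[c cS hc].
  have tc := cell_chain_rank (ab c _) hc.
  have := hr b c bS cS; rewrite leNgt (lt_trans (tc _) (tb _)) //.
    by rewrite mem_cat cS orbT.
  by rewrite mem_cat bS.
have := nu_ge0 x p true t; rewrite (rep_bd hx) !psum_cat !ffunE h2.
by have := psum_ge0 S2 p false t; chain_lia.
Qed.

Lemma rep_nontriv x p S : rep x p S -> above p S -> S != [::] -> ~ triv p x.
Proof.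
case: S => // b S hx /= /andP[pb _] _ ht.
have := @psum_mem n (b :: S) (deg b) true b b (mem_head _ _).
by rewrite -(hx _ true pb) ht // cell_chain_deg !ffunE eqxx.
Qed.

Lemma rep_triv x p : rep x p [::] -> triv p x.
Proof. by move=> h q a pq; rewrite h // /psum big_nil. Qed.

Lemma seq_max (I : eqType) (f : I -> nat) (s : seq I) : s != [::] ->
  exists2 i, i \in s & forall j, j \in s -> (f j <= f i)%N.
Proof.
elim: s => // i [|j s] IH _.
  by exists i; rewrite ?mem_head // => j; rewrite inE => /eqP ->.
have [//|k ks hk] := IH; case: (leqP (f k) (f i)) => h.
  exists i; rewrite ?mem_head // => u; rewrite inE => /predU1P[->//|/hk].
  by move=> /leq_trans; apply.
exists k => [|u]; first by rewrite inE ks orbT.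
by rewrite inE => /predU1P[->|/hk //]; apply: ltnW.
Qed.

Lemma min_rank S : S != [::] -> exists b T,
  perm_eq S (b :: T) /\ forall c, c \in T -> rank b <= rank c.
Proof.
elim: S => // b [|c S] IH _; first by exists b, [::].
have [//|d [T [pT hd]]] := IH; case: (leP (rank b) (rank d)) => h.
  exists b, (c :: S); split=> // u; rewrite (perm_mem pT) inE.
  by move=> /predU1P[->//|/hd]; apply: le_trans.
exists d, (b :: T); split.
  apply: (@perm_trans _ (b :: d :: T)); first by rewrite perm_cons.
  by rewrite (perm_catCA [:: b] [:: d] T).
by move=> u; rewrite inE => /predU1P[->|/hd //]; apply: ltW.
Qed.

(** A piece b of S of maximal degree is a face of some piece c of T, and c is a face of some piece
    of S; the degrees force b = c. This piece is removed from both lists. *)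
Lemma psum_inj p S T : above p S -> above p T ->
  (forall q a, (p < q)%N -> psum S q a = psum T q a) -> perm_eq S T.
Proof.
have mem S' T' (b : cell n) : b \in S' -> (p < deg b)%N ->
    (forall q a, (p < q)%N -> psum S' q a = psum T' q a) ->
    exists2 c, c \in T' & matches c true b.
  move=> bS pb h; have := @psum_mem n S' (deg b) true b b bS.
  rewrite h // cell_chain_deg !ffunE eqxx => hb.
  have /psum_neq0[c cT /cell_chain_neq0[_ m]] : psum T' (deg b) true b != 0.
    by apply/eqP => e; rewrite e in hb.
  by exists c.
move: {2}(size S) (erefl (size S)) => k; elim: k S T => [|k IH] S T.
  move=> /size0nil -> _; case: T => // c T /= /andP[pc _] h.
  by have [] := mem (c :: T) [::] c (mem_head _ _) pc (fun q a pq => esym (h q a pq)).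
move=> sS aS aT h; have [|b bS bmax] := @seq_max _ (@deg n) S; first by case: (S) sS.
have [c cT mc] := mem S T b bS (allP aS b bS) h.
have [d dS md] := mem T S c cT (allP aT c cT) (fun q a pq => esym (h q a pq)).
have bc : b = c.
  apply: (matches_eq mc); apply/eqP; rewrite eqn_leq (matches_deg mc) /=.
  exact: leq_trans (matches_deg md) (bmax d dS).
subst c; rewrite (permPl (perm_to_rem bS)) (permPr (perm_to_rem cT)) perm_cons.
apply: IH; first by rewrite size_rem // sS.
- by apply/allP => u /mem_rem /(allP aS).
- by apply/allP => u /mem_rem /(allP aT).
move=> q a pq; have := h q a pq.
rewrite {1}/psum (perm_big _ (perm_to_rem bS)) big_cons /=.
rewrite [X in _ = X]/psum (perm_big _ (perm_to_rem cT)) big_cons /=.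
exact: addrI.
Qed.

Lemma rep_uniq x p S T : above p S -> above p T -> rep x p S -> rep x p T -> perm_eq S T.
Proof.
move=> aS aT hS hT; apply: (psum_inj aS aT) => q a pq.
by rewrite -hS // hT.
Qed.

Definition nosplit p x := forall y z, ncmp p y z x -> triv p y \/ triv p z.

Lemma cell_chain_disjoint b q t : (q < deg b)%N ->
  cell_chain b true q t = 0 \/ cell_chain b false q t = 0.
Proof.
move=> qb; have [->|h] := eqVneq (cell_chain b true q t) 0; first by left.
have [->|h'] := eqVneq (cell_chain b false q t) 0; first by right.
have := lt_trans (cell_chain_rank qb h) (cell_chain_rank qb h').
by rewrite ltxx.
Qed.

(** Going down in degree: once z vanishes in degree q + 1, its source and target in degree q
    coincide, but they lie below the source and target of b, which are disjoint. *)
Lemma nosplit1_aux z p b :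
  (forall q a t, (p < q)%N -> z q a t <= cell_chain b a q t) ->
  z (deg b) false = 0 -> triv p z.
Proof.
move=> h hz; suff H k q : (p < q)%N -> (n < q + k)%N -> forall a, z q a = 0.
  by move=> q a pq; apply: (H n.+1) => //; rewrite addnS ltnS leq_addl.
elim: k q => [|k IH] q pq qk; first by move=> a; apply: nu_gt; rewrite -(addn0 q).
have e : z q true = z q false.
  have h1 : z q.+1 true = 0 by apply: IH; [apply: leqW|rewrite addSnnS].
  by rewrite (nu_tgt z q true) h1 boundary0 addr0.
suff h0 : z q false = 0 by case; rewrite ?e.
case: (ltngtP q (deg b)) => [qb|bq|->//]; apply/ffunP => t; rewrite ffunE.
  have := nu_ge0 z q false t; have := h q true t pq; have := h q false t pq.
  by rewrite e; have [->|->] := cell_chain_disjoint t qb; chain_lia.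
have := nu_ge0 z q false t; have := h q false t pq.
by rewrite cell_chain_gt // ffunE; chain_lia.
Qed.

(** In degree [deg b] there is the single term b, which falls to one of the factors; the other one
    is trivial by [nosplit1_aux]. *)
Lemma nosplit1 x p b : rep x p [:: b] -> nosplit p x.
Proof.
move=> hx y z h.
have E q a t : (p < q)%N -> y q a t + z q a t = cell_chain b a q t.
  move=> pq; have /ffunP/(_ t) := ncmp_gt a h pq.
  by rewrite hx // psum1 chainD => ->.
have yl q a t : (p < q)%N -> y q a t <= cell_chain b a q t.
  by move=> pq; rewrite -E // lerDl nu_ge0.
have zl q a t : (p < q)%N -> z q a t <= cell_chain b a q t.
  by move=> pq; rewrite -E // lerDr nu_ge0.
case: (leqP (deg b) p) => [bp|pb].
  left=> q a pq; apply/ffunP => t; have := yl q a t pq; have := nu_ge0 y q a t.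
  by rewrite cell_chain_gt ?(leq_ltn_trans bp) // ffunE; chain_lia.
have [y0|yn] := eqVneq (y (deg b) false) 0; [left|right].
  exact: nosplit1_aux yl y0.
apply: nosplit1_aux zl _; apply/ffunP => t; rewrite ffunE.
have : y (deg b) false b != 0.
  apply: contra_neq yn => yb; apply/ffunP => u; rewrite [RHS]ffunE.
  have [->//|ub] := eqVneq u b.
  have := yl _ false u pb; have := nu_ge0 y (deg b) false u.
  by rewrite cell_chain_deg ffunE (negPf ub); chain_lia.
have := E _ false t pb; have := nu_ge0 y (deg b) false t.
have := nu_ge0 z (deg b) false t.
rewrite cell_chain_deg ffunE; have [->|_] := eqVneq t b => /=; chain_lia.
Qed.

Lemma nosplit_triv x p : triv p x -> nosplit p x.
Proof. by move=> h y z /triv_cmp/(_ h)[]; left. Qed.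

Lemma chain_pieces (c : chain n) q : (forall t, 0 <= c t) -> homogeneous q c ->
  exists2 T, all (fun b => deg b == q) T & forall a, psum T q a = c.
Proof.
move=> c0 hc; exists (flatten [seq nseq `|c t|%N t | t <- enum {: cell n}]).
  apply/allP => b /flatten_mapP[t _]; rewrite mem_nseq => /andP[ct /eqP ->].
  by apply/eqP/hc; rewrite -absz_gt0.
move=> a; apply/ffunP => e; rewrite psumE big_flatten big_map big_enum /=.
rewrite (bigD1 e) //= [X in _ + X]big1 ?addr0 => [|t te].
  rewrite big_nseq -Monoid.iteropE -/(GRing.natmul _ _).
  have [->//|/hc dq] := eqVneq (c e) 0; rewrite -dq cell_chain_deg ffunE eqxx.
  by rewrite natr_absz ger0_norm // intz.
rewrite big_seq big1 // => b; rewrite mem_nseq => /andP[ct /eqP ->].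
have dq : deg t = q by apply: hc; rewrite -absz_gt0.
by rewrite -dq cell_chain_deg ffunE eq_sym (negPf te).
Qed.

(** The part of the source of x in degree p + 1 that S does not consume supplies the new pieces. It
    is also the part of the target that S does not produce. *)
Lemma rep_down x p S : rep x p.+1 S -> above p.+1 S ->
  (forall t, psum S p.+1 false t <= x p.+1 false t) ->
  exists T, [/\ rep x p (S ++ T), all (fun b => deg b == p.+1) T & above p (S ++ T)].
Proof.
move=> hx aS hle.
have [||T aT hT] := @chain_pieces (x p.+1 false - psum S p.+1 false) p.+1.
- by move=> t; rewrite !ffunE subr_ge0.
- move=> t; rewrite !ffunE => h.
  have : (x p.+1 false t != 0) || (psum S p.+1 false t != 0).
    by apply: contraR h; rewrite negb_or !negbK => /andP[/eqP-> /eqP->].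
  by case/orP => [/nu_homog|/psum_homog].
exists T; split=> //.
  move=> q a; rewrite leq_eqVlt => /predU1P[<-|pq]; rewrite psum_cat.
    rewrite hT; case: a; last by rewrite addrC subrK.
    by rewrite (rep_bd hx) addrCA.
  rewrite hx // -[LHS]addr0; congr (_ + _); apply/esym.
  rewrite /psum big_seq big1 // => b /(allP aT)/eqP db.
  by rewrite cell_chain_gt // db.
rewrite /above all_cat; apply/andP; split.
  by apply/allP => b /(allP aS) /ltnW.
by apply/allP => b /(allP aT)/eqP ->.
Qed.

(** Source and target of a single piece b are disjoint, so nonnegativity of the target of x forces
    the source of x to contain that of b. *)
Lemma rep_down1 x p S : rep x p.+1 S -> above p.+1 S -> (size S <= 1)%N ->
  exists T, rep x p T /\ above p T.
Proof.
move=> hx aS sS; have [|T [h1 _ h2]] := rep_down hx aS; last by exists (S ++ T).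
move=> t; case: S sS hx aS => [|b [|//]] _ hx /= => [_|/andP[pb _]].
  by rewrite /psum big_nil ffunE nu_ge0.
have /ffunP/(_ t) := rep_bd hx.
have := nu_ge0 x p.+1 true t; rewrite !psum1 !chainE.
have := nu_ge0 x p.+1 false t.
by have [->|->] := cell_chain_disjoint t pb; have := cell_chain_ge0 b true p.+1 t; chain_lia.
Qed.

Lemma descend x p : (p <= n)%N ->
  (exists q S, [/\ (p < q)%N, (1 < size S)%N, rep x q S, above q S &
     forall r, (q < r)%N -> nosplit r x]) \/
  (exists S, [/\ rep x p S, above p S & forall r, (p < r)%N -> nosplit r x]).
Proof.
move=> pn; rewrite -(subKn pn); elim: (n - p)%N (leq_subr p n) => [_|k IH kn].
  right; exists [::]; rewrite subn0; split=> // [q a nq|r nr].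
    by rewrite nu_gt // /psum big_nil.
  by apply: nosplit_triv => q a rq; apply: nu_gt; apply: ltn_trans rq.
rewrite -(subnSK kn) in IH.
have [[q [S [h1 h2 h3 h4 h5]]]|[S [h1 h2 h3]]] := IH (ltnW kn).
  by left; exists q, S; split=> //; apply: ltnW.
case: (ltnP 1 (size S)) => sS; first by left; exists (n - k.+1).+1, S.
right; have [T [hT aT]] := rep_down1 h1 h2 sS.
exists T; split=> // r; rewrite leq_eqVlt => /predU1P[<-|]; last exact: h3.
case: S sS h1 {h2} => [|b [|//]] _ h1; last exact: nosplit1 h1.
exact/nosplit_triv/rep_triv.
Qed.

Lemma ge_basis (c : chain n) t : (forall e, 0 <= c e) -> c t != 0 -> total c = 1 ->
  c = basis_chain t.
Proof.
move=> c0 ct h1; apply/eqP; rewrite -subr_eq0; apply/eqP/total_eq0 => [e|].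
  rewrite !ffunE; have [->|_] := eqVneq e t; last by rewrite subr0.
  by rewrite subr_ge0; have := c0 t; move: ct; chain_lia.
by rewrite totalB h1 total_basis subrr.
Qed.

(** If the descent reaches level 0 with at most one piece, then, the 0-chains having total 1, x can
    only be the atom of that piece or of a vertex. *)
Lemma decomposition x : (exists t, x = catom t) \/
  exists p S, [/\ (1 < size S)%N, rep x p S, above p S &
     forall r, (p < r)%N -> nosplit r x].
Proof.
have [[q [S [_ h2 h3 h4 h5]]]|[S [h1 h2 h3]]] := @descend x 0 isT.
  by right; exists q, S.
case: (ltnP 1 (size S)) => sS; first by right; exists 0%N, S.
left; case: S sS h1 h2 => [|b [|//]] _ h1 /= => [_|/andP[b0 _]]; last first.
  exists b; apply: nu_ext => q a; case: q => [|q]; last by rewrite h1 // psum1.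
  have le t : cell_chain b a 0 t <= x 0%N a t.
    have /ffunP/(_ t) := rep_bd h1.
    have := nu_ge0 x 0 true t; rewrite !psum1 !chainE; have := nu_ge0 x 0 false t.
    by case: a; have [->|->] := cell_chain_disjoint t b0;
      have := cell_chain_ge0 b true 0 t; have := cell_chain_ge0 b false 0 t; chain_lia.
  apply/eqP; rewrite -subr_eq0; apply/eqP/total_eq0 => [t|].
    by rewrite !chainE subr_ge0 le.
  by rewrite totalB nu_total0 (nu_total0 (catom b)) subrr.
have [t ht] : exists t, x 0%N true t != 0.
  apply/existsP; apply: contra_eqT (nu_total0 x true) => /existsPn h.
  rewrite /total big1 // => t _; apply/eqP; have := h t; by rewrite negbK.
exists t; have dt := nu_homog ht; apply: nu_ext => q a.
case: q => [|q]; last by rewrite (rep_triv h1) //= cell_chain_gt // dt.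
have e : x 0%N a = x 0%N true.
  by case: a => //; rewrite (nu_tgt x 0 true) (rep_triv h1 true (ltnSn 0)) boundary0 addr0.
rewrite e /= -dt cell_chain_deg; apply: ge_basis => //; last by rewrite dt nu_total0.
  by move=> u; apply: nu_ge0.
by rewrite dt.
Qed.

Lemma split_min x p S : (1 < size S)%N -> rep x p S -> above p S ->
  exists b T w v, [/\ perm_eq S (b :: T), T != [::],
    (forall c, c \in T -> rank b <= rank c) &
    [/\ ncmp p w v x, rep w p [:: b] & rep v p T]].
Proof.
move=> sS hx aS; have [|b [T [pT hb]]] := @min_rank S; first by case: (S) sS.
have aT : above p (b :: T) by rewrite /above -(perm_all _ pT).
have [|w [v [h1 h2 h3]]] := @split_rep x p [:: b] T (rep_perm pT hx) aT.
  by move=> c d; rewrite inE => /eqP ->; apply: hb.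
exists b, T, w, v; split=> //.
by move: sS; rewrite (perm_size pT) /= ltnS lt0n size_eq0.
Qed.

(** The descent stops early only at a level with two pieces, where x would split properly. *)
Lemma rep_of_nosplit x p : (forall r, (p < r)%N -> nosplit r x) ->
  exists S, rep x p S /\ above p S.
Proof.
move=> hx; case: (leqP p n) => [pn|np]; last first.
  exists [::]; split=> // q a pq; rewrite nu_gt ?(ltn_trans np) //.
  by rewrite /psum big_nil.
case: (descend x pn) => [[q [S [pq sS hS aS _]]]|[S [h1 h2 _]]]; last by exists S.
have [b [T [w [v [pT T0 _ [h1 h2 h3]]]]]] := split_min sS hS aS.
have /andP[ab aT] : (q < deg b)%N && above q T by have := aS; rewrite /above (perm_all _ pT).
have [] := hx q pq w v h1.
  by move/(rep_nontriv h2); rewrite /above /= ab; case.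
by move/(rep_nontriv h3 aT T0).
Qed.

Lemma nosplit_cmp p r y z x : (p < r)%N -> ncmp p y z x -> nosplit r x ->
  nosplit r y /\ nosplit r z.
Proof.
move=> pr h hx; split=> u v huv.
  have [s [t [h1 h2 h3]]] := cmp_grid pr huv (@cmp_idl (nuI n) r z) h.
  case: (hx s t h3) => ht; [left|right]; [by have [] := triv_cmp h1 ht|].
  by have [] := triv_cmp h2 ht.
have [s [t [h1 h2 h3]]] := cmp_grid pr (@cmp_idl (nuI n) r y) huv h.
case: (hx s t h3) => ht; [left|right]; [by have [] := triv_cmp h1 ht|].
by have [] := triv_cmp h2 ht.
Qed.

End Pieces.

(** * Freeness *)

Section Evaluation.
Variables (n : nat) (C : omega_cat) (P : cell n -> Prop) (phi : cell n -> C).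
Implicit Types (x y z w v : nu n) (t e : cell n) (S T : seq (cell n)).
Implicit Types (c : C).

(* The sub-omega-category of [nuI n * C] generated by the [(catom t, phi t)]. *)
Inductive ev : nu n -> C -> Prop :=
| ev_atom t : P t -> ev (catom t) (phi t)
| ev_cmp p y z x cy cz c :
    ncmp p y z x -> cmp p cy cz c -> ev y cy -> ev z cz -> ev x c.

Definition psupp x := forall q a t, x q a t != 0 -> P t.

(** The boundary condition asks only that the boundary of the value be among the generated values,
    so it can be stated before [ev] is known to be a function. *)
Record diagram : Prop := Diagram {
  diagram_close : forall t i a, P t -> t i = None -> P (close_cell t i a);
  diagram_dim : forall t, P t -> is_identity (deg t) (phi t);
  diagram_bd : forall t q a, P t -> (q < deg t)%N ->
    ev (nu_d q a (catom t)) (od q a (phi t)) }.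

Hypothesis D : diagram.

Lemma face_closed t e :
  (forall i b, t i = Some b -> e i = Some b) -> P t -> P e.
Proof.
move: {2}(deg t) (leqnn (deg t)) => k; elim: k t => [|k IH] t dt h Pt.
  suff -> : e = t by [].
  apply/ffunP => i; case ti: (t i) => [b|]; first exact: h.
  by move: dt; rewrite leqn0 => /eqP/card0_eq/(_ i); rewrite !inE ti.
have [->//|ne] := eqVneq e t.
have /existsP[i hi] : [exists i, e i != t i].
  apply/existsPn => h'; case/eqP: ne; apply/ffunP => i; apply/eqP.
  by have := h' i; rewrite negbK.
case ti: (t i) => [b|]; first by rewrite ti (h i b ti) eqxx in hi.
case ei: (e i) => [b|]; last by rewrite ti ei eqxx in hi.
have ci : close_cell t i b i = Some b by rewrite ffunE eqxx.
have oc : open_cell (close_cell t i b) i = t.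
  by apply/ffunP => j; rewrite !ffunE; case: eqP => // ->.
apply: (IH (close_cell t i b)); first by rewrite -ltnS -(deg_open ci) oc.
  by move=> j b'; rewrite ffunE; case: eqP => [->|_]; [rewrite ei|apply: h].
exact: diagram_close.
Qed.

Lemma boundary_closed (d : chain n) e :
  (forall t, d t != 0 -> P t) -> boundary d e != 0 -> P e.
Proof.
move=> h; rewrite boundaryE => hb.
have /existsP[i] : [exists i, (if e i is Some a then
      (-1) ^+ deg_before e i * sgn_int a * d (open_cell e i) else 0) != 0].
  apply: contraR hb => /existsPn h'; rewrite big1 // => i _; apply/eqP.
  by have := h' i; rewrite negbK.
case ei: (e i) => [a|]; last by rewrite eqxx.
move=> hi; have /h Po : d (open_cell e i) != 0.
  by apply: contra_neq hi => ->; rewrite mulr0.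
apply: face_closed Po => j b; rewrite ffunE.
by case: eqP.
Qed.

(** Above level p nothing cancels. At level p the interface is the source of x plus a boundary, and
    P is closed under faces. *)
Lemma psupp_cmp p y z x : ncmp p y z x -> psupp x -> psupp y /\ psupp z.
Proof.
move=> h hx; have [h1 h2 h3 h4 h5] := (ncmpP p y z x).1 h.
have gt q a : (p < q)%N -> forall t, (y q a t != 0 -> P t) /\ (z q a t != 0 -> P t).
  move=> pq t; have /ffunP/(_ t) := h5 q a pq; rewrite chainD => e.
  by split=> hy; apply: (hx q a t); apply: contra_neq hy; rewrite e;
    move: (nu_ge0 y q a t) (nu_ge0 z q a t); chain_lia.
have mid t : y p true t != 0 -> P t.
  rewrite (nu_tgt y p true) chainD h2 => ht.
  have [e|/hx //] := eqVneq (x p false t) 0; rewrite e add0r in ht.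
  by apply: boundary_closed ht => u; have [] := gt p.+1 true (ltnSn p) u.
split=> q a t; case: (ltngtP q p) => [qp|pq|->].
- by rewrite (h1 q a qp).1; apply: hx.
- by have [] := gt q a pq t.
- by case: a; [apply: mid|rewrite h2; apply: hx].
- by rewrite (h1 q a qp).2; apply: hx.
- by have [] := gt q a pq t.
by case: a; [rewrite h3; apply: hx|rewrite -h4; apply: mid].
Qed.

Lemma ev_psupp x c : ev x c -> psupp x.
Proof.
elim=> [t Pt q a e /cell_chain_neq0[_ m]|p y z u cy cz d h _ _ hy _ hz q a t].
  by apply: face_closed Pt => i b; apply: matches_closed m.
have [h1 h2 h3 h4 h5] := (ncmpP p y z u).1 h.
case: (ltngtP q p) => [qp|pq|->].
- by rewrite -(h1 q a qp).1; apply: hy.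
- rewrite h5 // chainD; have [->|/hy //] := eqVneq (y q a t) 0.
  by rewrite add0r; apply: hz.
by case: a; [rewrite -h3; apply: hz|rewrite -h2; apply: hy].
Qed.

Lemma catom_psupp t : psupp (catom t) -> P t.
Proof.
by move=> h; apply: (h (deg t) true); rewrite /= cell_chain_deg ffunE eqxx.
Qed.

Lemma catom_triv p t : triv p (catom t) -> (deg t <= p)%N.
Proof.
move=> h; rewrite leqNgt; apply/negP => /(h _ true)/ffunP/(_ t).
by rewrite /= cell_chain_deg !ffunE eqxx.
Qed.

Lemma ev_triv p x c : ev x c -> triv p x -> is_identity p c.
Proof.
elim=> [t Pt /catom_triv tp|q y z u cy cz d h h' _ hy _ hz hu].
  exact: is_identity_le tp (diagram_dim D Pt).
have [ty tz] := triv_cmp h hu.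
exact: is_identity_cmp h' (hy ty) (hz tz).
Qed.

Lemma ev_d q a x c : ev x c -> ev (nu_d q a x) (od q a c).
Proof.
elim=> [t Pt|p y z u cy cz d h h' _ hy _ hz].
  case: (ltnP q (deg t)) => [qt|tq]; first exact: diagram_bd.
  have -> : nu_d q a (catom t) = catom t.
    have /trivP/is_identityP h : triv q (catom t); last exact: h.
    by move=> r s qr; apply: cell_chain_gt; apply: leq_ltn_trans qr.
  have /is_identityP -> := is_identity_le tq (diagram_dim D Pt).
  exact: ev_atom.
have [e|pq] := p =P q; last exact: ev_cmp (cmp_d a pq h) (cmp_d a pq h') hy hz.
rewrite -e in hy hz *; case: a hy hz => hy hz.
  by rewrite -[nu_d p true u]/(@od (nuI n) p true u) (cmp_tgt h) (cmp_tgt h').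
by rewrite -[nu_d p false u]/(@od (nuI n) p false u) (cmp_src h) (cmp_src h').
Qed.

Definition comp_val p y z c := exists cy cz, [/\ ev y cy, ev z cz & cmp p cy cz c].

Definition functional x := forall c c', ev x c -> ev x c' -> c = c'.
Definition total_at x := psupp x -> exists c, ev x c.

(** * Independence of the decomposition, by induction on size *)

Section Step.
Variable M : int.
Hypothesis IH : forall x, mu x < M -> functional x /\ total_at x.

Lemma ev_comp_ex p y z x cy cz : ncmp p y z x -> mu y < M ->
  ev y cy -> ev z cz -> exists2 c, cmp p cy cz c & ev x c.
Proof.
move=> h My hy hz; have [|c hc] := @cmp_ex C p cy cz.
  have [f _] := IH (le_lt_trans (mu_d p true y) My).
  apply: f; first exact: ev_d.
  by have e := cmp_comp h; rewrite /= in e; rewrite e; apply: ev_d.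
by exists c => //; apply: ev_cmp h hc hy hz.
Qed.

Lemma ev_split p y z x c : ncmp p y z x -> mu x < M -> ev x c -> comp_val p y z c.
Proof.
move=> h Mx hx; have [sy sz] := psupp_cmp h (ev_psupp hx).
have My := le_lt_trans (mu_le_l h) Mx; have Mz := le_lt_trans (mu_le_r h) Mx.
have [cy hy] := (IH My).2 sy; have [cz hz] := (IH Mz).2 sz.
have [d hd ed] := ev_comp_ex h My hy hz.
by exists cy, cz; split=> //; rewrite ((IH Mx).1 _ _ hx ed).
Qed.

Lemma val_ev p y z x c : ncmp p y z x -> comp_val p y z c -> ev x c.
Proof. by move=> h [cy [cz [hy hz hc]]]; apply: ev_cmp h hc hy hz. Qed.

Lemma val_uniq p y z c c' : mu y < M -> mu z < M ->
  comp_val p y z c -> comp_val p y z c' -> c = c'.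
Proof.
move=> My Mz [a [b [ha hb h]]] [a' [b' [ha' hb' h']]].
rewrite -((IH My).1 _ _ ha ha') -((IH Mz).1 _ _ hb hb') in h'.
exact: cmp_uniq h h'.
Qed.

Lemma val_assocl p y z w y2 v c : mu y < M -> ncmp p w y2 y -> ncmp p y2 z v ->
  comp_val p y z c -> comp_val p w v c.
Proof.
move=> My h1 h2 [cy [cz [hy hz hc]]].
have [a [b [ha hb hab]]] := ev_split h1 My hy.
have [d hd hd'] := cmp_assoc_ex hab hc.
by exists a, d; split=> //; apply: ev_cmp h2 hd hb hz.
Qed.

Lemma val_assocr p y z w y2 v c : mu v < M -> ncmp p y2 z v -> ncmp p w y2 y ->
  comp_val p w v c -> comp_val p y z c.
Proof.
move=> Mv h1 h2 [cw [cv [hw hv hc]]].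
have [a [b [ha hb hab]]] := ev_split h1 Mv hv.
have [d hd hd'] := cmp_assocr_ex hab hc.
by exists d, b; split=> //; apply: ev_cmp h2 hd hw ha.
Qed.

(** Transfers a value from a decomposition at a low level q to one at level p, by the interchange
    law on both sides of [ev]. *)
Lemma val_grid q p (A B A1 A2 B1 B2 y z : nu n) c : (q < p)%N ->
  mu A < M -> mu B < M -> ncmp p A1 A2 A -> ncmp p B1 B2 B ->
  ncmp q A1 B1 y -> ncmp q A2 B2 z -> comp_val q A B c -> comp_val p y z c.
Proof.
move=> qp MA MB hA hB hy hz [a [b [ha hb hc]]].
have [a1 [a2 [ha1 ha2 ha12]]] := ev_split hA MA ha.
have [b1 [b2 [hb1 hb2 hb12]]] := ev_split hB MB hb.
have [u [v [h1 h2 h3]]] := cmp_grid qp ha12 hb12 hc.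
exists u, v; split=> //; [exact: ev_cmp hy h1 ha1 hb1|exact: ev_cmp hz h2 ha2 hb2].
Qed.

Lemma rep_cmp q p y z x S T : (q <= p)%N -> ncmp q y z x ->
  rep y p S -> rep z p T -> rep x p (S ++ T).
Proof.
move=> qp h hy hz r a pr; rewrite (ncmp_gt a h (leq_ltn_trans qp pr)).
by rewrite hy // hz // psum_cat.
Qed.

Lemma split_mem p y S b : rep y p S -> above p S -> b \in S ->
  (forall d, d \in S -> rank b <= rank d) ->
  exists w y2, [/\ ncmp p w y2 y, rep w p [:: b] & rep y2 p (rem b S)].
Proof.
move=> hy aS bS hb; have pS := perm_to_rem bS.
apply: (@split_rep _ y p [:: b] (rem b S)); first exact: rep_perm pS hy.
  by rewrite /above -(perm_all _ pS).
by move=> u d; rewrite inE => /eqP -> /mem_rem; apply: hb.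
Qed.

Lemma left_uniq1 p w v w' v' x b : ncmp p w v x -> rep w p [:: b] ->
  ncmp p w' v' x -> rep w' p [:: b] -> w' = w /\ v' = v.
Proof.
move=> h hw h' hw'; apply: ncmp_left_uniq h' h _ => q a pq.
by rewrite hw // hw'.
Qed.

(** * Moving the least piece to the front *)

Section Front.
Variables (p : nat) (x w v : nu n) (b : cell n).
Hypotheses (Mx : mu x <= M) (hwv : ncmp p w v x) (hw : rep w p [:: b]) (pb : (p < deg b)%N).

Lemma front_l y z S c : ncmp p y z x -> mu y < M -> rep y p S -> above p S ->
  b \in S -> (forall d, d \in S -> rank b <= rank d) ->
  comp_val p y z c -> comp_val p w v c.
Proof.
move=> h My hy aS bS hb; have [w' [y2 [h1 h2 h3]]] := split_mem hy aS bS hb.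
have [v' h4 h5] := cmp_assoc_ex h1 h.
have [e1 e2] := left_uniq1 hwv hw h5 h2; rewrite e1 in h1; rewrite e2 in h4.
exact: val_assocl h1 h4.
Qed.

(** Split b off z and move it to the left factor. What remains of z is nontrivial, so the new left
    factor is smaller than x and [front_l] applies. *)
Lemma front_r y z S T c : ncmp p y z x -> mu y < M -> mu z < M ->
  rep y p S -> rep z p T -> above p S -> above p T ->
  b \in T -> (1 < size T)%N ->
  (forall d, d \in S -> rank b <= rank d) ->
  (forall d, d \in T -> rank b <= rank d) ->
  comp_val p y z c -> comp_val p w v c.
Proof.
move=> h My Mz hy hz aS aT bT sT hbS hbT hc.
have [wz [z2 [h1 h2 h3]]] := split_mem hz aT bT hbT.
have [u h4 h5] := cmp_assocr_ex h1 h.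
have nz2 : ~ triv p z2.
  apply: (rep_nontriv h3); first by apply/allP => d /mem_rem /(allP aT).
  by rewrite -size_eq0 size_rem // -lt0n -ltnS prednK // (ltn_trans _ sT).
apply: (@front_l u z2 (S ++ [:: b])) => //.
- exact: lt_le_trans (mu_lt_l h5 nz2) Mx.
- exact: rep_cmp h4 hy h2.
- by rewrite /above all_cat (aS : all _ _) /= pb.
- by rewrite mem_cat mem_head orbT.
- move=> d; rewrite mem_cat => /orP[/hbS //|].
  by rewrite inE => /eqP ->.
exact: val_assocr h1 h4 hc.
Qed.

(** Here associativity does not suffice. The pieces are independent, so x also decomposes at level p
    - 1 into a part with b and a part with b', and the interchange law compares the two orders. *)
Lemma front_swap y z b' c : ncmp p y z x -> mu y < M -> mu z < M ->
  rep y p [:: b'] -> rep z p [:: b] -> (p < deg b')%N -> rank b <= rank b' ->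
  comp_val p y z c -> comp_val p w v c.
Proof.
move=> h My Mz hy hz pb' bb' hc.
have [h1 h2 h3 h4 h5] := (ncmpP p y z x).1 h.
(* Cells consumed by b rank below b and cells produced by b' rank above b', so b consumes nothing
   that b' produces: the source of x contains both sources. *)
have le t : psum [:: b; b'] p false t <= x p false t.
  rewrite psum_cons psum1 chainD -h2.
  have := nu_ge0 y p false t; have := nu_ge0 y p true t; have := nu_ge0 z p true t.
  rewrite (rep_bd hz) -h4 (rep_bd hy) !psum1 !chainE.
  have [->|hb] := eqVneq (cell_chain b false p t) 0.
    by have [->|->] := cell_chain_disjoint t pb'; have := cell_chain_ge0 b' true p t;
      chain_lia.
  have [->|h0] := cell_chain_disjoint t pb; last by rewrite h0 eqxx in hb.
  have [->|hb'] := eqVneq (cell_chain b' true p t) 0; first by chain_lia.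
  have := lt_trans (cell_chain_rank pb' hb') (cell_chain_rank pb hb).
  by rewrite ltNge bb'.
(* At level 0 the source of x has total 1, which leaves no room for two sources. *)
have [p0|p_gt0] := posnP p.
  have : 2%:R <= total (x 0%N false).
    rewrite (_ : 2%:R = total (psum [:: b; b'] 0 false)).
      by apply: ler_sum => t _; rewrite -p0.
    by rewrite psum_cons psum1 totalD (nu_total0 (catom b)) (nu_total0 (catom b')).
  by rewrite nu_total0.
set q := p.-1; have qp : p = q.+1 by rewrite /q prednK.
have qlt : (q < p)%N by rewrite qp.
have rx : rep x p [:: b; b'].
  apply: (@rep_perm _ x p ([:: b'] ++ [:: b])); last exact: rep_cmp h hy hz.
  by rewrite (perm_catC [:: b']).
have [T [rT dT aT]] : exists T, [/\ rep x q ([:: b; b'] ++ T),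
    all (fun d => deg d == p) T & above q ([:: b; b'] ++ T)].
  rewrite qp; apply: rep_down; rewrite -qp //.
  by rewrite /above /= pb pb'.
(* The new p-dimensional pieces are cut at the rank of b, ties going with b; this separates b from
   b' even when their ranks are equal. *)
pose T1 := [seq d <- T | rank d <= rank b]; pose T2 := [seq d <- T | ~~ (rank d <= rank b)].
have pT : perm_eq ([:: b; b'] ++ T) ((b :: T1) ++ (b' :: T2)).
  rewrite [X in perm_eq _ X]/= perm_cons perm_sym.
  rewrite (perm_catCA T1 [:: b'] T2) /= perm_cons perm_sym.
  by rewrite perm_sym perm_filterC.
have [||A [B [hAB hA hB]]] := split_rep (rep_perm pT rT).
- by rewrite /above -(perm_all _ pT).
- have r1 d : d \in b :: T1 -> rank d <= rank b.
    by rewrite inE mem_filter => /predU1P[->|/andP[]].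
  move=> d e /r1 db; rewrite inE mem_filter -ltNge => /predU1P[->|/andP[be _]].
    exact: le_trans bb'.
  exact: le_trans db (ltW be).
have low S d : S = [seq d <- T | rank d <= rank b] \/ S = [seq d <- T | ~~ (rank d <= rank b)] ->
    forall r a, (p < r)%N -> psum (d :: S) r a = cell_chain d a r.
  move=> hS r a pr; rewrite psum_cons -[RHS]addr0; congr (_ + _).
  rewrite /psum big_seq big1 // => u uS; apply: cell_chain_gt.
  suff /(allP dT)/eqP -> : u \in T by [].
  by case: hS uS => ->; rewrite mem_filter => /andP[].
have hA' : rep A p [:: b].
  by move=> r a pr; rewrite hA ?(ltn_trans qlt) // psum1 low //; left.
have hB' : rep B p [:: b'].
  by move=> r a pr; rewrite hB ?(ltn_trans qlt) // psum1 low //; right.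
have aqT : above q ((b :: T1) ++ (b' :: T2)) by rewrite /above -(perm_all _ pT).
have [aA aB] : above q (b :: T1) /\ above q (b' :: T2).
  by apply/andP; rewrite /above -all_cat.
have MA : mu A < M.
  by apply: lt_le_trans Mx; apply: mu_lt_l hAB _; apply: rep_nontriv hB aB _.
have MB : mu B < M.
  by apply: lt_le_trans Mx; apply: mu_lt_r hAB _; apply: rep_nontriv hA aA _.
have [sA sB] := psupp_cmp hAB (ev_psupp (val_ev h hc)).
have [cA eA] := (IH MA).2 sA; have [cB eB] := (IH MB).2 sB.
have [cx hcx ecx] := ev_comp_ex hAB MA eA eB.
have vAB : comp_val q A B cx by exists cA, cB.
(* Padding A and B with identities for #_p in two ways gives the two orders: B acting first yields
   [y #_p z], and A acting first yields [w #_p v]. *)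
have [u1 [u2 [g1 g2 g3]]] := cmp_grid qlt (@cmp_idl (nuI n) p A) (@cmp_idr (nuI n) p B) hAB.
have [v1 [v2 [k1 k2 k3]]] := cmp_grid qlt (@cmp_idr (nuI n) p A) (@cmp_idl (nuI n) p B) hAB.
have dz (u : nu n) s a r : (p < r)%N -> nu_d p s u r a = 0.
  by move=> pr; rewrite /= /dchain_d ltnNge (ltnW pr) /= gtn_eqF.
have [e1 e2] : u1 = y /\ u2 = z.
  apply: (left_uniq1 h hy g3) => r a pr.
  by rewrite (ncmp_gt a g1 (ltn_trans qlt pr)) (dz A) // add0r hB'.
have [e3 e4] : v1 = w /\ v2 = v.
  apply: (left_uniq1 hwv hw k3) => r a pr.
  by rewrite (ncmp_gt a k1 (ltn_trans qlt pr)) (dz B) // addr0 hA'.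
rewrite e1 in g1; rewrite e2 in g2; rewrite e3 in k1; rewrite e4 in k2.
have vyz : comp_val p y z cx := val_grid qlt MA MB (@cmp_idl (nuI n) p A) (@cmp_idr (nuI n) p B) g1 g2 vAB.
rewrite (val_uniq My Mz hc vyz).
exact: val_grid qlt MA MB (@cmp_idr (nuI n) p A) (@cmp_idl (nuI n) p B) k1 k2 vAB.
Qed.

Lemma front y z S T c : ncmp p y z x -> mu y < M -> mu z < M ->
  rep y p S -> rep z p T -> above p S -> above p T -> S != [::] ->
  b \in S ++ T -> (forall d, d \in S ++ T -> rank b <= rank d) ->
  comp_val p y z c -> comp_val p w v c.
Proof.
move=> h My Mz hy hz aS aT S0 bST hb hc.
have hbS d : d \in S -> rank b <= rank d by move=> dS; apply: hb; rewrite mem_cat dS.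
have hbT d : d \in T -> rank b <= rank d.
  by move=> dT; apply: hb; rewrite mem_cat dT orbT.
case: (boolP (b \in S)) => bS; first exact: front_l h My hy aS bS hbS hc.
have bT : b \in T by move: bST; rewrite mem_cat (negPf bS).
case: (ltnP 1 (size T)) => sT.
  exact: front_r h My Mz hy hz aS aT bT sT hbS hbT hc.
have {sT} eT : T = [:: b].
  by case: T sT bT {hz aT bST hb hbT} => [|d [|//]] // _; rewrite inE => /eqP ->.
(* Now z consists of b alone. If y has several pieces, its least piece s is kept on the left and the
   others join b, so that [front_r] applies. *)
subst T; case: (ltnP 1 (size S)) => sS; last first.
  case: S sS S0 hy aS hbS {bST hb bS} => [|b' [|//]] // _ _ hy /andP[pb' _] hbS.
  by apply: front_swap h My Mz hy hz pb' _ hc; apply: hbS; rewrite mem_head.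
have [s [T' [y1 [y2 [pS T0 _ [h1 h2 h3]]]]]] := split_min sS hy aS.
have /andP[ps aT'] : (p < deg s)%N && above p T'.
  by have := aS; rewrite /above (perm_all _ pS).
have [u h4 h5] := cmp_assoc_ex h1 h.
have ny1 : ~ triv p y1 by apply: rep_nontriv h2 _ _; rewrite //= ps.
apply: (@front_r y1 u [:: s] (T' ++ [:: b])) => //.
- exact: le_lt_trans (mu_le_l h1) My.
- exact: lt_le_trans (mu_lt_r h5 ny1) Mx.
- exact: rep_cmp h4 h3 hz.
- by rewrite /above /= ps.
- by rewrite /above all_cat (aT' : all _ _) /= pb.
- by rewrite mem_cat mem_head orbT.
- by rewrite size_cat /= addn1 ltnS lt0n size_eq0.
- move=> d; rewrite inE => /eqP ->; apply: hbS.
  by rewrite (perm_mem pS) mem_head.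
- move=> d; rewrite mem_cat => /orP[dT|]; last by rewrite inE => /eqP ->.
  by apply: hbS; rewrite (perm_mem pS) inE dT orbT.
exact: val_assocl h1 h4 hc.
Qed.

Lemma front_low q y z S T c : (q < p)%N -> ncmp q y z x -> mu y < M -> mu z < M ->
  rep y p S -> rep z p T -> above p S -> above p T ->
  b \in S ++ T -> (forall d, d \in S ++ T -> rank b <= rank d) ->
  comp_val q y z c -> comp_val p w v c.
Proof.
move=> qp h My Mz hy hz aS aT bST hb hc.
have hbS d : d \in S -> rank b <= rank d by move=> dS; apply: hb; rewrite mem_cat dS.
have hbT d : d \in T -> rank b <= rank d.
  by move=> dT; apply: hb; rewrite mem_cat dT orbT.
have dz (u : nu n) s a r : (p < r)%N -> nu_d p s u r a = 0.
  by move=> pr; rewrite /= /dchain_d ltnNge (ltnW pr) /= gtn_eqF.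
case: (boolP (b \in S)) => bS.
  have [w' [y2 [h1 h2 h3]]] := split_mem hy aS bS hbS.
  have [u1 [u2 [g1 g2 g3]]] := cmp_grid qp h1 (@cmp_idl (nuI n) p z) h.
  have [e1 e2] : u1 = w /\ u2 = v.
    apply: (left_uniq1 hwv hw g3) => r a pr.
    by rewrite (ncmp_gt a g1 (ltn_trans qp pr)) (dz z) // addr0 h2.
  rewrite e1 in g1; rewrite e2 in g2.
  exact: val_grid qp My Mz h1 (@cmp_idl (nuI n) p z) g1 g2 hc.
have bT : b \in T by move: bST; rewrite mem_cat (negPf bS).
have [w' [z2 [h1 h2 h3]]] := split_mem hz aT bT hbT.
have [u1 [u2 [g1 g2 g3]]] := cmp_grid qp (@cmp_idl (nuI n) p y) h1 h.
have [e1 e2] : u1 = w /\ u2 = v.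
  apply: (left_uniq1 hwv hw g3) => r a pr.
  by rewrite (ncmp_gt a g1 (ltn_trans qp pr)) (dz y) // add0r h2.
rewrite e1 in g1; rewrite e2 in g2.
exact: val_grid qp My Mz (@cmp_idl (nuI n) p y) h1 g1 g2 hc.
Qed.

End Front.

(** Induction on the way c was obtained. Trivial factors have identity values and drop out; an
    outermost composition above level p is excluded, one at level p is handled by [front], and one
    below p by [front_low]. *)
Lemma canonical_val p x w v b T c : mu x <= M ->
  ncmp p w v x -> rep w p [:: b] -> rep v p T -> T != [::] -> above p (b :: T) ->
  (forall d, d \in T -> rank b <= rank d) ->
  (forall r, (p < r)%N -> nosplit r x) -> ev x c -> comp_val p w v c.
Proof.
move=> Mx hwv hw hv T0 aT hb hx hc.
have /andP[pb aT'] := aT.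
have nw : ~ triv p w by apply: rep_nontriv hw _ _; rewrite //= pb.
have nv : ~ triv p v := rep_nontriv hv aT' T0.
suff H u d : ev u d -> u = x -> comp_val p w v d by apply: H hc _.
elim=> [t _|q y z {}u cy cz {}d h hd ey IHy ez IHz] e.
  have ht : nosplit p (catom t).
    by apply: (@nosplit1 _ _ p t) => r a pr; rewrite psum1.
  by subst x; case: (ht _ _ hwv).
subst u; have [ty|ny] := EM (triv q y).
  have -> : d = cz by apply: cmp_identityl hd (ev_triv ey ty).
  by apply: IHz; apply/esym; apply: cmp_identityl h _; apply/trivP.
have [tz|nz] := EM (triv q z).
  have -> : d = cy by apply: cmp_identityr hd (ev_triv ez tz).
  by apply: IHy; apply/esym; apply: cmp_identityr h _; apply/trivP.
have My : mu y < M := lt_le_trans (mu_lt_l h nz) Mx.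
have Mz : mu z < M := lt_le_trans (mu_lt_r h ny) Mx.
have hval : comp_val q y z d by exists cy, cz.
have [pq|qp] := ltnP p q; first by case: (hx q pq _ _ h).
have nos r : (p < r)%N -> nosplit r y /\ nosplit r z.
  by move=> pr; apply: nosplit_cmp h (hx r pr); apply: leq_ltn_trans pr.
have [S [hS aS]] := @rep_of_nosplit _ y p (fun r pr => (nos r pr).1).
have [S' [hS' aS']] := @rep_of_nosplit _ z p (fun r pr => (nos r pr).2).
have pST : perm_eq (S ++ S') (b :: T).
  apply: (@rep_uniq _ x p) => //; first by rewrite /above all_cat; apply/andP.
    exact: rep_cmp qp h hS hS'.
  exact: (rep_cmp (leqnn p) hwv hw hv).
have bST : b \in S ++ S' by rewrite (perm_mem pST) mem_head.
have hbS u : u \in S ++ S' -> rank b <= rank u.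
  by rewrite (perm_mem pST) inE => /predU1P[->//|/hb].
move: qp; rewrite leq_eqVlt => /predU1P[e|qp].
  subst q; have S0 : S != [::].
    by apply/eqP => S0; apply: ny; rewrite S0 in hS; apply: rep_triv.
  exact (front Mx hwv hw pb h My Mz hS hS' aS aS' S0 bST hbS hval).
exact (front_low hwv hw qp h My Mz hS hS' aS aS' bST hbS hval).
Qed.

End Step.

(** Every decomposition of an atom has a trivial factor, whose value is an identity. *)
Lemma ev_catom t c : ev (catom t) c -> c = phi t.
Proof.
suff H u d : ev u d -> u = catom t -> d = phi t by move=> hc; apply: H hc _.
elim=> [s _ /catom_inj -> //|q y z {}u cy cz {}d h hd ey IHy ez IHz] e.
subst u; have ht : nosplit q (catom t).
  by apply: (@nosplit1 _ _ q t) => r a pr; rewrite psum1.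
case: (ht _ _ h) => tr.
  have -> : d = cz by apply: cmp_identityl hd (ev_triv ey tr).
  by apply: IHz; apply/esym; apply: cmp_identityl h _; apply/trivP.
have -> : d = cy by apply: cmp_identityr hd (ev_triv ez tr).
by apply: IHy; apply/esym; apply: cmp_identityr h _; apply/trivP.
Qed.

Lemma ev_good x : functional x /\ total_at x.
Proof.
elim/mu_ind: x => x IH.
have [[t ->]|[p [S [sS hS aS hx]]]] := decomposition x.
  split=> [c c' hc hc'|/catom_psupp Pt]; last by exists (phi t); apply: ev_atom.
  by rewrite (ev_catom hc) (ev_catom hc').
have [b [T [w [v [pT T0 hb [h1 h2 h3]]]]]] := split_min sS hS aS.
have aT : above p (b :: T) by have := aS; rewrite /above (perm_all _ pT).
have /andP[pb aT'] := aT.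
have nw : ~ triv p w by apply: rep_nontriv h2 _ _; rewrite //= pb.
have nv : ~ triv p v := rep_nontriv h3 aT' T0.
have Mw := mu_lt_l h1 nv; have Mv := mu_lt_r h1 nw.
split=> [c c' hc hc'|sx].
  have V d := @canonical_val (mu x) IH p x w v b T d (lexx _) h1 h2 h3 T0 aT hb hx.
  exact: (val_uniq IH Mw Mv (V _ hc) (V _ hc')).
have [sw sv] := psupp_cmp h1 sx.
have [cw ew] := (IH w Mw).2 sw; have [cv ev'] := (IH v Mv).2 sv.
by have [c _ ec] := ev_comp_ex IH h1 Mw ew ev'; exists c.
Qed.

Lemma ev_fun x c c' : ev x c -> ev x c' -> c = c'.
Proof. by have [h _] := ev_good x; apply: h. Qed.

Lemma ev_ex x : psupp x -> exists c, ev x c.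
Proof. by have [_ h] := ev_good x. Qed.

End Evaluation.

(** * Morphisms defined on atoms *)

Section Homs.
Variables (n : nat) (C : omega_cat).
Implicit Types (x y z : nu n) (t e : cell n) (P : cell n -> Prop) (phi : cell n -> C).
Implicit Types (f g : omega_hom (nuI n) C) (c : C).

Lemma nu_atom_ind (Q : nu n -> Prop) : (forall t, Q (catom t)) ->
  (forall p y z x, ncmp p y z x -> Q y -> Q z -> Q x) -> forall x, Q x.
Proof.
move=> hatom hcmp; elim/mu_ind => x IH.
have [[t ->]//|[p [S [sS hS aS hx]]]] := decomposition x.
have [b [T [w [v [pT T0 hb [h1 h2 h3]]]]]] := split_min sS hS aS.
have /andP[pb aT] : (p < deg b)%N && above p T.
  by have := aS; rewrite /above (perm_all _ pT).
have nw : ~ triv p w by apply: rep_nontriv h2 _ _; rewrite //= pb.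
have nv : ~ triv p v := rep_nontriv h3 aT T0.
by apply: (hcmp _ _ _ _ h1); apply: IH; [apply: mu_lt_l h1 nv|apply: mu_lt_r h1 nw].
Qed.

Lemma ev_hom P phi f x c : (forall t, P t -> f (catom t) = phi t) ->
  ev P phi x c -> f x = c.
Proof.
move=> h; elim=> [t /h //|p y z u cy cz d h1 h2 _ ey _ ez].
by apply: cmp_uniq (cmp_hom f h1) _; rewrite ey ez.
Qed.

Lemma ev_homT f x : ev (fun=> True) (f \o @catom n) x (f x).
Proof.
elim/nu_atom_ind: x => [t|p y z x h ey ez]; first exact: (ev_atom (f \o @catom n)).
exact: ev_cmp h (cmp_hom f h) ey ez.
Qed.

Lemma hom_identity f p x : triv p x -> is_identity p (f x).
Proof.
by move/trivP => [h1 h2]; split; rewrite -ohom_d ?h1 ?h2.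
Qed.

Lemma catom_deg_triv t : triv (deg t) (catom t).
Proof. by move=> q a tq; apply: cell_chain_gt. Qed.

Lemma diagram_hom f : diagram (fun=> True) (f \o @catom n).
Proof.
split=> // [t _|t q a _ _] /=; first exact/hom_identity/catom_deg_triv.
by rewrite -ohom_d; apply: ev_homT.
Qed.

Lemma hom_ext f g : (forall t, f (catom t) = g (catom t)) -> f = g.
Proof.
move=> h; apply: omega_hom_ext => x.
by apply: (@ev_hom (fun=> True) (g \o @catom n)); [move=> t _; apply: h|apply: ev_homT].
Qed.

(** The graph [ev] is closed under sides and composition, so its being functional makes the chosen
    function a morphism. *)
Lemma hom_ex phi : diagram (fun=> True) phi -> exists f, forall t, f (catom t) = phi t.
Proof.
move=> D; have ex x : exists c, ev (fun=> True) phi x c by apply: (ev_ex D).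
pose F x := projT1 (cid (ex x)).
have FP x : ev (fun=> True) phi x (F x) by rewrite /F; case: cid.
have Fd p a x : F (nu_d p a x) = od p a (F x).
  by apply: (ev_fun D (FP _)); apply: (ev_d D).
have Fc p x y (h : nu_d p true x = nu_d p false y)
    (h' : od p true (F x) = od p false (F y)) : F (nu_comp h) = ocomp h'.
  apply: (ev_fun D (FP _)); apply: ev_cmp (FP x) (FP y); last by exists h'.
  by exists h.
exists (@OmegaHom (nuI n) C F Fd Fc) => t /=.
exact: (ev_fun D (FP _) (ev_atom _ _)).
Qed.

Lemma ev_mono P P' phi phi' x c : (forall t, P t -> P' t /\ phi' t = phi t) ->
  ev P phi x c -> ev P' phi' x c.
Proof.
move=> h; elim=> [t /h[Pt <-]|p y z u cy cz d h1 h2 _ ey _ ez]; first exact: ev_atom.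
exact: ev_cmp h1 h2 ey ez.
Qed.

Lemma diagram_extend P phi t0 c : diagram P phi -> ~ P t0 ->
  (forall i a, t0 i = None -> P (close_cell t0 i a)) -> is_identity (deg t0) c ->
  (forall q a, (q < deg t0)%N -> ev P phi (nu_d q a (catom t0)) (od q a c)) ->
  diagram (fun t => P t \/ t = t0) (fun t => if t == t0 then c else phi t).
Proof.
move=> D nP hcl hdim hbd.
have ne t : P t -> (t == t0) = false by move=> Pt; apply/eqP => e; rewrite e in Pt.
have mono x d : ev P phi x d -> ev (fun t => P t \/ t = t0) (fun t => if t == t0 then c else phi t) x d.
  by apply: ev_mono => t Pt; rewrite ne //; split=> //; left.
split=> [t i a [Pt|->] ti|t [Pt|->]|t q a [Pt|->] qt].
- by left; apply: diagram_close D _ _ _ Pt ti.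
- by left; apply: hcl.
- by rewrite ne //; apply: diagram_dim D _ Pt.
- by rewrite eqxx.
- by rewrite ne //; apply: mono; apply: diagram_bd D _ _ _ Pt qt.
by rewrite eqxx; apply: mono; apply: hbd.
Qed.

End Homs.

(** * Values on the cells covered by a shell or box *)

Section PartialShell.
Variables (n : nat) (C : omega_cat) (Q : 'I_n -> bool -> bool).
Variable s : 'I_n -> bool -> omega_hom (nuI n.-1) C.
Hypothesis compat : forall (i j : 'I_n.-1) a b, (j <= i)%N ->
  Q (ord_same j) b -> Q (ord_next i) a ->
  nerve_face i a (s (ord_same j) b) = nerve_face j b (s (ord_next i) a).
Implicit Types (t e : cell n).

Definition covered t := exists i a, t i = Some a /\ Q i a.

(** A cell closed in two directions comes from a face of each of the two members, and the shell
    relation identifies these faces. *)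
Lemma partial_shell_wd t i j a b : t i = Some a -> Q i a -> t j = Some b -> Q j b ->
  s i a (catom (delete i t)) = s j b (catom (delete j t)).
Proof.
wlog ji : i j a b / (j < i)%N => [W|].
  case: (ltngtP i j) => [ij|ji|/val_inj ij]; last first.
  - by subst j => -> _ [->].
  - exact: W.
  by move=> *; apply/esym; apply: W.
move=> ti Qi tj Qj.
have lti : (i.-1 < n.-1)%N by rewrite -ltnS !prednK //; case: (i) ji (ltn_ord i) => /=; lia.
have ltj : (j < n.-1)%N by have := ltn_ord i; lia.
pose i' := Ordinal lti; pose j' := Ordinal ltj.
have ei : ord_next i' = i by apply: val_inj => /=; lia.
have ej : ord_same j' = j by apply: val_inj.
have ij' : (j' <= i')%N by rewrite /=; lia.
have li : lift j i' = i by apply: val_inj; rewrite /= /bump; lia.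
have lj : lift i j' = j by apply: val_inj; rewrite /= /bump; lia.
have di : delete j t i' = Some a by rewrite ffunE li.
have dj : delete i t j' = Some b by rewrite ffunE lj.
have dd : delete i' (delete j t) = delete j' (delete i t).
  apply/ffunP => m; rewrite !ffunE; congr (t _); apply: val_inj => /=.
  by rewrite /bump; lia.
rewrite -(nu_coface_catom dj) -(nu_coface_catom di) dd.
have := @compat i' j' a b ij'; rewrite ei ej => /(_ Qj Qi).
by move/(congr1 (fun f : omega_hom (nuI _) C => f (catom (delete j' (delete i t))))).
Qed.

Lemma partial_shell_diagram (c0 : C) : exists phi : cell n -> C,
  diagram covered phi /\
  forall t i a, t i = Some a -> Q i a -> phi t = s i a (catom (delete i t)).
Proof.
(* Any covering face may be picked; [c0] is a default value for cells that no face covers. *)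
pose phi t := if [pick i | if t i is Some a then Q i a else false] is Some i
  then s i (odflt true (t i)) (catom (delete i t)) else c0.
have phiE t i a : t i = Some a -> Q i a -> phi t = s i a (catom (delete i t)).
  move=> ti Qi; rewrite /phi; case: pickP => [j|/(_ i)]; last by rewrite ti Qi.
  by case tj: (t j) => [b|//] Qj /=; apply: partial_shell_wd.
exists phi; split=> //.
have faceE i a (x : nu n.-1) : Q i a -> ev covered phi (nu_coface_fun i a x) (s i a x).
  move=> Qi; elim/nu_atom_ind: x => [t|p y z x h ey ez]; last first.
    exact: ev_cmp (cmp_hom (nu_coface i a) h) (cmp_hom (s i a) h) ey ez.
  pose e : cell n := [ffun j => if unlift i j is Some j' then t j' else Some a].
  have ei : e i = Some a by rewrite ffunE unlift_none.
  have et : delete i e = t by apply/ffunP => j; rewrite !ffunE liftK.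
  rewrite -et (nu_coface_catom ei) -(phiE _ _ _ ei Qi); apply: ev_atom.
  by exists i, a.
split=> [t i b [j [a [tj Qj]]] ti|t [i [a [ti Qi]]]|t q b [i [a [ti Qi]]] _].
- exists j, a; rewrite ffunE; split=> //; case: eqP => // ji.
  by rewrite -ji tj in ti.
- rewrite (phiE _ _ _ ti Qi) -(deg_delete ti); apply: hom_identity.
  exact: catom_deg_triv.
rewrite (phiE _ _ _ ti Qi) -ohom_d -(nu_coface_catom ti).
by rewrite -nu_coface_d; apply: faceE.
Qed.

End PartialShell.

(** * Complementary cells *)

Section Complementary.
Variables (n : nat) (k : 'I_n) (g : bool).
Implicit Types (t e : cell n) (q : nat) (a b s : bool).

Definition face_cell : cell n := close_cell (top_cell n) k g.

(* The cells of the operations complementary to (k, g): filling in the sign *)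
(* ~~ g at k gives a cell whose adjusted signs are all equal to [s].        *)
Definition compl s t := [&& t k == None, s == ~~ g (+) odd (deg_before t k)
  & sign_test t (fun j => if (j < k)%N then s else ~~ s)].

Definition compl_chain s q : chain n := [ffun t => ((deg t == q) && compl s t)%:R].

Lemma face_cellE i : face_cell i = if i == k then Some g else None.
Proof. by rewrite !ffunE. Qed.

Lemma boundary_sgn (c : chain n) e :
  boundary c e = \sum_i sgn e i * c (open_cell e i).
Proof.
rewrite boundaryE; apply: eq_bigr => i _; rewrite /sgn.
case: (e i) => [b|]; last by rewrite mul0r.
congr (_ * _); rewrite -signr_odd /sgn_int.
by case: (odd _) b => [] [].
Qed.

Lemma sign_test_open e i b f : e i = Some b ->
  sign_test (open_cell e i) f = [forall j, if e j is Some c then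
    (j != i) ==> (c (+) odd (deg_before e j) == f j (+) (i < j)%N) else true].
Proof.
move=> ei; apply: eq_forallb => j; rewrite ffunE.
have [->|ji] := eqVneq j i; first by rewrite ei.
case: (e j) => // c; rewrite (deg_before_open_lt ei ji) oddD /=.
by case: (odd _) (f j) c (i < j)%N => [] [] [] [].
Qed.

Lemma sign_test_split e i b f : e i = Some b ->
  sign_test e f = (b (+) odd (deg_before e i) == f i) &&
    [forall j, if e j is Some c then
      (j != i) ==> (c (+) odd (deg_before e j) == f j) else true].
Proof.
move=> ei; apply/forallP/andP => [h|[h1 /forallP h2] j].
  split; first by have := h i; rewrite ei.
  by apply/forallP => j; have := h j; case: (e j) => // c ->; rewrite implybT.
have := h2 j; case ej: (e j) => [c|//]; have [ji|//] := eqVneq j i.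
by move: ej; rewrite ji ei => -[<-].
Qed.

(** With coordinate k free, the contributions of the other coordinates telescope: opening coordinate
    i flips the adjusted signs after i, so each term is a difference of consecutive sign tests. *)
Lemma boundary_compl_open e q : e k = None ->
  boundary (compl_chain false q.+1) e =
    compl_chain false q e + compl_chain true q e - cell_chain (top_cell n) false q e.
Proof.
move=> ek.
pose par := false == ~~ g (+) odd (deg_before e k).
pose St m := sign_test e (fun j => (k <= j)%N (+) (m <= j)%N).
pose dq : int := (deg e == q)%:R.
(* The values at n and at 0 give the terms with s = - and s = +. The shift past k makes the function
   continuous there and supplies the term of the top cell. *)
pose F m : int := if (m <= k)%N then - (dq * (~~ par && St m)%:R)
  else dq * (par && St m)%:R - dq * (St k)%:R.
have St_ext (f : nat -> bool) m : (forall j : 'I_n, j != k -> f j = (k <= j)%N (+) (m <= j)%N) ->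
    sign_test e f = St m.
  move=> h; apply: eq_forallb => j; case ej: (e j) => [b|//].
  by rewrite h //; apply/eqP => jk; rewrite jk ek in ej.
rewrite boundary_sgn (eq_bigr (fun i : 'I_n => F i.+1 - F i)) => [|i _].
  rewrite -(big_mkord predT (fun i => F i.+1 - F i)) telescope_sumr // /F.
  rewrite leqNgt ltn_ord /= !ffunE /compl ek /= -/par matches_top.
  rewrite (@St_ext _ n) => [|j _]; last by rewrite [(n <= j)%N]leqNgt ltn_ord addbF; case: (ltnP j k).
  rewrite (@St_ext _ 0%N) => [|j _]; last by case: (ltnP j k).
  rewrite (@St_ext (fun=> false) k) => [|j _]; last by rewrite addbb.
  have -> : (true == ~~ g (+) odd (deg_before e k)) = ~~ par.
    by rewrite /par; case: (_ (+) _).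
  rewrite /dq; case: (deg e == q) (par) (St n) (St 0%N) (St k) => [] [] [] [] [] //=; lia.
have [->|ik] := eqVneq i k.
  rewrite /sgn ek mul0r /F leqnn ltnn.
  have -> : St k.+1 = St k.
    by apply: St_ext => j jk; rewrite ltn_neqAle eq_sym jk.
  by rewrite /dq; case: (_ == q) (par) (St k) => [] [] [].
case ei: (e i) => [b|]; last first.
  rewrite /sgn ei mul0r /F.
  have -> : St i.+1 = St i.
    apply: eq_forallb => j; case ej: (e j) => [b|//]; rewrite [(i <= j)%N]leq_eqVlt.
    by case: (nat_of_ord i =P j) => // /val_inj ij; rewrite -ij ei in ej.
  rewrite [(i < k)%N]ltn_neqAle ik /=.
  by case: ifP; rewrite subrr.
pose H := [forall j, if e j is Some c then
    (j != i) ==> (c (+) odd (deg_before e j) == (k <= j)%N (+) (i < j)%N) else true].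
have Si : St i = (b (+) odd (deg_before e i) != (k <= i)%N) && H.
  rewrite /St (sign_test_split _ ei) leqnn; congr (_ && _).
    by case: (_ (+) _) (k <= i)%N => [] [].
  apply: eq_forallb => j; case: (e j) => // c; have [//|ji] := eqVneq j i.
  by rewrite [(i < j)%N]ltn_neqAle eq_sym -val_eqE /= in ji *; rewrite ji.
have Si1 : St i.+1 = (b (+) odd (deg_before e i) == (k <= i)%N) && H.
  by rewrite /St (sign_test_split _ ei) ltnn addbF.
have -> : compl_chain false q.+1 (open_cell e i) =
    dq * ((par == (k < i)%N) && H)%:R.
  rewrite !ffunE (deg_open ei) eqSS /compl ffunE (eq_sym k) (negPf ik) ek /=.
  have ki : k != i by rewrite eq_sym.
  rewrite (deg_before_open_lt ei ki) oddD (sign_test_open _ ei).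
  rewrite -natrM mulnb; congr (nat_of_bool (_ && (_ && _)))%:R.
    rewrite -val_eqE /= in ik; rewrite /par.
    by case: (ltngtP i k) ik => // _ _; case: (g) (odd _) => [] [].
  apply: eq_forallb => j; case: (e j) => // c; congr (_ ==> (_ == _ (+) _)).
  by case: ltnP.
rewrite /F /sgn ei Si Si1; rewrite -val_eqE /= in ik.
case: (ltngtP i k) ik => // ik _; rewrite /dq ?opprB ?addrA ?subrK;
by case: (_ == q) (par) (H) (b (+) _) => [] [] [] [].
Qed.

Lemma boundary_compl_closed e q b : e k = Some b ->
  boundary (compl_chain false q.+1) e =
    cell_chain face_cell false q e - cell_chain (top_cell n) false q e.
Proof.
move=> ek; rewrite boundary_sgn (bigD1 k) //= big1 ?addr0 => [|i ik]; last first.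
  by rewrite !ffunE /compl ffunE (eq_sym k) (negPf ik) ek andbF mulr0.
rewrite !ffunE (deg_open ek) eqSS /compl ffunE eqxx deg_before_open.
rewrite (sign_test_open _ ek) matches_top (sign_test_split _ ek) /=.
set H := [forall j, if e j is Some c then (j != k) ==> (c (+) odd (deg_before e j) == false) else true].
have -> : [forall j, if e j is Some c then (j != k) ==>
    (c (+) odd (deg_before e j) == (if (j < k)%N then false else true) (+) (k < j)%N)
    else true] = H.
  apply: eq_forallb => j; case: (e j) => // c; rewrite -val_eqE /=.
  by case: ltngtP.
have -> : matches face_cell false e = (b == g) && H.
  apply/forallP/andP => [h|[/eqP bg /forallP h] i].
    split; first by have := h k; rewrite face_cellE eqxx ek => /eqP[->].
    apply/forallP => i; have := h i; rewrite face_cellE.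
    by case: (eqVneq i k) => [->|_]; [case: (e k)|case: (e i) => // c ->].
  have := h i; rewrite face_cellE; case: (eqVneq i k) => [->|//].
  by rewrite ek bg.
rewrite /sgn ek.
by case: (_ == q) H (odd _) (g) b {ek} => [] [] [] [] [] /=.
Qed.

(** Pushing the source of u_n across the complementary cells with s = - exposes the source of the
    face, surrounded by complementary cells one dimension lower. This drives the induction in
    [reduced_ev]. *)
Lemma boundary_compl q :
  cell_chain (top_cell n) false q + boundary (compl_chain false q.+1) =
  cell_chain face_cell false q + compl_chain false q + compl_chain true q.
Proof.
apply/ffunP => e; rewrite !chainE; case ek: (e k) => [b|].
  rewrite (boundary_compl_closed _ ek) addrC subrK.
  by rewrite !(ffunE _ e) /compl ek !andbF /= !addr0.
rewrite boundary_compl_open // addrC subrK.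
suff -> : cell_chain face_cell false q e = 0 by rewrite add0r.
apply/eqP; apply: contraT => /cell_chain_neq0[_ m].
have := @matches_closed _ _ _ _ k g m; rewrite face_cellE eqxx => /(_ erefl).
by rewrite ek.
Qed.

(** The first closed coordinate of t before k, where the face is free, decides the order. If there
    is none, coordinate k decides it, by the parity condition in [compl]. *)
Lemma compl_rank s t : compl s t ->
  if s then rank face_cell < rank t else rank t < rank face_cell.
Proof.
case/and3P => /eqP tk /eqP hs /forallP ht.
have [i [si lti]] : exists i, (sgn t i < sgn face_cell i) = ~~ s /\
    (sgn face_cell i < sgn t i) = s /\
    forall j : 'I_n, (j < i)%N -> sgn t j = sgn face_cell j.
  have fN (j : 'I_n) : j != k -> sgn face_cell j = 0.
    by move=> jk; rewrite /sgn face_cellE (negPf jk).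
  case: (boolP [exists i : 'I_n, (i < k)%N && (t i != None)]) => [/existsP[i0 h0]|/existsPn h].
    case: (@arg_minnP _ i0 (fun i : 'I_n => (i < k)%N && (t i != None)) (@nat_of_ord n) h0).
    move=> i /andP[ik ti] imin; exists i.
    have ne : i != k by rewrite -val_eqE /= ltn_eqF.
    have sv : sgn t i = if s then 1 else -1.
      by have := ht i; rewrite ik /sgn; case: (t i) ti => // b _ /eqP ->.
    rewrite sv fN //; split; first by case: (s).
    split=> [|j ji]; first by case: (s).
    have jk : (j < k)%N := ltn_trans ji ik.
    rewrite fN; last by rewrite -val_eqE /= ltn_eqF.
    rewrite /sgn; case tj: (t j) => [c|//]; have /imin : (j < k)%N && (t j != None) by rewrite jk tj.
    by rewrite leqNgt ji.
  have tN (j : 'I_n) : (j < k)%N -> t j = None.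
    by move=> jk; have := h j; rewrite jk negbK => /eqP.
  have fk (j : 'I_n) : (j < k)%N -> face_cell j = None.
    by move=> jk; rewrite face_cellE -val_eqE /= ltn_eqF.
  exists k; rewrite /sgn tk face_cellE eqxx.
  rewrite (@deg_before_eq _ face_cell t) => [|j jk]; last by rewrite tN // fk.
  rewrite hs; split; first by case: (g) (odd _) => [] [].
  split=> [|j jk]; first by case: (g) (odd _) => [] [].
  by rewrite tN // fk.
move: lti => [si' lti]; case: s si si' {hs ht} => si si'.
  by apply: (rank_lt (i := i)) => // j ji; rewrite lti.
by apply: (rank_lt (i := i)).
Qed.

End Complementary.

(** * Composites with identity values *)

Section Thin.
Variables (n : nat) (C : omega_cat) (P : cell n -> Prop) (phi : cell n -> C).
Hypothesis D : diagram P phi.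
Implicit Types (x y z w : nu n) (t e : cell n) (c : C).

(** In a decomposition of x the terms of degree p + 1 of both factors are terms of x, because in
    that degree sources and targets coincide. *)
Lemma ev_thin p x c : ev P phi x c -> triv p.+1 x ->
  (forall t a, x p.+1 a t != 0 -> is_identity p (phi t)) -> is_identity p c.
Proof.
elim=> [t Pt tx h|q y z u cy cz d h h' _ hy _ hz tu hu].
  have := catom_triv tx; rewrite leq_eqVlt ltnS => /predU1P[e|tp].
    by apply: (h t true); rewrite /= -e cell_chain_deg ffunE eqxx.
  exact: is_identity_le tp (diagram_dim D Pt).
have [ty tz] := triv_cmp h tu; have [h1 h2 h3 h4 h5] := (ncmpP q y z u).1 h.
have yE : y p.+1 true = y p.+1 false.
  by rewrite (nu_tgt y p.+1 true) (ty p.+2) // boundary0 addr0.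
have supp t a : (y p.+1 a t != 0 -> is_identity p (phi t)) /\
    (z p.+1 a t != 0 -> is_identity p (phi t)).
  case: (ltngtP p.+1 q) => [pq|qp|e].
  - by have [-> ->] := h1 p.+1 a pq; split; apply: hu.
  - have /ffunP/(_ t) := h5 _ a qp; rewrite chainD => e.
    by split=> ht; apply: (hu t a); apply: contra_neq ht; rewrite e;
      move: (nu_ge0 y p.+1 a t) (nu_ge0 z p.+1 a t); chain_lia.
  subst q; split.
    have -> : y p.+1 a = u p.+1 false by case: a; rewrite ?yE.
    exact: hu.
  case: a; first by rewrite h3; apply: hu.
  by rewrite -h4 yE h2; apply: hu.
by apply: is_identity_cmp h' (hy ty _) (hz tz _) => t a; have [] := supp t a.
Qed.

(** Stated for sides, since x and z may contain a missing face that has no value yet, while their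
    sides do have values. *)
Lemma ev_d_cmp_l p q b y z x cy c : ncmp p y z x -> ev P phi y cy ->
  is_identity p cy -> ev P phi (nu_d q b z) c -> ev P phi (nu_d q b x) c.
Proof.
move=> h ey iy ez; case: (ltngtP q p) => [qp|pq|e].
- have := (cmp_d_lt b qp h).2; rewrite /= => ->; exact: ez.
- have pq' : p <> q by move=> e; rewrite e ltnn in pq.
  have /is_identityP cyE := is_identity_le (ltnW pq) iy.
  have h' := cmp_d b pq' h.
  have ey' := ev_d D q b ey; rewrite cyE in ey'.
  apply: (ev_cmp h' _ ey' ez).
  suff -> : cy = od p false c by apply: cmp_idl.
  have [_ <-] := iy; apply: (ev_fun D (ev_d D p true ey')).
  have := cmp_comp h'; rewrite /= => ->; exact: ev_d.
subst q; have [i1 i2] := iy.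
case: b ez => ez; first by have := cmp_tgt h; rewrite /= => ->.
have := cmp_src h; rewrite /= => ->.
have <- : cy = c; last by rewrite -i1; apply: ev_d.
apply: (ev_fun D _ ez); have := cmp_comp h; rewrite /= => <-.
by rewrite -i2; apply: ev_d.
Qed.

Lemma ev_d_cmp_r p q b y z x cz c : ncmp p y z x -> ev P phi z cz ->
  is_identity p cz -> ev P phi (nu_d q b y) c -> ev P phi (nu_d q b x) c.
Proof.
move=> h ez iz ey; case: (ltngtP q p) => [qp|pq|e].
- have := (cmp_d_lt b qp h).1; rewrite /= => ->; exact: ey.
- have pq' : p <> q by move=> e; rewrite e ltnn in pq.
  have /is_identityP czE := is_identity_le (ltnW pq) iz.
  have h' := cmp_d b pq' h.
  have ez' := ev_d D q b ez; rewrite czE in ez'.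
  apply: (ev_cmp h' _ ey ez').
  suff -> : cz = od p true c by apply: cmp_idr.
  have [<- _] := iz; apply: (ev_fun D (ev_d D p false ez')).
  have := cmp_comp h'; rewrite /= => <-; exact: ev_d.
subst q; have [i1 i2] := iz.
case: b ey => ey; last by have := cmp_src h; rewrite /= => ->.
have := cmp_tgt h; rewrite /= => ->.
have <- : cz = c; last by rewrite -i2; apply: ev_d.
apply: (ev_fun D _ ey); have := cmp_comp h; rewrite /= => ->.
by rewrite -i1; apply: ev_d.
Qed.

End Thin.

Lemma deg_top n : deg (top_cell n) = n.
Proof.
rewrite sum_deg (eq_bigr (fun=> 1%N)) ?sum1_card ?card_ord // => i _.
by rewrite ffunE.
Qed.

Lemma deg_before_top n m : (m <= n)%N -> deg_before (top_cell n) m = m.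
Proof.
move=> mn; rewrite sum_deg_before (eq_bigr (fun j : 'I_n => nat_of_bool (j < m)%N)).
  by rewrite -big_mkcond -(big_ord_widen n (fun=> 1%N)) // sum1_card card_ord.
by move=> j _; rewrite ffunE andbT.
Qed.

Lemma deg_eq_top n (t : cell n) : deg t = n -> t = top_cell n.
Proof.
move=> d; apply: (@matches_eq _ (top_cell n) true); last by rewrite deg_top.
rewrite matches_top; apply/forallP => i.
move: d => /eqP; rewrite -[X in _ == X]card_ord -cardsT => /eqP d.
have /setP/(_ i) : [set j | t j == None] = setT.
  by apply/eqP; rewrite eqEcard subsetT -d leqnn.
by rewrite !inE; case: (t i).
Qed.

Lemma deg_face n (k : 'I_n) g : (deg (face_cell k g)).+1 = n.
Proof.
have fk : face_cell k g k = Some g by rewrite face_cellE eqxx.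
rewrite -(deg_open fk) -[RHS]deg_top; congr deg; apply/ffunP => j.
by rewrite !ffunE; case: eqP.
Qed.

Lemma deg_face_pred n (k : 'I_n) g : deg (face_cell k g) = n.-1.
Proof. by rewrite -[RHS](congr1 predn (deg_face k g)). Qed.

(** * Stripping complementary cells from a side of the cube *)

Section Reduction.
Variables (n : nat) (k : 'I_n) (g : bool) (C : omega_cat).
Variables (P : cell n -> Prop) (phi : cell n -> C).
Hypothesis D : diagram P phi.
Hypothesis low : forall t : cell n, (deg t < n.-1)%N -> P t.
Hypothesis compl_thin : forall s (t : cell n), compl k g s t -> t != top_cell n ->
  P t /\ is_identity (deg t).-1 (phi t).
Implicit Types (x y z w : nu n) (t e : cell n) (c : C).

Local Notation fk := (face_cell k g).

Definition compls s p := [seq t <- enum {: cell n} | (deg t == p) && compl k g s t].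

Lemma mem_compls s p t : (t \in compls s p) = (deg t == p) && compl k g s t.
Proof. by rewrite mem_filter mem_enum andbT. Qed.

Lemma psum_compls s p a : psum (compls s p) p a = compl_chain k g s p.
Proof.
apply/ffunP => e; rewrite psumE big_filter big_enum_cond /= [RHS]ffunE.
case: (boolP (_ && _)) => he; last first.
  rewrite big1 // => t /andP[/eqP dt ct]; rewrite -dt cell_chain_deg ffunE.
  by case: eqP => // et; rewrite et dt eqxx ct in he.
rewrite (bigD1 e) //= big1 ?addr0 => [|t /andP[/andP[/eqP dt _] te]].
  by move/andP: he => [/eqP <- _]; rewrite cell_chain_deg ffunE eqxx.
by rewrite -dt cell_chain_deg ffunE eq_sym (negPf te).
Qed.

Lemma psum_compls_gt s p q a : (p < q)%N -> psum (compls s p) q a = 0.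
Proof.
move=> pq; rewrite /psum big_seq big1 // => t; rewrite mem_compls => /andP[/eqP dt _].
by apply: cell_chain_gt; rewrite dt.
Qed.

Lemma compls_thin s p y : (p.+1 < n)%N -> rep y p (compls s p.+1) ->
  exists2 c, ev P phi y c & is_identity p c.
Proof.
move=> pn hy.
have top t a : y p.+1 a t != 0 -> deg t = p.+1 /\ compl k g s t.
  rewrite hy // psum_compls ffunE.
  by case: (deg t =P p.+1) => [->|]; case: compl.
have thin t a : y p.+1 a t != 0 -> P t /\ is_identity p (phi t).
  case/top => dt /compl_thin; rewrite dt; apply.
  by apply: contra_eq_neq dt => ->; rewrite deg_top gtn_eqF.
have ty : triv p.+1 y.
  by move=> q a pq; rewrite hy ?(ltnW pq) // psum_compls_gt.
have [|c ec] := ev_ex D (x := y).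
  move=> q a t; case: (ltngtP q p.+1) => [qp|pq|->]; last by case/thin.
    by move=> /nu_homog dt; apply: low; rewrite dt; lia.
  by rewrite ty // ffunE eqxx.
exists c => //; apply: (ev_thin D ec ty) => t a /thin[].
by [].
Qed.

(* At level [p] all pieces of [w] other than [face_cell k g] are complementary. *)
Definition reduced p w := [/\ forall q a, (q < p)%N -> w q a = cell_chain (top_cell n) a q,
  forall a, w p a = cell_chain fk a p + compl_chain k g false p + compl_chain k g true p &
  forall q a, (p < q)%N -> w q a = cell_chain fk a q].

(** The order puts the complementary pieces with s = - before the face and those with s = + after
    it. Both groups evaluate to identities and are cut off; the remaining middle factor is reduced
    one level lower. At level 0 only the face is left, since a complementary cell is free at k. *)
Lemma reduced_ev p w q b c : (p < n)%N -> reduced p w ->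
  ev P phi (nu_d q b (catom fk)) c -> ev P phi (nu_d q b w) c.
Proof.
elim: p w => [|p IH] w pn [h1 h2 h3] hc.
  suff -> : w = catom fk by [].
  apply: nu_ext => r a; case: r => [|r]; last by rewrite h3.
  suff c0 s : compl_chain k g s 0 = 0 by rewrite h2 !c0 !addr0.
  apply/ffunP => t; rewrite !ffunE /compl.
  case: eqP => //= /card0_eq/(_ k); rewrite !inE.
  by case: (t k).
have dfk := deg_face_pred k g.
have pfk : (p < deg fk)%N by rewrite dfk; lia.
have rw : rep w p (compls false p.+1 ++ (fk :: compls true p.+1)).
  move=> r a; rewrite leq_eqVlt psum_cat psum_cons => /predU1P[<-|pr].
    by rewrite h2 !psum_compls addrCA addrA.
  by rewrite h3 // !psum_compls_gt // add0r addr0.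
have ac s : above p (compls s p.+1).
  by apply/allP => t; rewrite mem_compls => /andP[/eqP ->].
have a1 : above p (fk :: compls true p.+1) by rewrite /above /= pfk; apply: ac.
have rk t : t \in compls true p.+1 -> rank fk <= rank t.
  by rewrite mem_compls => /andP[_ /compl_rank /ltW].
have [||y1 [w1 [g1 g2 g3]]] := split_rep rw.
- by rewrite /above all_cat; apply/andP; split; [apply: ac|apply: a1].
- move=> t e; rewrite mem_compls => /andP[_ /compl_rank tf].
  rewrite inE => /predU1P[->|/rk ef]; first exact: ltW.
  exact: le_trans (ltW tf) ef.
have [|w2 [y2 [k1 k2 k3]]] := @split_rep _ w1 p [:: fk] (compls true p.+1) g3 a1.
  by move=> t e; rewrite inE => /eqP ->; apply: rk.
have [c1 e1 i1] := compls_thin pn g2; have [c2 e2 i2] := compls_thin pn k3.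
apply: (ev_d_cmp_l D g1 e1 i1); apply: (ev_d_cmp_r D k1 e2 i2).
apply: IH hc; first exact: ltnW.
have [x1 x2 x3 x4 x5] := (ncmpP _ _ _ _).1 g1.
have [z1 z2 z3 z4 z5] := (ncmpP _ _ _ _).1 k1.
have w20 : w2 p false = cell_chain fk false p + compl_chain k g false p + compl_chain k g true p.
  rewrite z2 -x4 (nu_tgt y1 p true) x2 h1 // g2 // psum_compls.
  exact: boundary_compl.
split=> [r a rp|[]|r a pr] //.
- by rewrite (z1 r a rp).1 (x1 r a rp).2 h1 // ltnW.
- by rewrite (rep_bd k2) w20 !psum1 addrC !addrA subrK.
- by rewrite k2 // psum1.
Qed.

Lemma reduced_source : reduced n.-1 (nu_d n.-1 (g (+) odd k) (catom (top_cell n))).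
Proof.
have n0 : (0 < n)%N := leq_ltn_trans (leq0n k) (ltn_ord k).
have dfk := deg_face_pred k g.
have fkE a : cell_chain fk a n.-1 = basis_chain fk by rewrite -dfk cell_chain_deg.
split=> [q a qn|a|q a nq] /=; rewrite /dchain_d.
- by rewrite qn.
- rewrite ltnn eqxx fkE -(fkE false) -boundary_compl prednK //.
  (* The only n-cell, u_n, is complementary with s = - exactly when the face lies in the target of
     u_n. [boundary_compl] then describes the target, and otherwise the source. *)
  have -> : compl_chain k g false n =
      if g (+) odd k then cell_chain (top_cell n) true n else 0.
    apply/ffunP => t; rewrite ffunE; case: eqP => [/deg_eq_top ->|nt]; last first.
      by case: ifP; rewrite !ffunE //; case: eqP.
    have -> : compl k g false (top_cell n) = g (+) odd k.
      have -> : compl k g false (top_cell n) = (false == ~~ g (+) odd k).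
        rewrite /compl ffunE eqxx deg_before_top ?(ltnW (ltn_ord k)) //.
        by rewrite [sign_test _ _](introT forallP _) ?andbT // => i; rewrite ffunE.
      by case: (g) (odd k) => [] [].
    case: ifP => _; last by rewrite ffunE.
    have := cell_chain_deg (top_cell n) true.
    by rewrite deg_top => ->; rewrite ffunE eqxx.
  case: (g (+) odd k); last by rewrite boundary0 addr0.
  have := nu_bd (catom (top_cell n)) n.-1 true; rewrite prednK //= => <-.
  by rewrite addrC subrK.
by rewrite ltnNge (ltnW nq) (gtn_eqF nq) [RHS]cell_chain_gt // dfk.
Qed.

Lemma ev_source q b c : ev P phi (nu_d q b (catom fk)) c ->
  ev P phi (nu_d q b (nu_d n.-1 (g (+) odd k) (catom (top_cell n)))) c.
Proof. by apply: reduced_ev reduced_source; rewrite prednK // (leq_ltn_trans _ (ltn_ord k)). Qed.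

End Reduction.

(** * Precubical operations as cells *)

Section Words.

Fixpoint closed_seq (f : nat -> option bool) (m : nat) : seq (nat * bool) :=
  if m is m'.+1 then
    if f m' is Some b then rcons (closed_seq f m') (m', b) else closed_seq f m'
  else [::].

Implicit Types (f : nat -> option bool).

Lemma eq_closed_seq f f' m : (forall j, (j < m)%N -> f j = f' j) ->
  closed_seq f m = closed_seq f' m.
Proof.
elim: m => //= m IH h; rewrite h // IH // => j jm.
by apply: h; apply: ltnW.
Qed.

Lemma closed_seq_trunc f m q : (m <= q)%N ->
  (forall j, (m <= j < q)%N -> f j = None) -> closed_seq f q = closed_seq f m.
Proof.
elim: q => [|q IH]; first by rewrite leqn0 => /eqP ->.
rewrite leq_eqVlt => /predU1P[->//|]; rewrite ltnS => mq h /=.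
rewrite h ?mq ?ltnSn // IH // => j /andP[mj jq].
by apply: h; rewrite mj ltnW.
Qed.

Lemma closed_seq_fst f m : [seq x.1 | x <- closed_seq f m] = [seq j <- iota 0 m | f j].
Proof.
elim: m => // m IH.
have -> : iota 0 m.+1 = iota 0 m ++ [:: m] by rewrite -addn1 iotaD.
rewrite filter_cat /= -IH.
by case: (f m) => [b|] /=; rewrite ?cats0 // map_rcons cats1.
Qed.

Lemma closed_seq_lt f m x : x \in closed_seq f m -> (x.1 < m)%N.
Proof.
move=> h; have : x.1 \in [seq j <- iota 0 m | f j].
  by rewrite -closed_seq_fst map_f.
by rewrite mem_filter mem_iota => /and3P[].
Qed.

Lemma closed_seq_insert f f' k b m : (k < m)%N -> f k = None -> f' k = Some b ->
  (forall j, j != k -> f' j = f j) ->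
  closed_seq f' m = insert_face k b (closed_seq f m).
Proof.
move=> km fk fk' h; elim: m km => // m IH; rewrite ltnS leq_eqVlt.
move=> /predU1P[e|km] /=.
  subst m; rewrite fk fk' (@eq_closed_seq f' f) => [|j jk]; last by rewrite h // ltn_eqF.
  rewrite /insert_face -cats1; congr (_ ++ _ :: _).
    by apply/esym/all_filterP/allP => x /closed_seq_lt.
  apply/esym/eqP; rewrite -(negbK (_ == _)) -has_filter -all_predC.
  by apply/allP => x /closed_seq_lt /=; rewrite -leqNgt => /ltnW.
rewrite (h m) ?gtn_eqF //; case: (f m) => [c|]; last exact: IH.
rewrite IH // /insert_face !filter_rcons /= km ltnNge (ltnW km) /=.
by rewrite -rcons_cons -rcons_cat.
Qed.

Lemma closed_seq_sign f m s :
  (forall j b, (j < m)%N -> f j = Some b -> odd (j - size (closed_seq f j)) (+) b = s) ->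
  constant_sign (closed_seq f m).
Proof.
move=> h; exists s; elim: m h => // m IH h r /=.
have {}IH := IH (fun j b jm => h j b (ltnW jm)).
case fm: (f m) => [b|]; last exact: IH.
rewrite size_rcons ltnS leq_eqVlt nth_rcons => /predU1P[->|rs].
  by rewrite ltnn eqxx /=; apply: h fm.
by rewrite rs; apply: IH.
Qed.

Variable n : nat.
Implicit Types (t e : cell n).

Definition cell_fun t (j : nat) : option bool := if insub j is Some i then t i else None.

Lemma cell_funE t (i : 'I_n) : cell_fun t i = t i.
Proof. by rewrite /cell_fun valK. Qed.

Lemma cell_fun_lt t j (h : (j < n)%N) : cell_fun t j = t (Ordinal h).
Proof. by rewrite -cell_funE. Qed.

Lemma deg_before_S t (i : 'I_n) : deg_before t i.+1 = (deg_before t i + (t i == None))%N.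
Proof.
rewrite !sum_deg_before (bigD1 i) //= [in RHS](bigD1 i) //= ltnSn ltnn /= add0n addnC.
congr (_ + _)%N; apply: eq_bigr => j ji; rewrite ltnS leq_eqVlt.
by rewrite [val j == val i](negPf ji).
Qed.

Lemma size_closed_seq t m : (m <= n)%N ->
  (size (closed_seq (cell_fun t) m) + deg_before t m)%N = m.
Proof.
elim: m => [_|m IH mn] /=.
  by rewrite /deg_before eq_card0 // => j; rewrite !inE.
have := IH (ltnW mn); rewrite (deg_before_S t (Ordinal mn)) (cell_fun_lt t mn).
by case: (t _) => [b|] /=; rewrite ?size_rcons; lia.
Qed.

End Words.

Lemma last_closed n (t : cell n) : t != top_cell n ->
  exists i a, t i = Some a /\ forall j : 'I_n, (i < j)%N -> t j = None.
Proof.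
move=> /closed_ex[i0 [b0 h0]]; have h0' : t i0 != None by rewrite h0.
case: (@arg_maxnP _ i0 (fun i => t i != None) (@nat_of_ord n) h0') => i ti imax.
case ti': (t i) ti => [a|//] _; exists i, a; split=> // j ij.
apply/eqP; apply: contraLR ij => /imax h; rewrite -leqNgt; exact: h.
Qed.

Lemma closed_seq_last n (t : cell n) i a : t i = Some a ->
  (forall j : 'I_n, (i < j)%N -> t j = None) ->
  closed_seq (cell_fun t) n =
    rcons (closed_seq (cell_fun (delete i t)) n.-1) (nat_of_ord i, a).
Proof.
move=> ti h; have ni := ltn_ord i.
rewrite (@closed_seq_trunc _ i.+1) // => [|j /andP[ij jn]]; last first.
  by rewrite (cell_fun_lt t jn) h.
rewrite /= cell_funE ti; congr rcons; rewrite [RHS](@closed_seq_trunc _ i).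
- apply: eq_closed_seq => j ji; have jn : (j < n)%N := ltn_trans ji ni.
  have jn' : (j < n.-1)%N by lia.
  rewrite (cell_fun_lt t jn) (cell_fun_lt _ jn') ffunE; congr (t _).
  by apply: val_inj; rewrite /= /bump leqNgt ji.
- lia.
move=> j /andP[ij jn]; rewrite (cell_fun_lt _ jn) ffunE h //.
by rewrite /= /bump ij ltnS.
Qed.

Lemma word_ex n (t : cell n) : exists m (w : face_word m n),
  [/\ m = deg t, factors w = closed_seq (cell_fun t) n &
   forall C (x : omega_hom (nuI n) C),
     op_apply (X := nerve_precubical C) w x (atom m) = x (catom t)].
Proof.
elim: n t => [|n IH] t; have [->|] := eqVneq t (top_cell _).
- by exists 0%N, op_id; split; rewrite ?deg_top //= => C x; rewrite catom_top.
- by case/closed_ex; case.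
- exists n.+1, op_id; split=> [||C x]; rewrite ?deg_top ?catom_top //.
  rewrite [RHS](@closed_seq_trunc _ 0) // => j /andP[_ jn].
  by rewrite (cell_fun_lt _ jn) ffunE.
case/last_closed => i [a [ti h]].
have [m [w [h1 h2 h3]]] := IH (delete i t : cell n).
exists m, (op_snoc (w : face_word m n.+1.-1) i a).
split=> [||C x]; first by rewrite h1 (deg_delete ti).
  by rewrite (closed_seq_last ti h) /= h2.
rewrite /= (h3 C (nerve_face i a x)) /=; congr (x _).
exact: nu_coface_catom.
Qed.

(** The r-th closed coordinate i(r) has i(r) - r free coordinates before it, so the sign condition
    on standard decompositions says that the adjusted signs are constant. *)
Lemma compl_complementary n (k : 'I_n) g s (t : cell n) m (w : face_word m n) :
  compl k g s t -> factors w = closed_seq (cell_fun t) n -> complementary w k g.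
Proof.
case/and3P => /eqP tk /eqP hs /forallP ht hw.
have fst_w : [seq x.1 | x <- factors w] = [seq j <- iota 0 n | cell_fun t j].
  by rewrite hw closed_seq_fst.
split.
- rewrite /standard fst_w; apply: sorted_filter; first exact: ltn_trans.
  exact: iota_ltn_sorted.
- by rewrite fst_w mem_filter cell_funE tk.
pose t' := close_cell t k (~~ g).
have t'k : t' k = Some (~~ g) by rewrite ffunE eqxx.
have ot : open_cell t' k = t.
  by apply/ffunP => j; rewrite !ffunE; case: eqP => // ->.
rewrite hw -(@closed_seq_insert (cell_fun t) (cell_fun t')) ?cell_funE //; last first.
  move=> j jk; rewrite /cell_fun; case: insubP => // i _ ij.
  by rewrite ffunE -val_eqE ij (negPf jk).
apply: (@closed_seq_sign _ _ s) => j b jn; rewrite (cell_fun_lt _ jn) => tj.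
have -> : (j - size (closed_seq (cell_fun t') j))%N = deg_before t' j.
  by have := size_closed_seq t' (ltnW jn); lia.
have dk : deg_before t' k = deg_before t k by rewrite -ot deg_before_open.
move: tj; rewrite ffunE -val_eqE /=; case: (ltngtP j k) => [jk|kj|->].
- move=> tj; have := ht (Ordinal jn); rewrite tj /= jk => /eqP <-.
  rewrite addbC; congr (_ (+) odd _); apply: deg_before_eq => i ij.
  by rewrite ffunE -val_eqE /= ltn_eqF // (ltn_trans ij jk).
- move=> tj; have := ht (Ordinal jn); rewrite tj /= ltnNge (ltnW kj) /=.
  have jk : Ordinal jn != k by rewrite -val_eqE /= gtn_eqF.
  have := deg_before_open_lt t'k jk; rewrite ot /= kj => ->; rewrite oddD /=.
  by case: (s) (odd _) b {tj} => [] [] [].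
by case=> <-; rewrite dk addbC.
Qed.

Lemma compl_face n (k l : 'I_n) g d : (k, g) <> (l, d) ->
  g (+) odd k = d (+) odd l ->
  compl k g (~~ g (+) odd (deg_before (face_cell l d) k)) (face_cell l d).
Proof.
move=> kl hs; have lk : k != l.
  apply/eqP => e; apply: kl; rewrite e in hs *; congr (_, _).
  by move: hs; case: g d (odd l) => [] [] [].
have fl : face_cell l d l = Some d by rewrite face_cellE eqxx.
have ot : open_cell (face_cell l d) l = top_cell n.
  by apply/ffunP => j; rewrite !ffunE; case: eqP.
rewrite /compl face_cellE (negPf lk) !eqxx /=; apply/forallP => j.
rewrite face_cellE; case: (eqVneq j l) => [->|//].
have -> : deg_before (face_cell l d) l = l.
  by rewrite -deg_before_open ot deg_before_top // ltnW.
have := deg_before_open_lt fl lk; rewrite ot deg_before_top ?(ltnW (ltn_ord k)) // => e.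
move: hs; rewrite {1}e oddD; move: lk; rewrite -val_eqE /=.
by case: (ltngtP k l) => // _ _ <-; case: (g) (odd _) => [] [].
Qed.

(** Distinct faces on the same side of u_n are complementary. *)
Lemma noncomplementary_sign n (k l : 'I_n) g d : (k, g) <> (l, d) ->
  ~ complementary (face_op l d) k g -> g (+) odd k = ~~ (d (+) odd l).
Proof.
move=> kl nc; have [hs|] := eqVneq (g (+) odd k) (d (+) odd l); last first.
  by case: (g (+) _) (d (+) _) => [] [].
case: nc; apply: compl_complementary (compl_face kl hs) _ => /=.
rewrite (@closed_seq_last _ _ l d) ?face_cellE ?eqxx // => [|j lj].
  rewrite [X in rcons X _](@closed_seq_trunc _ 0) // => j /andP[_ jn].
  by rewrite (cell_fun_lt _ jn) ffunE face_cellE eq_sym (negPf (neq_lift _ _)).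
by rewrite face_cellE -val_eqE /= gtn_eqF.
Qed.

(** * Thin fillers *)

Lemma face_hom n (C : omega_cat) (f : omega_hom (nuI n) C) (i : 'I_n) a
    (y : omega_hom (nuI n.-1) C) :
  (forall t : cell n, t i = Some a -> f (catom t) = y (catom (delete i t))) ->
  nerve_face i a f = y.
Proof.
move=> h; apply: hom_ext => t /=.
pose e : cell n := [ffun j => if unlift i j is Some j' then t j' else Some a].
have ei : e i = Some a by rewrite ffunE unlift_none.
have et : delete i e = t by apply/ffunP => j; rewrite !ffunE liftK.
by rewrite -{1}et (nu_coface_catom ei) (h e ei) et.
Qed.

Lemma hom_face n (C : omega_cat) (f : omega_hom (nuI n) C) (i : 'I_n) a
    (y : omega_hom (nuI n.-1) C) (t : cell n) :
  nerve_face i a f = y -> t i = Some a -> f (catom t) = y (catom (delete i t)).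
Proof. by move=> <- ti /=; rewrite (nu_coface_catom ti). Qed.

Lemma diagram_full n (C : omega_cat) (P : cell n -> Prop) (phi : cell n -> C) :
  (forall t, P t) -> diagram P phi -> diagram (fun=> True) phi.
Proof.
move=> h D; split=> [//|t _|t q a _ qt]; first exact: diagram_dim D _ (h t).
by apply: ev_mono (diagram_bd D a (h t) qt).
Qed.

Lemma top_source n (C : omega_cat) (x : omega_hom (nuI n) C) a : nerve_thin x ->
  x (nu_d n.-1 a (catom (top_cell n))) = x (catom (top_cell n)).
Proof.
by case=> _ /is_identityP h; rewrite ohom_d catom_top h.
Qed.

(** * Extending values to the top cell *)

Section Extension.
Variables (n : nat) (C : omega_cat) (P : cell n -> Prop) (phi : cell n -> C).
Hypothesis D : diagram P phi.

Lemma ev_face (k : 'I_n) g : P (face_cell k g) ->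
  (forall t : cell n, (deg t < n.-1)%N -> P t) ->
  (forall s (t : cell n), compl k g s t -> t != top_cell n ->
    P t /\ is_identity (deg t).-1 (phi t)) ->
  ev P phi (nu_d n.-1 (g (+) odd k) (catom (top_cell n))) (phi (face_cell k g)).
Proof.
move=> Pf low thin; have dfk := deg_face_pred k g.
have [_ e] := diagram_dim D Pf.
have := @ev_source n k g C P phi D low thin n.-1 true (phi (face_cell k g)).
rewrite nu_d_d; apply; rewrite -e dfk.
by apply: (ev_d D); apply: ev_atom.
Qed.

(** Both sides of u_n have value c, so c is a legitimate value of u_n; its lower boundaries follow
    from the sides by globularity. *)
Lemma thin_extension c : (0 < n)%N -> (forall t, P t <-> t <> top_cell n) ->
  is_identity n.-1 c -> (forall a, ev P phi (nu_d n.-1 a (catom (top_cell n))) c) ->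
  exists x : omega_hom (nuI n) C, nerve_thin x /\ forall t, P t -> x (catom t) = phi t.
Proof.
move=> n0 hP ic hc; pose phi' t := if t == top_cell n then c else phi t.
have D' : diagram (fun t => P t \/ t = top_cell n) phi'.
  apply: (diagram_extend D) => [|i a _||q a].
  - by move/hP.
  - by apply/hP => /ffunP/(_ i); rewrite !ffunE eqxx.
  - by rewrite deg_top; apply: is_identity_le ic; apply: leq_pred.
  rewrite deg_top => qn; have := ev_d D q a (hc a).
  have -> // : nu_d q a (nu_d n.-1 a (catom (top_cell n))) = nu_d q a (catom (top_cell n)).
  have := @od_odE (nuI n) q n.-1 a a (catom (top_cell n)); rewrite /= => ->.
  by case: ltnP => // h; congr nu_d; lia.
have [|x hx] := hom_ex (diagram_full _ D').
  by move=> t; have [->|/eqP/hP] := eqVneq t (top_cell n); [right|left].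
exists x; split; first by split; rewrite // -catom_top hx /phi' eqxx.
by move=> t Pt; rewrite hx /phi'; case: eqP => // /(hP t).1.
Qed.

End Extension.

(** The last closed coordinate of t is the face operation applied first, so t is read inside the
    corresponding member of the box. *)
Lemma admissible_compl (C : omega_cat) n (k : 'I_n) g (b : box (nerve C) k g)
    (phi : cell n -> C) s (t : cell n) :
  (forall (t : cell n) i a h, t i = Some a -> phi t = b i a h (catom (delete i t))) ->
  admissible_box b -> compl k g s t -> t != top_cell n ->
  is_identity (deg t).-1 (phi t).
Proof.
move=> hphi hb ct /last_closed[i [a [ti hi]]].
have h : (i, a) != (k, g).
  apply/eqP => -[ik _]; case/and3P: ct => /eqP tk _ _.
  by rewrite ik tk in ti.
have [m [w [hm hw hx]]] := word_ex (delete i t).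
have hc : complementary (op_snoc w i a) k g.
  by apply: compl_complementary ct _; rewrite /= hw (closed_seq_last ti hi).
have [_] := hb m w i a h hc.
by rewrite hx -(hphi _ _ _ h ti) hm (deg_delete ti).
Qed.

(** * Admissible shells *)

Section Shells.
Variables (C : omega_cat) (n : nat) (s : shell (nerve C) n).

Lemma shell_thin_filler : admissible_shell s ->
  exists! x : nerve C n, thin x /\ shell_filler s x.
Proof.
case=> k [l [g [d [kl nc skl hk hl]]]].
have n0 := shell_dim s.
have [|phi [D hphi]] := @partial_shell_diagram n C (fun _ _ => true) (fun i a => s i a) _
    (s k g (atom n.-1)).
  by move=> i j a b ij _ _; exact: (@shell_rel (nerve C) n s i j a b ij).
set P := covered _ in D.
have hP t : P t <-> t <> top_cell n.
  split=> [[i [a [ti _]]] e|/eqP/closed_ex[i [a ti]]]; first by rewrite e ffunE in ti.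
  by exists i, a.
have low (t : cell n) : (deg t < n.-1)%N -> P t.
  by move=> dt; apply/hP => e; rewrite e deg_top in dt; lia.
have thin k' g' : admissible_box (remove_face s k' g') ->
    forall e (t : cell n), compl k' g' e t -> t != top_cell n ->
    P t /\ is_identity (deg t).-1 (phi t).
  move=> hb e t ct tt; split; first by apply/hP/eqP.
  apply: (@admissible_compl C n k' g' (remove_face s k' g') phi e t) => //.
  by move=> u i a h ui; apply: hphi.
have Pf i a : P (face_cell i a) by exists i, a; rewrite face_cellE eqxx.
have phif i a : phi (face_cell i a) = s i a (atom n.-1).
  rewrite (hphi _ i a) ?face_cellE ?eqxx // -catom_top; congr (s i a (catom _)).
  by apply/ffunP => j; rewrite !ffunE eq_sym (negPf (neq_lift _ _)).
pose c := phi (face_cell k g).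
(* Each side of u_n has the value of the chosen face in it; the two faces lie on opposite sides and
   coincide. *)
have hc a : ev P phi (nu_d n.-1 a (catom (top_cell n))) c.
  have h1 := ev_face D (Pf k g) low (thin k g hk).
  have h2 := ev_face D (Pf l d) low (thin l d hl).
  rewrite phif -skl -phif in h2.
  have := noncomplementary_sign kl nc; rewrite -/c in h1 h2.
  by case: (g (+) _) h1 (d (+) _) h2 a => h1 [] h2 [].
have ic : is_identity n.-1 c.
  by have := diagram_dim D (Pf k g); rewrite (deg_face_pred k g).
have [x [tx hx]] := thin_extension D n0 hP ic hc.
exists x; split.
  split=> // i a; apply: face_hom => t ti; rewrite hx; first exact: hphi.
  by exists i, a.
move=> y [ty hy]; apply: hom_ext => t.
have E (z : omega_hom (nuI n) C) u : shell_filler s z -> P u -> z (catom u) = phi u.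
  move=> hz [i [a [ui _]]]; rewrite (hphi _ _ _ ui) //.
  exact: hom_face (hz i a) ui.
have T (z : omega_hom (nuI n) C) : nerve_thin z -> (forall u, P u -> z (catom u) = phi u) ->
    z (catom (top_cell n)) = c.
  by move=> tz hz; rewrite -(top_source true tz); apply: ev_hom hz (hc true).
have [->|/eqP/hP Pt] := eqVneq t (top_cell n); last by rewrite hx // E.
by rewrite !T // => u; apply: E.
Qed.

End Shells.

(** * Admissible boxes *)

Section Boxes.
Variables (C : omega_cat) (n : nat) (k : 'I_n) (g : bool) (b : box (nerve C) k g).
Hypothesis hb : admissible_box b.
Implicit Types (t : cell n) (x : omega_hom (nuI n) C).

Local Notation fk := (face_cell k g).
Local Notation alpha := (g (+) odd k).
Local Notation u := (catom (top_cell n)).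

Definition in_box t := covered (fun i a => (i, a) != (k, g)) t.

Lemma in_boxP t : in_box t <-> t <> top_cell n /\ t <> fk.
Proof.
split=> [[i [a [ti ia]]]|[nt nf]].
  split=> e; first by rewrite e ffunE in ti.
  move: ti ia; rewrite e face_cellE; case: eqP => // -> [->].
  by rewrite eqxx.
apply: contrapT => h.
have {}h i a : t i = Some a -> (i, a) = (k, g).
  by move=> ti; apply/eqP; apply: contra_notT h => ia; exists i, a.
case tk: (t k) => [a|].
  case: nf; apply/ffunP => i; rewrite face_cellE.
  case: eqP => [->|ik]; first by rewrite tk; have [->] := h k a tk.
  by case ti: (t i) => [a'|//]; have [] := h i a' ti.
case: nt; apply/ffunP => i; rewrite ffunE.
by case ti: (t i) => [a|//]; have [e _] := h i a ti; rewrite e tk in ti.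
Qed.

Lemma box_dim_gt0 : (0 < n)%N.
Proof. exact: leq_ltn_trans (leq0n k) (ltn_ord k). Qed.

Lemma in_box_low t : (deg t < n.-1)%N -> in_box t.
Proof.
have n0 := box_dim_gt0; move=> dt; apply/in_boxP; split=> e; rewrite e in dt.
  by rewrite deg_top in dt; lia.
by rewrite (deg_face_pred k g) ltnn in dt.
Qed.

Lemma compl_in_box s t : compl k g s t -> t != top_cell n -> in_box t.
Proof.
case/and3P => /eqP tk _ _ /eqP tt; apply/in_boxP; split=> // e.
by rewrite e face_cellE eqxx in tk.
Qed.

(** The adjusted sign of the missing face at k is [alpha], so it is not a term of the other side;
    all lower cells belong to the box. *)
Lemma other_side_in_box q a t : nu_d n.-1 (~~ alpha) u q a t != 0 -> in_box t.
Proof.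
rewrite /= /dchain_d; case: ltnP => [qn /cell_chain_neq0[dt _]|_].
  by apply: in_box_low; rewrite dt.
case: (q =P n.-1) => [_ /cell_chain_neq0[dt m]|_]; last by rewrite ffunE eqxx.
have n0 := box_dim_gt0; apply/in_boxP; split=> e; rewrite e in dt m.
  by rewrite deg_top in dt; lia.
have := forallP m k; rewrite ffunE face_cellE eqxx.
have fkk : fk k = Some g by rewrite face_cellE eqxx.
have ot : open_cell fk k = top_cell n.
  by apply/ffunP => j; rewrite !ffunE; case: eqP.
rewrite -deg_before_open ot deg_before_top ?(ltnW (ltn_ord k)) //.
by case: (_ (+) _).
Qed.

Lemma box_total : exists s : 'I_n -> bool -> omega_hom (nuI n.-1) C,
  forall i a h, s i a = b i a h.
Proof.
have h0 : (k, ~~ g) != (k, g) by apply/eqP => -[]; case: (g).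
(* The opposite member stands in at (k, g), where the box has no member. *)
pose s i a : omega_hom (nuI n.-1) C :=
  if pselect ((i, a) != (k, g)) is left h then b i a h else b k (~~ g) h0.
exists s => i a h; rewrite /s; case: pselect => [h'|//].
by rewrite (bool_irrelevance h' h).
Qed.

Lemma box_diagram : exists phi : cell n -> C, diagram in_box phi /\
  forall t i a h, t i = Some a -> phi t = b i a h (catom (delete i t)).
Proof.
have [s hs] := box_total.
have [|phi [D hphi]] := @partial_shell_diagram n C (fun i a => (i, a) != (k, g)) s _
    (s k g (atom n.-1)).
  move=> i j a b' ij hj hi; rewrite (hs _ _ hj) (hs _ _ hi).
  exact: (@box_rel (nerve C) n k g b i j a b' hj hi ij).
by exists phi; split=> // t i a h ti; rewrite (hphi t i a) // hs.
Qed.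

Lemma filler_catom x t i a h : box_filler b x -> t i = Some a ->
  x (catom t) = b i a h (catom (delete i t)).
Proof. by move=> hx ti; apply: hom_face (hx i a h) ti. Qed.

Lemma filler_face x : nerve_thin x -> box_filler b x -> x (catom fk) = x u.
Proof.
move=> tx hx.
have thin s t : compl k g s t -> t != top_cell n ->
    True /\ is_identity (deg t).-1 ((x \o @catom n) t).
  move=> ct tt; split=> //; apply: (admissible_compl _ hb ct tt) => e i a h.
  exact: filler_catom.
have h := @ev_face n C _ _ (diagram_hom x) k g I (fun _ _ => I) thin.
by rewrite -(top_source alpha tx) (ev_hom (fun _ _ => erefl) h).
Qed.

Lemma box_thin_filler : exists! x : nerve C n, thin x /\ box_filler b x.
Proof.
have n0 := box_dim_gt0; have dfk := deg_face_pred k g.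
have [phi [D hphi]] := box_diagram.
have [|c hc] := ev_ex D (x := nu_d n.-1 (~~ alpha) u).
  by move=> q a t; apply: other_side_in_box.
have ic : is_identity n.-1 c.
  apply: (ev_triv D hc) => q a nq.
  by rewrite /= /dchain_d ltnNge (ltnW nq) (gtn_eqF nq).
have nf : ~ in_box fk by case/in_boxP.
have thin s t : compl k g s t -> t != top_cell n ->
    in_box t /\ is_identity (deg t).-1 (phi t).
  move=> ct tt; split; first exact: compl_in_box ct tt.
  by apply: (admissible_compl _ hb ct tt) => e i a h; apply: hphi.
pose phi1 t := if t == fk then c else phi t.
have D1 : diagram (fun t => in_box t \/ t = fk) phi1.
  apply: (diagram_extend D nf) => [i a fi||q a].
  - exists i, a; rewrite ffunE eqxx; split=> //; apply/eqP => -[ik _].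
    by rewrite ik face_cellE eqxx in fi.
  - by rewrite dfk.
  rewrite dfk => qn.
  (* The missing face has no value yet, but its sides below level n - 1 involve only cells of the
     box. *)
  have [|c' hc'] := ev_ex D (x := nu_d q a (catom fk)).
    move=> r e t; rewrite /= /dchain_d => ht; apply: in_box_low.
    move: ht; case: ltnP => [rq /cell_chain_neq0[-> _]|_]; first exact: ltn_trans qn.
    by case: (r =P q) => [_ /cell_chain_neq0[-> _]|_] //; rewrite ffunE eqxx.
  (* These sides have the value of the sides of [d_{n-1}^alpha u_n], hence by globularity of those
     of the opposite side, whose value is c. *)
  have := ev_source D in_box_low thin hc'.
  have E a' : nu_d q a (nu_d n.-1 a' u) = nu_d q a u.
    by have := @od_odE (nuI n) q n.-1 a a' u; rewrite /= qn.
  rewrite E -(E (~~ alpha)) => /(ev_fun D (ev_d D q a hc)) ->.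
  exact: hc'.
have hc1 a : ev (fun t => in_box t \/ t = fk) phi1 (nu_d n.-1 a u) c.
  have [->|na] : a = alpha \/ a = ~~ alpha by case: a alpha => [] []; [left|right|right|left].
    have <- : phi1 fk = c by rewrite /phi1 eqxx.
    apply: (ev_face D1 (or_intror erefl)).
      by move=> t dt; left; apply: in_box_low.
    move=> s t ct tt; have [it] := thin s t ct tt; rewrite /phi1.
    by case: eqP => [e|_]; [case: nf; rewrite -e|split=> //; left].
  rewrite na; apply: ev_mono hc => t it; split; first by left.
  by rewrite /phi1; case: eqP => // e; case: nf; rewrite -e.
have hP t : in_box t \/ t = fk <-> t <> top_cell n.
  split=> [[/in_boxP[]//|-> e]|tt].
    have : fk k = None by rewrite e ffunE.
    by rewrite face_cellE eqxx.
  by have [->|/eqP tf] := eqVneq t fk; [right|left; apply/in_boxP].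
have [x [tx hx]] := thin_extension D1 n0 hP ic hc1.
have hx' t : in_box t -> x (catom t) = phi t.
  move=> it; rewrite hx; last by left.
  by rewrite /phi1; case: eqP => // e; case: nf; rewrite -e.
have bx : box_filler b x.
  move=> i a h; apply: face_hom => t ti; rewrite hx'; first exact: hphi.
  by exists i, a.
exists x; split=> // y [ty hy]; apply: hom_ext => t.
have E (z : omega_hom (nuI n) C) e : box_filler b z -> in_box e -> z (catom e) = phi e.
  by move=> hz [i [a [ei h]]]; rewrite (filler_catom h hz ei) (hphi _ _ _ h).
have T (z : omega_hom (nuI n) C) : nerve_thin z -> box_filler b z -> z u = c.
  move=> tz hz; rewrite -(top_source (~~ alpha) tz).
  by apply: ev_hom hc => e; apply: E.
have [->|/eqP/hP[it|->]] := eqVneq t (top_cell n); first by rewrite !T.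
  by rewrite !E.
by rewrite !filler_face // !T.
Qed.

Lemma box_thin_face x : nerve_thin x -> box_filler b x ->
  (forall i a h, nerve_thin (b i a h)) -> nerve_thin (nerve_face k g x).
Proof.
move=> tx hx tb; have n0 := box_dim_gt0; have dfk := deg_face_pred k g.
have h0 : (k, ~~ g) != (k, g) by apply/eqP => -[]; case: (g).
(* Thinness of the member opposite to the missing face excludes n = 1. *)
have [n1 _] := tb _ _ h0; split=> //.
have -> : nerve_face k g x (atom n.-1) = x (catom fk).
  have fkk : fk k = Some g by rewrite face_cellE eqxx.
  rewrite -(nu_coface_catom fkk) -catom_top /=; congr (x (nu_coface_fun _ _ (catom _))).
  by apply/ffunP => j; rewrite !ffunE eq_sym (negPf (neq_lift _ _)).
(* The value of the missing face is that of the side not containing it, whose (n-1)-cells are thin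
   members of the box. *)
rewrite filler_face // -(top_source (~~ alpha) tx).
apply: (ev_thin (diagram_hom x) (ev_homT x _)).
  rewrite prednK // => q a nq.
  by rewrite /= /dchain_d ltnNge (ltnW nq) (gtn_eqF nq).
move=> t a ht; have dt := nu_homog ht; rewrite prednK // in dt.
have [i [a' [ti h]]] := other_side_in_box ht.
rewrite /= (filler_catom h hx ti) (@deg_eq_top _ (delete i t)) ?catom_top.
  by have [] := tb i a' h.
by rewrite (deg_delete ti).
Qed.

End Boxes.

Theorem theorem3p16 (C : omega_cat) : complete (nerve C).
Proof.
split=> [n k g b hb|n s hs|n k g b x hb tx hx tb].
- exact: box_thin_filler.
- exact: shell_thin_filler.
exact: box_thin_face hb _ tx hx tb.
Qed.
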